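(* Let $H\in(0,1)$ and $\kappa\in(0,\infty)$. Let $\{X_n\}_{n\in\mathbb N}$ and $\{Y_n\}_{n\in\mathbb N}$ be two independent sequences of random variables. Write $S_0=0$, $S_n=X_1+\cdots+X_n$, and $M_0=0$, $M_n=\max_{i=1,\dots,n}(S_i+Y_i)$ for $n\in\mathbb N$. Suppose that $$\left\{\frac{S_{\lfloor nt\rfloor}}{n^H}\right\}_{t\in[0,1]}\Rightarrow\{\mathbb B^H_t\}_{t\in[0,1]}\quad\text{as } n\to\infty$$ weakly in the space $D[0,1]$ (with the Skorohod $J_1$ topology), where $\mathbb B^H$ is the fractional Brownian motion with Hurst index $H$, and suppose that $\{Y_n\}_{n\in\mathbb N}$ are i.i.d. random variables with $$\mathbb P(Y_1>x)\sim\kappa x^{-1/H}\quad\text{as } x\to\infty .$$ Then $$\left\{\frac{M_{\lfloor nt\rfloor}}{n^H}\right\}_{t\in[0,1]}\Rightarrow\{Z^H_t\}_{t\in[0,1]}\quad\text{as } n\to\infty$$ weakly in $D[0,1]$ equipped with the Skorohod $J_1$ topology, where $$Z^H_t=\sup_{s\in[0,t]}\left(\mathbb B^H_s+\kappa^H\sum_{i=1}^\infty\eta_i\mathbf 1_{\{U_i=s\}}\right),$$ and $\{(\eta_i,U_i)\}_{i\in\mathbb N}$ is a Poisson point process on $(0,\infty)\times[0,\infty)$ with intensity $H^{-1}x^{-1-1/H}\,dx\,du$, defined on the same probability space as $\mathbb B^H$ and independent of it.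
   Context: $D[0,1]$ is the space of càdlàg real functions on $[0,1]$; $\Rightarrow$ denotes weak convergence (convergence in distribution). The fractional Brownian motion $\mathbb B^H=\{\mathbb B^H_t\}_{t\ge0}$ with Hurst index $H\in(0,1)$ is the zero-mean Gaussian process with covariance $\mathrm{Cov}(\mathbb B^H_s,\mathbb B^H_t)=\tfrac12(s^{2H}+t^{2H}-|s-t|^{2H})$, $s,t\ge 0$; it is assumed throughout to have continuous sample paths. No stationarity or independence of $\{X_n\}$ is assumed beyond the stated invariance principle, and $Y_n$ may take negative values. *)

(* Defs.v *)
From HB Require Import structures.
From mathcomp Require Import all_boot all_order all_algebra.
From mathcomp Require Import finmap.
From mathcomp Require Import all_classical all_reals all_analysis.
From mathcomp Require Import measurable_realfun.

Set Implicit Arguments.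
Unset Strict Implicit.
Unset Printing Implicit Defensive.

Import Order.TTheory GRing.Theory Num.Theory.
Import numFieldNormedType.Exports.

Local Open Scope classical_set_scope.
Local Open Scope ring_scope.

Section skorohod_space.
Context {R : realType}.
Implicit Types (f g l : R -> R) (e : R).

Definition cadlag01 f : Prop :=
  (forall t : R, t \in `[0, 1[ -> f x @[x --> t^'+] --> f t) /\
  (forall t : R, t \in `]0, 1] -> cvg (f x @[x --> t^'-])).

Definition time_change l : Prop :=
  [/\ {in `[0, 1] &, {homo l : s t / s < t}},
      {within `[0, 1], continuous l} &
      l @` `[0, 1] = `[0, 1]%classic].

(* The set of [g] at J1-distance less than [e] from [f], up to replacing the
   strict pointwise bounds by strict bounds on the suprema; this changes neither
   the uniform structure nor the topology. *)
Definition J1_ball f e g : Prop :=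
  exists2 l, time_change l & forall t : R, t \in `[0, 1] ->
    `|l t - t| < e /\ `|f t - g (l t)| < e.

Lemma time_change_intro l :
  {in `[0, 1] &, {homo l : s t / s < t}} -> l @` `[0, 1] = `[0, 1]%classic ->
  time_change l.
Proof.
move=> lincr limg; split => //.
have lle : {in `[0, 1] &, {mono l : x y / x <= y}}
  by exact: (@le_mono_in _ _ _ _ (mem `[0, 1])) lincr.
have i0 : (0 : R) \in `[0, 1] by rewrite bound_itvE.
have i1 : (1 : R) \in `[0, 1] by rewrite bound_itvE.
have lin t : t \in `[0, 1] -> l t \in `[0, 1].
  move=> t01; have : (l @` `[0, 1]) (l t) by exists t.
  by rewrite limg.
have lsurj s : s \in `[0, 1] -> exists2 t, t \in `[0, 1] & l t = s.
  by move=> s01; have : `[0, 1]%classic s by []; rewrite -limg => -[t]; exists t.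
have inP (t : R) : t \in `[0, 1] = (0 <= t <= 1) by rewrite in_itv.
have l0 : l 0 = 0.
  have [t t01 lt0] := lsurj _ i0; apply/le_anti/andP; split.
    by rewrite -[leRHS]lt0 lle//; move: t01; rewrite inP => /andP[].
  by have := lin _ i0; rewrite inP => /andP[].
have l1 : l 1 = 1.
  have [t t01 lt1] := lsurj _ i1; apply/le_anti/andP; split.
    by have := lin _ i1; rewrite inP => /andP[].
  by rewrite -[leLHS]lt1 lle//; move: t01; rewrite inP => /andP[].
apply: segment_inc_surj_continuous => //.
by rewrite l0 l1 => s s01; rewrite limg.
Qed.

Lemma time_change_in l t : time_change l -> t \in `[0, 1] -> l t \in `[0, 1].
Proof.
move=> [_ _ limg] t01; have : (l @` `[0, 1]) (l t) by exists t.
by rewrite limg.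
Qed.

Lemma time_change_id : time_change id.
Proof. by apply: time_change_intro => //; rewrite image_id. Qed.

Lemma time_change_comp l1 l2 :
  time_change l1 -> time_change l2 -> time_change (l2 \o l1).
Proof.
move=> tc1 tc2; have [i1 _ im1] := tc1; have [i2 _ im2] := tc2.
apply: time_change_intro => [s t s01 t01 st /=|].
  by apply: i2; [exact: time_change_in|exact: time_change_in|exact: i1].
by rewrite -image_comp im1 im2.
Qed.

Lemma time_change_inv l : time_change l ->
  exists k, [/\ time_change k, {in `[0, 1], cancel l k} &
                {in `[0, 1], cancel k l}].
Proof.
move=> tc; have [li _ limg] := tc.
have lle : {in `[0, 1] &, {mono l : x y / x <= y}}
  by exact: (@le_mono_in _ _ _ _ (mem `[0, 1])) li.
have llt := leW_mono_in lle.
have linj := inc_inj_in lle.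
have ex s : exists t, s \in `[0, 1] -> t \in `[0, 1] /\ l t = s.
  have [s01|] := boolP (s \in `[0, 1]); last by exists 0.
  by have : `[0, 1]%classic s by []; rewrite -limg => -[t t01 <-]; exists t.
have [k kP] := choice ex.
have kin s : s \in `[0, 1] -> k s \in `[0, 1] by move=> /kP[].
have lk : {in `[0, 1], cancel k l} by move=> s /kP[].
have kl : {in `[0, 1], cancel l k}.
  move=> t t01; apply: linj => //; first exact/kin/time_change_in.
  by rewrite lk//; exact: time_change_in.
exists k; split => //; apply: time_change_intro.
  by move=> s t s01 t01 st; rewrite -llt ?kin// !lk.
apply/seteqP; split => [_ [s s01 <-]|t t01] /=; first exact: kin.
by exists (l t); [exact: time_change_in|exact: kl].
Qed.

Lemma J1_ball_center f e : 0 < e -> J1_ball f e f.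
Proof.
move=> e0; exists id; first exact: time_change_id.
by move=> t _; rewrite !subrr !normr0.
Qed.

Lemma J1_ball_sym f g e : J1_ball f e g -> J1_ball g e f.
Proof.
move=> [l tc lP]; have [k [tck lK kK]] := time_change_inv tc.
exists k => // t t01; have [] := lP (k t) (time_change_in tck t01).
by rewrite kK// distrC (distrC (f _)).
Qed.

Lemma J1_ball_triangle f g h e1 e2 :
  J1_ball f e1 g -> J1_ball g e2 h -> J1_ball f (e1 + e2) h.
Proof.
move=> [l1 tc1 P1] [l2 tc2 P2]; exists (l2 \o l1).
  exact: time_change_comp.
move=> t t01 /=; have [a1 b1] := P1 _ t01.
have [a2 b2] := P2 _ (time_change_in tc1 t01); split.
  by rewrite (addrC e1); apply: le_lt_trans (ler_distD (l1 t) _ _) _; exact: ltrD.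
by apply: le_lt_trans (ler_distD (g (l1 t)) _ _) _; exact: ltrD.
Qed.

End skorohod_space.

(* The space D[0,1]. Elements are functions on the whole line, but neither the
   càdlàg condition nor the balls look outside [0,1]: two elements with the same
   restriction to [0,1] lie in the same neighbourhoods, so that a continuous
   functional only depends on this restriction. *)
Record D01 (R : realType) := MkD01 {
  D01_fun :> R -> R ;
  D01_cadlag : cadlag01 D01_fun }.

Section J1_topology.
Context {R : realType}.

HB.instance Definition _ := gen_eqMixin (D01 R).
HB.instance Definition _ := gen_choiceMixin (D01 R).

Let ball (f : D01 R) (e : R) (g : D01 R) : Prop := J1_ball f e g.

Let ball_center (f : D01 R) (e : R) : 0 < e -> ball f e f.
Proof. exact: J1_ball_center. Qed.

Let ball_sym (f g : D01 R) (e : R) : ball f e g -> ball g e f.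
Proof. exact: J1_ball_sym. Qed.

Let ball_triangle (f g h : D01 R) (e1 e2 : R) :
  ball f e1 g -> ball g e2 h -> ball f (e1 + e2) h.
Proof. exact: J1_ball_triangle. Qed.

HB.instance Definition _ := @hasNbhs.Build (D01 R) (nbhs_ (entourage_ ball)).
HB.instance Definition _ := @Nbhs_isPseudoMetric.Build R (D01 R)
  (entourage_ ball) erefl ball ball_center ball_sym ball_triangle erefl.

Lemma cadlag01_cst (c : R) : cadlag01 (cst c).
Proof. by split=> t _; [exact: cvg_cst|exact: is_cvg_cst]. Qed.

(* Used on paths that are càdlàg outside of a null set. *)
Definition toD (f : R -> R) : D01 R :=
  match pselect (cadlag01 f) with
  | left h => MkD01 h
  | right _ => MkD01 (cadlag01_cst 0)
  end.

End J1_topology.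

Section weak_convergence.
Context {R : realType}.

(* The Borel sigma-algebra of the J1 topology is generated by the evaluations
   at the points of [0,1]. *)
Definition D01_process (d : measure_display) (T : measurableType d)
    (P : probability T R) (X : R -> T -> R) : Prop :=
  (forall t : R, t \in `[0, 1] -> measurable_fun setT (X t)) /\
  {ae P, forall w, cadlag01 (X ^~ w)}.

Definition cvg_in_distr_D01 (d d' : measure_display) (T : measurableType d)
    (T' : measurableType d') (P : probability T R) (P' : probability T' R)
    (X : nat -> R -> T -> R) (Z : R -> T' -> R) : Prop :=
  [/\ forall n, D01_process P (X n),
      D01_process P' Z &
      forall F : D01 R -> R, continuous F ->
        (exists M : R, forall f, `|F f| <= M) ->
        'E_P[fun w => F (toD (X n ^~ w))]%E @[n --> \oo] -->
        'E_P'[fun w => F (toD (Z ^~ w))]%E].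

End weak_convergence.

Section independence.
Context {R : realType} (d : measure_display) (T : measurableType d).
Variable P : probability T R.

Definition sigma_family (d' : measure_display) (E : measurableType d')
    (I : Type) (D : set I) (X : I -> T -> E) : set (set T) :=
  <<s \bigcup_(i in D) preimage_set_system setT (X i) measurable >>.

Definition independent_sigma (F G : set (set T)) : Prop :=
  forall A B, F A -> G B -> P (A `&` B) = (P A * P B)%E.

Definition mutually_independent (d' : measure_display) (E : measurableType d')
    (X : nat -> T -> E) : Prop :=
  forall (J : {fset nat}) (A : nat -> set E), (forall i, measurable (A i)) ->
    P (\bigcap_(i in [set` J]) (X i @^-1` A i)) =
    (\prod_(i <- J) P (X i @^-1` A i))%E.

Definition identically_distributed (d' : measure_display)
    (E : measurableType d') (X : nat -> T -> E) : Prop :=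
  forall i (A : set E), measurable A -> P (X i @^-1` A) = P (X 0%N @^-1` A).

End independence.

Section gaussian.
Context {R : realType} (d : measure_display) (T : measurableType d).
Variable P : probability T R.

(* [normal_prob m 0] is not the Dirac mass at [m]. *)
Definition gaussian_rv (X : T -> R) : Prop :=
  measurable_fun setT X /\
  exists m s : R, 0 <= s /\
    forall A : set R, measurable A ->
      P (X @^-1` A) = if s == 0 then \d_m A else normal_prob m s A.

Definition gaussian_process (X : R -> T -> R) : Prop :=
  forall (n : nat) (a t : 'I_n -> R), (forall i, 0 <= t i) ->
    gaussian_rv (fun w => \sum_(i < n) a i * X (t i) w).

(* Only the times [t >= 0] are constrained. *)
Definition fractional_brownian_motion (H : R) (B : R -> T -> R) : Prop :=
  [/\ gaussian_process B,
      forall t : R, 0 <= t -> ('E_P[B t] = 0)%E,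
      forall s t : R, 0 <= s -> 0 <= t ->
        covariance P (B s) (B t) =
        (2^-1 * (s `^ (2 * H) + t `^ (2 * H) - `|s - t| `^ (2 * H)))%:E &
      forall w, {within `[0, +oo[, continuous (B ^~ w)}].

End gaussian.

Section poisson_point_process.
Context {R : realType} (d : measure_display) (T : measurableType d).
Variable P : probability T R.

Definition point_count (eta U : nat -> T -> R) (A : set (R * R)) (w : T) :
    \bar R :=
  (\sum_(0 <= i <oo) (\1_A (eta i w, U i w))%:E)%E.

(* The enumeration of the points is an arbitrary measurable one. The third
   clause writes out the Poisson law, because [poisson_pmf 0] is not the mass
   function of the law with parameter 0. *)
Definition poisson_point_process (S : set (R * R)) (nu : set (R * R) -> \bar R)
    (eta U : nat -> T -> R) : Prop :=
  [/\ forall i, measurable_fun setT (eta i) /\ measurable_fun setT (U i),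
      forall i w, S (eta i w, U i w),
      forall A, measurable A -> A `<=` S -> (nu A < +oo)%E ->
        forall k : nat, P [set w | point_count eta U A w = k%:R%:E] =
          (fine (nu A) ^+ k / k`!%:R * expR (- fine (nu A)))%:E,
      forall A, measurable A -> A `<=` S -> nu A = +oo%E ->
        P [set w | point_count eta U A w = +oo%E] = 1%E &
      forall A : nat -> set (R * R),
        (forall i, measurable (A i) /\ A i `<=` S) -> trivIset setT A ->
        mutually_independent P (fun i => point_count eta U (A i))].

Definition points_sigma (S : set (R * R)) (eta U : nat -> T -> R) :
    set (set T) :=
  sigma_family [set A | measurable A /\ A `<=` S] (point_count eta U).

End poisson_point_process.

Section model.
Context {R : realType}.

Definition point_space : set (R * R) := `]0, +oo[ `*` `[0, +oo[.

Definition jump_intensity (H : R) (A : set (R * R)) : \bar R :=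
  (\int[lebesgue_measure \x lebesgue_measure]_(z in A)
     (H^-1 * z.1 `^ (- 1 - H^-1))%:E)%E.

(* Sequences are indexed from 0: [X i] stands for the variable of index i + 1. *)
Definition walk (T : Type) (X : nat -> T -> R) (n : nat) (w : T) : R :=
  \sum_(i < n) X i w.

Definition perturbed_max (T : Type) (X Y : nat -> T -> R) (n : nat) (w : T) :
    R :=
  if n is m.+1 then
    \big[Num.max/X 0%N w + Y 0%N w]_(i < m.+1) (walk X i.+1 w + Y i w)
  else 0.

Definition rescaled (T : Type) (H : R) (V : nat -> T -> R) (n : nat) (t : R)
    (w : T) : R :=
  V (Num.truncn (n%:R * t)) w / n%:R `^ H.

(* The series and the supremum are computed in the extended reals; almost surely
   both are finite. *)
Definition Z_process (T : Type) (H kappa : R) (B : R -> T -> R)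
    (eta U : nat -> T -> R) (t : R) (w : T) : R :=
  fine (ereal_sup [set ((B s w)%:E + (kappa `^ H)%:E *
    \sum_(0 <= i <oo) (eta i w * \1_[set s] (U i w))%:E)%E | s in `[0, t]]).

End model.

(* Main.v *)
(* Cut [0,1] into m cells. Outside an event of small probability, the rescaled
   maxima and the limit Z are J1-close to one and the same functional of two
   ingredients: the driving path (the rescaled walk, resp. B) and, for each cell,
   the largest mark in it, rounded down to a multiple of e and capped at e N. The
   functional is the running maximum over the grid points of path value plus
   rounded mark: with high probability no cell carries two marks above e, so that
   a small time change moves the large mark to the end of its cell, and the path
   hardly oscillates over a cell. To make the functional J1-continuous in the
   path, path values are replaced by sup-convolutions sup_s (f s - K |s - t|).

   The rounded marks take finitely many values, are independent of the path, and
   their law converges because of the Poisson limit for the i.i.d. heavy tails;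
   hence the approximants converge in distribution. The conclusion passes to the
   processes themselves through J1-Lipschitz test functionals, from which bounded
   continuous ones are recovered as increasing limits of inf-convolutions. *)
Require Import Defs.
From mathcomp Require Import all_boot all_order all_algebra.
From mathcomp Require Import finmap.
From mathcomp Require Import all_classical all_reals all_analysis.
From mathcomp Require Import measurable_realfun.
From mathcomp Require Import ring lra.

Set Implicit Arguments.
Unset Strict Implicit.
Unset Printing Implicit Defensive.

Import Order.TTheory GRing.Theory Num.Theory.
Import numFieldNormedType.Exports.

Local Open Scope classical_set_scope.
Local Open Scope ring_scope.

(** * Time changes and running maxima *)

(** The parameters are chosen in the order accuracy [e], slope [K], cap [N], grid size [m]; only
    then does [n] go to infinity. A path with [|f s - f t| <= e + K |s - t|] varies by at most [2 e]
    over a cell once [K <= e m]. This property is detected by a J1-Lipschitz functional, so that it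
    passes from [B] to the rescaled walk without a tightness argument. Negative perturbations make
    the two sides asymmetric: the limit dominates [B] at all times, whereas the maximum dominates
    the walk only where the perturbation is not too negative. As paths are compared at grid points,
    only [m + 1] perturbations have to be controlled, and each is below [- e n^H] with vanishing
    probability. The limit is only almost surely càdlàg, and nothing is known beforehand on the
    measurability of functionals of it. Both points are settled through the approximants, along a
    summable sequence of accuracies; until then means of possibly non-measurable bounded functions
    have to be handled. *)

Section time_change_interpolation.
Context {R : realType}.
Variables (m : nat) (q : nat -> R).
Hypotheses (m0 : (0 < m)%N) (q0 : q 0%N = 0) (qm : q m = 1)
  (qS : forall j, (j < m)%N -> q j < q j.+1).

(* Sends [j / m] to [q j]. *)
Definition interpolate (s : R) : R :=
  let j := Num.truncn (m%:R * s) in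
  q j + (m%:R * s - j%:R) * (q j.+1 - q j).

Lemma node_le i j : (i <= j <= m)%N -> q i <= q j.
Proof.
move=> /andP[]; elim: j => [|j IH]; first by rewrite leqn0 => /eqP ->.
rewrite leq_eqVlt => /orP[/eqP ->//|ij jm].
by apply: le_trans (IH ij (ltnW jm)) (ltW (qS jm)).
Qed.

Lemma truncn_scaled_lt (s : R) : 0 <= s < 1 -> (Num.truncn (m%:R * s) < m)%N.
Proof.
move=> /andP[s0 s1]; rewrite truncn_lt_nat; last by rewrite mulr_ge0.
by rewrite gtr_pMr// ltr0n.
Qed.

Lemma interpolate1 : interpolate 1 = 1.
Proof. by rewrite /interpolate mulr1 natrK subrr mul0r addr0. Qed.

Lemma interpolate_cell (s : R) : 0 <= s < 1 ->
  q (Num.truncn (m%:R * s)) <= interpolate s < q (Num.truncn (m%:R * s)).+1.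
Proof.
move=> s01; have jm := truncn_scaled_lt s01; move: s01 => /andP[s0 s1].
have ms0 : 0 <= m%:R * s by rewrite mulr_ge0.
have /andP[tl tr] := truncn_itv ms0.
rewrite /interpolate; set j := Num.truncn _ in jm tl tr *.
have dq : 0 < q j.+1 - q j by rewrite subr_gt0 qS.
rewrite lerDl mulr_ge0 ?subr_ge0//=; last exact/ltW/qS.
rewrite -ltrBrDl gtr_pMl// ltrBlDl.
by move: tr; rewrite -natr1 addrC.
Qed.

Lemma interpolate_homo : {in `[0, 1] &, {homo interpolate : s t / s < t}}.
Proof.
move=> s t; rewrite !in_itv /= => /andP[s0 s1] /andP[t0 t1] st.
have s01 : 0 <= s < 1 by rewrite s0 (lt_le_trans st).
have /andP[sl sr] := interpolate_cell s01.
have jm := truncn_scaled_lt s01.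
have [t1'|t1'] := eqVneq t 1.
  rewrite t1' interpolate1; apply: lt_le_trans sr _.
  by rewrite -[leRHS]qm; apply: node_le; apply/andP; split.
have t01 : 0 <= t < 1 by rewrite t0 lt_neqAle t1'.
have /andP[tl tr] := interpolate_cell t01.
have jm' := truncn_scaled_lt t01.
have /le_truncn : m%:R * s <= m%:R * t by rewrite ler_pM2l ?ltr0n// ltW.
rewrite leq_eqVlt => /orP[/eqP e|lt]; last first.
  by apply: lt_le_trans sr (le_trans _ tl); rewrite node_le// lt ltnW.
rewrite /interpolate -e ltrD2l ltr_pM2r ?subr_gt0 ?qS//.
by rewrite ltrD2r ltr_pM2l ?ltr0n.
Qed.

Lemma interpolate_time_change : time_change interpolate.
Proof.
apply: time_change_intro; first exact: interpolate_homo.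
apply/seteqP; split => [_ [s /= + <-]|t /=]; rewrite !in_itv /= => /andP[l0 l1].
  have [->|s1] := eqVneq s 1; first by rewrite interpolate1 lexx ler01.
  have s01 : 0 <= s < 1 by rewrite l0 lt_neqAle s1.
  have /andP[sl sr] := interpolate_cell s01; have jm := truncn_scaled_lt s01.
  apply/andP; split.
    by apply: le_trans sl; rewrite -[leLHS]q0; apply: node_le; rewrite leq0n ltnW.
  by apply: le_trans (ltW sr) _; rewrite -[leRHS]qm; apply: node_le; apply/andP; split.
have [->|t1] := eqVneq t 1.
  by exists 1; [rewrite in_itv /= lexx ler01|exact: interpolate1].
have lt1 : t < 1 by rewrite lt_neqAle t1.
(* The piece containing [t] ends at the first node beyond [t], which is not node 0 because
   [q 0 = 0 <= t]. *)
have [j jm /andP[jl jr]] : exists2 j, (j < m)%N & q j <= t < q j.+1.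
  have tqm : t < q m by rewrite qm.
  case: (@ex_minnP (fun j => t < q j) (ex_intro _ m tqm)) => -[|j] tj jmin.
    by move: tj; rewrite q0 ltNge l0.
  exists j; first exact: jmin.
  by rewrite tj andbT leNgt; apply/negP => /jmin; rewrite ltnn.
have dq : 0 < q j.+1 - q j by rewrite subr_gt0 qS.
pose x := (t - q j) / (q j.+1 - q j).
have x0 : 0 <= x by rewrite divr_ge0 ?subr_ge0// ltW// qS.
have x1 : x < 1 by rewrite ltr_pdivrMr// mul1r ltrD2r.
have mR : 0 < m%:R :> R by rewrite ltr0n.
exists ((j%:R + x) / m%:R).
  rewrite in_itv /= divr_ge0 ?addr_ge0//= ler_pdivrMr// mul1r.
  apply: le_trans (_ : j.+1%:R <= _); last by rewrite ler_nat.
  by rewrite -natr1 lerD2l ltW.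
rewrite /interpolate mulrCA divff ?lt0r_neq0// mulr1.
rewrite (_ : Num.truncn _ = j); last first.
  by apply: truncn_def; rewrite lerDl x0 /= -natr1 ltrD2l.
by rewrite addrAC subrr add0r divfK ?lt0r_neq0// addrC subrK.
Qed.

(** Node [q j] lies in the cell ending at [j / m], so on [[j / m, (j + 1) / m[] the interpolation
    stays between [(j - 1) / m] and [(j + 1) / m]. *)
Lemma interpolate_close (s : R) :
  (forall j, (0 < j <= m)%N -> j%:R - 1 < m%:R * q j <= j%:R) ->
  s \in `[0, 1] -> `|interpolate s - s| <= 2 / m%:R.
Proof.
move=> qj; rewrite in_itv /= => /andP[s0 s1].
have mR : 0 < m%:R :> R by rewrite ltr0n.
have [->|s1'] := eqVneq s 1; first by rewrite interpolate1 subrr normr0 divr_ge0.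
have s01 : 0 <= s < 1 by rewrite s0 lt_neqAle s1'.
have /andP[sl sr] := interpolate_cell s01; have jm := truncn_scaled_lt s01.
have ms0 : 0 <= m%:R * s by rewrite mulr_ge0.
have /andP[tl tr] := truncn_itv ms0.
set j := Num.truncn _ in jm tl tr sl sr.
have h1 : m%:R * q j.+1 <= j%:R + 1.
  by have := qj j.+1 jm; rewrite -natr1 => /andP[].
have h2 : j%:R - 1 <= m%:R * q j.
  have [->|j0] := posnP j; first by rewrite q0 mulr0 lerBlDr add0r ler01.
  by have := qj j; rewrite j0 (ltnW jm) => /(_ isT) /andP[/ltW].
have h3 : m%:R * interpolate s <= m%:R * q j.+1 by rewrite ler_pM2l ?ltW.
have h4 : m%:R * q j <= m%:R * interpolate s by rewrite ler_pM2l.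
rewrite ler_pdivlMr// mulrC -[X in X * _](ger0_norm (ltW mR)).
rewrite -normrM ler_norml mulrBr; move: tl tr; rewrite -natr1 => tl tr.
by apply/andP; split; lra.
Qed.

End time_change_interpolation.

Lemma le_or_lt {R : realType} (x y : R) : x <= y \/ y < x.
Proof. by case: leP; [left|right]. Qed.

Section running_max.
Context {R : realType}.
Implicit Types a b u : nat -> R.

Definition runmax a (k : nat) : R := \big[Num.max/a 0%N]_(i < k.+1) a i.

Lemma le_runmax a i k : (i <= k)%N -> a i <= runmax a k.
Proof.
rewrite -ltnS => ik.
exact: (le_bigmax (a 0%N) (fun i : 'I_k.+1 => a i) (Ordinal ik)).
Qed.

Lemma runmax_le a k x : (forall i, (i <= k)%N -> a i <= x) -> runmax a k <= x.
Proof. by move=> ax; apply: bigmax_le => [|i _]; apply: ax; rewrite // -ltnS. Qed.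

Lemma runmax_dist a b k e : (forall i, (i <= k)%N -> `|a i - b i| <= e) ->
  `|runmax a k - runmax b k| <= e.
Proof.
move=> ab; rewrite ler_norml; apply/andP; split.
  rewrite lerBrDl lerBlDr; apply: runmax_le => i ik.
  have := ab _ ik; have := le_runmax a ik; rewrite ler_norml => ? /andP[]; lra.
rewrite lerBlDr; apply: runmax_le => i ik.
have := ab _ ik; have := le_runmax b ik; rewrite ler_norml => ? /andP[]; lra.
Qed.

Definition step_path m a (t : R) : R := runmax a (Num.truncn (m%:R * t)).

(** The interpolation carries [[j / m, (j + 1) / m[], on which the step path is constant, onto [[q
    j, q j.+1[]; time 1 is fixed and treated apart. The gap between [e0] and [e] supplies the strict
    inequality of the ball. *)
Lemma J1_step_path m (q a : nat -> R) (Z : R -> R) e0 e : (0 < m)%N ->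
  q 0%N = 0 -> q m = 1 -> (forall j, (j < m)%N -> q j < q j.+1) ->
  (forall j, (0 < j <= m)%N -> j%:R - 1 < m%:R * q j <= j%:R) ->
  (forall j (t : R), (j < m)%N -> q j <= t < q j.+1 -> `|runmax a j - Z t| <= e0) ->
  `|runmax a m - Z 1| <= e0 -> e0 < e -> 2 / m%:R < e ->
  J1_ball (step_path m a) e Z.
Proof.
move=> m0 q0 qm qS qj H H1 e0e me; exists (interpolate m q).
  exact: interpolate_time_change.
move=> t t01; split; first exact: le_lt_trans (interpolate_close _ _ _ _ _ t01) _.
apply: le_lt_trans e0e.
have [->|t1] := eqVneq t 1.
  by rewrite interpolate1// /step_path mulr1 natrK.
have {}t01 : 0 <= t < 1.
  by move: t01; rewrite in_itv /= lt_neqAle t1.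
by apply: H; [exact: truncn_scaled_lt|exact: interpolate_cell].
Qed.

End running_max.

(** For decreasing [Q], this is the length of the initial segment of indices at which [Q] holds,
    capped at [N]. *)
Definition levels (N : nat) (Q : nat -> Prop) : nat := (\sum_(k < N) `[< Q k >])%N.

Lemma levelsP N (Q : nat -> Prop) : (forall k, Q k.+1 -> Q k) ->
  forall k, (k < N)%N -> (Q k <-> (k < levels N Q)%N).
Proof.
move=> Qd.
have Qle i j : (i <= j)%N -> Q j -> Q i.
  by elim: j => [|j IH]; [rewrite leqn0 => /eqP ->|rewrite leq_eqVlt ltnS =>
    /orP[/eqP ->//|/IH IHj /Qd]].
have levle n : (levels n Q <= n)%N.
  elim: n => [|n IH]; first by rewrite /levels big_ord0.
  rewrite /levels big_ord_recr /= -addn1; apply: leq_add => //.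
  by case: asboolP.
have levall n : Q n -> levels n Q = n.
  elim: n => [|n IH] Qn; first by rewrite /levels big_ord0.
  rewrite /levels big_ord_recr /= (_ : (\sum_(_ < _) _)%N = levels n Q)// IH; last exact: Qd.
  by rewrite (asboolT (Qd _ Qn)) addn1.
elim: N => // N IH k; rewrite ltnS => kN.
rewrite /levels big_ord_recr /= (_ : (\sum_(_ < _) _)%N = levels N Q)//.
case: asboolP => QN.
  rewrite levall// addn1 ltnS kN; split => // _; exact: Qle QN.
rewrite addn0; move: kN; rewrite leq_eqVlt => /orP[/eqP ->|/IH//].
by split => //; rewrite ltnNge levle.
Qed.

Lemma levels_le N (Q : nat -> Prop) : (levels N Q <= N)%N.
Proof.
rewrite /levels -[leqRHS]card_ord -sum1_card; apply: leq_sum => i _.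
by case: asboolP.
Qed.

(** * Pathwise comparison with the discretized maximum *)

Section discretized_maximum.
Context {R : realType}.

Definition in_cell (m j : nat) (p : R) : Prop := j%:R < m%:R * p <= j.+1%:R.

(** Thresholds start at [dl]: marks of height at most [dl], negative ones included, have level 0. A
    largest mark [v] above that is recorded as the [c] with [dl * c < v <= dl * c.+1], unless the
    cap intervenes. *)
Definition cell_levels m N (dl : R) (E : R -> R -> Prop) (j : nat) : nat :=
  levels N (fun k => exists p v, [/\ E p v, in_cell m j p & dl * k.+1%:R < v]).

(** The mark of cell [j] is attached to its right end, grid point [j.+1]; grid point 0 closes no
    cell. *)
Definition bumped (dl : R) (u : nat -> R) (c : nat -> nat) (i : nat) : R :=
  if i is j.+1 then u i + dl * (c j)%:R else u 0%N.

(* [E p v] says that a mark of height [v] sits at time [p]. The time change moves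
   the unique large mark of each cell to the right end of the cell; it fixes 1,
   so that [Elast] has to exclude large marks from the last cell. *)
Variables (m N : nat) (e K : R) (b Z : R -> R) (u : nat -> R) (E : R -> R -> Prop).
Hypotheses (m0 : (0 < m)%N) (e0 : 0 < e) (K0 : 0 <= K) (Km : K <= e * m%:R)
  (me : 2 / m%:R < 7 * e)
  (bK : forall s t : R, s \in `[0, 1] -> t \in `[0, 1] -> b s - b t <= e + K * `|s - t|)
  (ub : forall j, (j <= m)%N -> b (j%:R / m%:R) <= u j <= b (j%:R / m%:R) + e)
  (E01 : forall p v, E p v -> e < v -> 0 < p <= 1)
  (Euniq : forall j p v p' v', in_cell m j p -> in_cell m j p' ->
     E p v -> E p' v' -> e < v -> e < v' -> p = p')
  (Elast : forall p v, E p v -> e < v -> ~ in_cell m m.-1 p)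
  (EN : forall p v, E p v -> v <= e * N.+1%:R)
  (ZU : forall t : R, t \in `[0, 1] -> exists s v : R,
     [/\ 0 <= s <= t, v <= e \/ E s v & Z t <= b s + v + e])
  (ZE : forall s v t : R, E s v -> e < v -> s <= t <= 1 -> b s + v <= Z t + 3 * e)
  (ZG : forall j (t : R), (j <= m)%N -> j%:R / m%:R <= t <= 1 ->
     b (j%:R / m%:R) <= Z t + 3 * e).

(** The error [6 * e] consists of [3 * e] for replacing the path at a mark by [u] at the end of its
    cell ([e] from [ub], [2 * e] from the oscillation over a cell) and of the [3 * e] allowed in
    [ZE]; the seventh [e] makes the inequality strict. The hypotheses on [Z] are those that the
    limit and the rescaled maxima have in common. *)
Lemma J1_discretized_maximum :
  J1_ball (step_path m (bumped e u (cell_levels m N e E))) (7 * e) Z.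
Proof.
have e0_ : 0 < e by []; set c := cell_levels m N e E; set a := bumped e u c.
have mR : 0 < m%:R :> R by rewrite ltr0n.
have grid01 j : (j <= m)%N -> (j%:R / m%:R : R) \in `[0, 1].
  move=> jm; rewrite in_itv /= divr_ge0//= ler_pdivrMr// mul1r ler_nat//.
pose big j p := in_cell m j p /\ exists2 v, E p v & e < v.
have cP j k : (k < N)%N ->
    (exists p v, [/\ E p v, in_cell m j p & e * k.+1%:R < v]) <-> (k < c j)%N.
  move=> kN; apply: (@levelsP N (fun k => exists p v,
    [/\ E p v, in_cell m j p & e * k.+1%:R < v])) => // {kN}k [p [v [Epv pj kv]]].
  exists p, v; split => //; apply: le_lt_trans kv.
  by rewrite ler_pM2l// ler_nat.
(* [q j.+1] is the position of the large mark of cell [j], or the right end of the cell if there is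
   none; [Euniq] makes this consistent. *)
have [q [q0 qbig qnone]] : exists q : nat -> R, [/\ q 0%N = 0,
    forall j p, big j p -> q j.+1 = p &
    forall j, (forall p, ~ big j p) -> q j.+1 = j.+1%:R / m%:R].
  have /choice[f fP] : forall j, exists x, (forall p, big j p -> x = p) /\
      ((forall p, ~ big j p) -> x = j.+1%:R / m%:R).
    move=> j; have [[p bp]|nb] := pselect (exists p, big j p).
      exists p; split => [p' bp'|/(_ _ bp)//].
      case: bp bp' => pj [v Epv ev] [pj' [v' Epv' ev']].
      exact: Euniq pj pj' Epv Epv' ev ev'.
    exists (j.+1%:R / m%:R); split => // p bp; exfalso; apply: nb; by exists p.
  by exists (fun i => if i is j.+1 then f j else 0); split => // j;
    have [] := fP j.
have qcell j : in_cell m j (q j.+1).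
  have [[p bp]|nb] := pselect (exists p, big j p).
    by rewrite (qbig _ _ bp); case: bp.
  rewrite qnone; last by move=> p bp; apply: nb; exists p.
  by rewrite /in_cell mulrC divfK ?lt0r_neq0// lexx ltr_nat ltnSn.
have qle j : m%:R * q j <= j%:R.
  by case: j => [|j]; [rewrite q0 mulr0|case/andP: (qcell j)].
have qS j : (j < m)%N -> q j < q j.+1.
  move=> jm; rewrite -(ltr_pM2l mR); apply: le_lt_trans (qle j) _.
  by case/andP: (qcell j).
have qm : q m = 1.
  rewrite -(prednK m0) qnone; first by rewrite prednK// divff ?lt0r_neq0.
  by move=> p [pm [v Epv ev]]; apply: Elast Epv ev pm.
have q01 j : (j <= m)%N -> 0 <= q j <= 1.
  move=> jm; rewrite -[X in X <= _]q0 -[X in _ <= _ <= X]qm.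
  by rewrite !(node_le qS)// ?jm ?leqnn.
have close (s : R) j : (j <= m)%N -> s \in `[0, 1] -> `|m%:R * s - j%:R| <= 1 ->
    b s <= u j + 2 * e /\ u j <= b s + 3 * e.
  move=> jm s01 sj; have /andP[h1 h2] := ub jm.
  have h : K * `|s - j%:R / m%:R| <= e.
    have -> : s - j%:R / m%:R = (m%:R * s - j%:R) / m%:R.
      by rewrite mulrBl mulrAC divff ?lt0r_neq0// mul1r.
    rewrite normrM normfV (ger0_norm (ltW mR)) mulrA ler_pdivrMr//.
    by apply: le_trans Km; rewrite ler_piMr.
  have := bK s01 (grid01 _ jm); have := bK (grid01 _ jm) s01.
  by rewrite distrC; split; lra.
(* The restriction on [t] is void for [j = m], so that [t = 1] is covered too. *)
have up j (t : R) : (j <= m)%N -> t \in `[0, 1] -> ((j < m)%N -> t < q j.+1) ->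
    Z t <= runmax a j + 5 * e.
  move=> jm t01 tj; have [s [v [/andP[s0 st] vE Zt]]] := ZU t01.
  have s01 : s \in `[0, 1].
    move: t01; rewrite !in_itv /= s0 => /andP[_ t1]; exact: le_trans t1.
  have s1 : s <= 1 by move: s01; rewrite in_itv /= => /andP[].
  have ms0 : 0 <= m%:R * s by rewrite mulr_ge0.
  have sj : m%:R * s < j.+1%:R.
    have [jm'|jm'] := ltnP j m.
      apply: lt_le_trans (qle j.+1); rewrite ltr_pM2l//.
      exact: le_lt_trans st (tj jm').
    apply: (@le_lt_trans _ _ m%:R); first by rewrite ger_pMr.
    by rewrite ltr_nat ltnS.
  (* A near-maximizer without large mark is compared with the last grid point before it. One with a
     large mark is itself a node [q i.+1], and [s <= t < q j.+1] forces [i < j]. *)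
  have [ve|ev] := le_or_lt v e.
    have ij : (Num.truncn (m%:R * s) <= j)%N by rewrite truncn_le_nat.
    have /andP[tl tr] := truncn_itv ms0.
    have sj' : `|m%:R * s - (Num.truncn (m%:R * s))%:R| <= 1.
      by rewrite ger0_norm ?subr_ge0// lerBlDl natr1 ltW.
    have [+ _] := close s _ (leq_trans ij jm) s01 sj'.
    have := le_runmax a ij; rewrite {1}/a /bumped.
    case: Num.truncn => [|i] /= ai h; first by lra.
    have := mulr_ge0 (ltW e0) (ler0n R (c i)); lra.
  have {vE} Esv : E s v by case: vE => // /(lt_le_trans ev); rewrite ltxx.
  have s0' : 0 < s by case/andP: (E01 Esv ev).
  have [i si] : exists i, in_cell m i s.
    have mx : exists i, m%:R * s <= i%:R by exists j.+1; exact: ltW.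
    case: (@ex_minnP (fun i => m%:R * s <= i%:R) mx) => -[|i] si imin.
      by move: si; rewrite leNgt mulr_gt0.
    exists i; rewrite /in_cell si andbT ltNge; apply/negP => /imin.
    by rewrite ltnn.
  have qi : q i.+1 = s by apply: qbig; split => //; exists v.
  have ij : (i < j)%N.
    rewrite ltnNge; apply/negP => ji.
    have im : (i < m)%N.
      rewrite -(ltr_nat R); case/andP: si => si _; apply: lt_le_trans si _.
      by rewrite ger_pMr.
    have jm' := leq_ltn_trans ji im.
    have := le_lt_trans st (tj jm'); rewrite -qi ltNge.
    by rewrite (node_le qS)// ltnS ji.
  have sj' : `|m%:R * s - i.+1%:R| <= 1.
    case/andP: si => h1 h2; rewrite distrC ger0_norm ?subr_ge0//.
    by rewrite -natr1; lra.
  have [bs _] := close s _ (leq_trans ij jm) s01 sj'.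
  have := le_runmax a ij; rewrite {1}/a /bumped => ai.
  have vc : v <= e * (c i).+1%:R.
    have := levels_le N (fun k => exists p v,
      [/\ E p v, in_cell m i p & e * k.+1%:R < v]).
    rewrite -/(cell_levels m N e E i) -/(c i) leq_eqVlt => /orP[/eqP ->|cN].
      exact: EN Esv.
    rewrite leNgt; apply/negP => cv.
    suff : (c i < c i)%N by rewrite ltnn.
    by apply/(cP _ _ cN); exists s, v.
  by move: vc; rewrite -natr1 mulrDr mulr1 => vc; lra.
have lo j (t : R) : (j <= m)%N -> q j <= t <= 1 -> runmax a j <= Z t + 6 * e.
  move=> jm /andP[jt t1]; apply: runmax_le => -[_|i ij].
    rewrite /a /bumped; have := @ZG 0%N t isT.
    rewrite mul0r -[X in X <= t]q0 (le_trans _ jt) ?(node_le qS)// t1 => /(_ isT).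
    by have := ub (leq0n m); rewrite mul0r => /andP[_]; lra.
  have im := leq_trans ij jm.
  have qit : q i.+1 <= t <= 1.
    by rewrite t1 andbT (le_trans _ jt)// (node_le qS)// ij.
  rewrite /a /bumped; have [c0|c0] := posnP (c i).
    rewrite c0 mulr0 addr0; have qi : q i.+1 = i.+1%:R / m%:R.
      apply: qnone => p [pi [v Epv ev]].
      (* With [N = 0] the levels carry no information, but then [EN] excludes marks above [e]. *)
      have [N0|N0] := posnP N.
        by have := EN Epv; rewrite N0 mulr1 leNgt ev.
      suff : (0 < c i)%N by rewrite c0.
      by apply/(cP _ _ N0); exists p, v; rewrite mulr1.
    have := ZG im (t := t); rewrite -qi => /(_ qit).
    by have /andP[_] := ub im; rewrite -qi; lra.
  have cN : ((c i).-1 < N)%N by rewrite prednK//; exact: levels_le.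
  have [|p [v [Epv pi cv]]] := (cP i _ cN).2; first by rewrite prednK.
  have ev : e < v.
    by apply: le_lt_trans cv; rewrite prednK// ler_peMr ?(ltW e0_)// ler1n.
  rewrite prednK// in cv.
  have qi : q i.+1 = p by apply: qbig; split => //; exists v.
  rewrite qi in qit; have := ZE Epv ev qit.
  have p01 : p \in `[0, 1].
    by rewrite in_itv /=; case/andP: (E01 Epv ev) => /ltW -> ->.
  have pi1 : `|m%:R * p - i.+1%:R| <= 1.
    case/andP: pi => h1 h2; rewrite distrC ger0_norm ?subr_ge0//.
    by rewrite -natr1; lra.
  have [_] := close p _ im p01 pi1; lra.
apply: (@J1_step_path _ m q a Z (6 * e)) => //.
- move=> [|j]; rewrite ?ltnn// => _; have /andP[h1 h2] := qcell j.
  by rewrite h2 -natr1 addrK h1.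
- move=> j t jm /andP[jt tj].
  have t1 : t <= 1.
    apply: le_trans (ltW tj) _; by case/andP: (q01 j.+1 jm).
  have t01 : t \in `[0, 1].
    rewrite in_itv /= t1 andbT; apply: le_trans jt; by case/andP: (q01 j (ltnW jm)).
  rewrite ler_norml; have := up j t (ltnW jm) t01 (fun _ => tj).
  have := lo j t (ltnW jm); rewrite jt t1 => /(_ isT); lra.
- have i1 : (1 : R) \in `[0, 1] by rewrite in_itv /= lexx ler01.
  have h1 : Z 1 <= runmax a m + 5 * e by apply: up; rewrite ?ltnn.
  rewrite ler_norml; have := lo m 1 (leqnn m); rewrite qm lexx => /(_ isT).
  lra.
- by rewrite ltr_pM2r// ltr_nat.
Qed.

End discretized_maximum.

(** * Expectations of bounded functions *)

Section means.
Context d (T : measurableType d) (R : realType) (P : probability T R).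
Implicit Types (f g : T -> R) (A B : set T).

(* [fine] sends infinite values to 0; [mean] is only meant for bounded functions. *)
Definition prob A : R := fine (P A).
Definition mean f : R := fine 'E_P[f].

Lemma probE A : measurable A -> P A = (prob A)%:E.
Proof. by move=> mA; rewrite /prob fineK// fin_num_measure. Qed.

Lemma prob_ge0 A : 0 <= prob A. Proof. exact: fine_ge0. Qed.

Lemma prob_le A B : measurable A -> measurable B -> A `<=` B -> prob A <= prob B.
Proof.
by move=> mA mB AB; rewrite -lee_fin -!probE//; apply: le_measure; rewrite ?inE.
Qed.

Lemma prob_le1 A : measurable A -> prob A <= 1.
Proof. by move=> mA; rewrite -lee_fin -probE// probability_le1. Qed.

Lemma prob_setC A : measurable A -> prob (~` A) = 1 - prob A.
Proof.
move=> mA; apply: EFin_inj; rewrite -probE ?probability_setC//.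
  by rewrite EFinB probE.
exact: measurableC.
Qed.

Lemma prob_setU A B : measurable A -> measurable B ->
  prob (A `|` B) <= prob A + prob B.
Proof.
move=> mA mB; rewrite -lee_fin EFinD -!probE//; last exact: measurableU.
exact: measureU2.
Qed.

Lemma prob_bigcup (n : nat) (F : nat -> set T) : (forall i, measurable (F i)) ->
  prob (\big[setU/set0]_(i < n) F i) <= \sum_(i < n) prob (F i).
Proof.
move=> mF; elim: n => [|n IH]; first by rewrite !big_ord0 /prob measure0.
rewrite !big_ord_recr /=; apply: le_trans (prob_setU _ _) _ => //.
  exact: bigsetU_measurable.
by rewrite lerD2r.
Qed.

Lemma prob_setD A B : measurable A -> measurable B -> B `<=` A ->
  prob (A `\` B) = prob A - prob B.
Proof.
move=> mA mB BA; apply/eqP; rewrite eq_sym subr_eq; apply/eqP/EFin_inj.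
have mAB := measurableD mA mB.
rewrite EFinD -!probE// -measureU// ?setDKU//.
by apply/seteqP; split => // w [[_ nb]].
Qed.

(* No measurability is assumed here: a continuous functional of the limit process
   is only known to be measurable up to a null set. *)
Lemma integral_mono (f g : T -> \bar R) : (forall w, (f w <= g w)%E) ->
  (\int[P]_w f w <= \int[P]_w g w)%E.
Proof.
move=> fg; rewrite /integral !patch_setT; apply: leeB.
  apply: ereal_sup_le => _ [h hf <-]; exists h => // w.
  by apply: le_trans (hf w) _; apply: (@funepos_le _ _ setT) => //; rewrite inE.
apply: ereal_sup_le => _ [h hf <-]; exists h => // w.
by apply: le_trans (hf w) _; apply: (@funeneg_le _ _ setT) => //; rewrite inE.
Qed.

Lemma mean_cst c : mean (fun=> c) = c.
Proof. by rewrite /mean expectation_cst. Qed.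

Lemma expectation_mono f g : (forall w, f w <= g w) -> ('E_P[f] <= 'E_P[g])%E.
Proof. by move=> fg; rewrite unlock; apply: integral_mono => w; rewrite lee_fin. Qed.

Lemma meanE M f : (forall w, `|f w| <= M) -> 'E_P[f]%E = (mean f)%:E.
Proof.
move=> fM; rewrite /mean fineK// fin_numE.
have /expectation_mono : forall w, f w <= cst M w.
  by move=> w; apply: le_trans (fM w); exact: ler_norm.
have /expectation_mono : forall w, cst (- M) w <= f w.
  by move=> w; rewrite /= lerNl; apply: le_trans (fM w); rewrite -normrN ler_norm.
by rewrite !expectation_cst; case: ('E_P[f])%E.
Qed.

Lemma mean_mono M f g : (forall w, `|f w| <= M) -> (forall w, `|g w| <= M) ->
  (forall w, f w <= g w) -> mean f <= mean g.
Proof.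
by move=> fM gM fg; rewrite -lee_fin -(meanE fM) -(meanE gM) expectation_mono.
Qed.

Lemma bounded_integrable M f : measurable_fun setT f ->
  (forall w, `|f w| <= M) -> P.-integrable setT (EFin \o f).
Proof.
move=> mf fM; apply: measurable_bounded_integrable => //.
  by rewrite -ge0_fin_numE// fin_num_measure.
exists M; split; first exact: num_real.
by move=> x Mx w _ /=; apply: le_trans (fM w) (ltW Mx).
Qed.

Lemma meanD M f g : measurable_fun setT f -> measurable_fun setT g ->
  (forall w, `|f w| <= M) -> (forall w, `|g w| <= M) ->
  mean (fun w => f w + g w) = mean f + mean g.
Proof.
move=> mf mg fM gM; rewrite /mean unlock.
have If := bounded_integrable mf fM; have Ig := bounded_integrable mg gM.
by rewrite -(@RintegralD _ _ _ P setT f g).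
Qed.

(** The integral is the difference of the integrals of the positive and negative parts even for
    non-measurable [f]; boundedness makes the negative part finite, so that the sign can be taken
    out. *)
Lemma meanN M f : (forall w, `|f w| <= M) -> mean (fun w => - f w) = - mean f.
Proof.
move=> fM; rewrite /mean unlock -fineN; congr fine.
under eq_integral do rewrite EFinN.
rewrite integralN//; apply: fin_num_adde_defl; rewrite fin_numN.
rewrite ge0_fin_numE; last by apply: integral_ge0 => w _; exact: funeneg_ge0.
apply: (@le_lt_trans _ _ (\int[P]_w (cst M%:E w))%E).
  apply: integral_mono => w; rewrite funenegE /= ge_max -?EFinN !lee_fin.
  have := fM w; rewrite ler_norml => /andP[h1 h2].
  by rewrite lerNl h1 /= (le_trans _ (fM w)).
by have := expectation_cst P M; rewrite unlock /= => ->; exact: ltry.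
Qed.

Lemma meanZ M f k : measurable_fun setT f -> (forall w, `|f w| <= M) ->
  mean (fun w => k * f w) = k * mean f.
Proof.
move=> mf fM; rewrite /mean unlock.
by rewrite -(@RintegralZl _ _ _ P setT f k)//; exact: bounded_integrable fM.
Qed.

Lemma mean_indic A : measurable A -> mean \1_A = prob A.
Proof. by move=> mA; rewrite /mean expectation_indic. Qed.

Lemma mean_sum (I : finType) M (f : I -> T -> R) :
  (forall i, measurable_fun setT (f i)) -> (forall i w, `|f i w| <= M) ->
  mean (fun w => \sum_i f i w) = \sum_i mean (f i).
Proof.
move=> mf fM; elim: (index_enum I) => [|i s IH].
  rewrite big_nil (_ : (fun w => _) = fun=> 0) ?mean_cst//.
  by apply/funext => w; rewrite big_nil.
rewrite (_ : (fun w => _) = fun w => f i w + \sum_(j <- s) f j w); last first.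
  by apply/funext => w; rewrite big_cons.
rewrite big_cons -IH (@meanD (M * (size s).+1%:R))//.
- by apply: measurable_sum => j; exact: mf.
- by move=> w; apply: le_trans (fM i w) _; rewrite ler_peMr ?ler1n// (le_trans _ (fM i w)).
- move=> w; apply: le_trans (ler_norm_sum _ _ _) _.
  apply: (@le_trans _ _ (\sum_(j <- s) M)); first exact: ler_sum.
  rewrite big_const_seq count_predT iter_addr addr0 -[leLHS]mulr_natr ler_wpM2l ?ler_nat//.
  by rewrite (le_trans _ (fM i w)).
Qed.

(** [f] is squeezed between [g - h] and [g + h], where [h] is [e] plus [2 * M] on [A]; monotonicity
    is all that is asked of the mean of [f], which may be non-measurable. *)
Lemma mean_sandwich M e f g A : 0 <= e -> measurable A -> measurable_fun setT g ->
  (forall w, `|f w| <= M) -> (forall w, `|g w| <= M) ->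
  (forall w, ~ A w -> `|f w - g w| <= e) ->
  `|mean f - mean g| <= e + 2 * M * prob A.
Proof.
move=> e0 mA mg fM gM fg.
(* The space has mass 1, hence a point, and this gives [0 <= M]. *)
have [w0|T0] := pselect (exists w : T, True); last first.
  have PT : prob setT = 0.
    rewrite /prob (_ : setT = set0) ?measure0//; apply/seteqP; split => // w _.
    by apply: T0; exists w.
  by move: PT; rewrite /prob probability_setT => /eqP; rewrite oner_eq0.
case: w0 => w0 _; have M0 : 0 <= M by apply: le_trans (fM w0).
have mI : measurable_fun setT (\1_A : T -> R) by exact: measurable_indic.
have I01 (w : T) : 0 <= (\1_A w : R) <= 1
  by rewrite indicE; case: (_ \in _); apply/andP; split; rewrite ?ler01.
pose h w : R := e + 2 * M * \1_A w.
have mh : measurable_fun setT h.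
  by apply: measurable_funD => //; exact: measurable_funM.
have hM w : `|h w| <= e + 2 * M.
  have /andP[I0 I1] := I01 w.
  rewrite ger0_norm ?addr_ge0 ?mulr_ge0// lerD2l; by rewrite ler_piMr ?mulr_ge0.
have meanh : mean h = e + 2 * M * prob A.
  rewrite /h (@meanD (e + 2 * M))//; first last.
  - move=> w; have /andP[I0 I1] := I01 w.
    by rewrite ger0_norm ?mulr_ge0// (@le_trans _ _ (2 * M)) ?ler_piMr ?mulr_ge0// lerDr.
  - by move=> w; rewrite ger0_norm ?lerDl ?mulr_ge0.
  - exact: measurable_funM.
  rewrite mean_cst (@meanZ 1)// ?mean_indic// => w.
  by have /andP[I0 I1] := I01 w; rewrite ger0_norm.
have fgh w : `|f w - g w| <= h w.
  rewrite /h indicE; case: (boolP (w \in A)); rewrite ?inE ?notin_setE => Aw.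
    rewrite mulr1; apply: le_trans (ler_normB _ _) _.
    have := fM w; have := gM w; lra.
  by rewrite mulr0 addr0; exact: fg.
have bnd (s : R) w : s = 1 \/ s = -1 -> `|g w + s * h w| <= M + (e + 2 * M).
  move=> s1; apply: le_trans (ler_normD _ _) _; apply: lerD => //.
  by case: s1 => ->; rewrite ?mul1r// mulN1r normrN.
have bndf w : `|f w| <= M + (e + 2 * M) by have := fM w; lra.
have mgh (s : R) : s = 1 \/ s = -1 -> mean (fun w => g w + s * h w) = mean g + s * mean h.
  move=> s1; rewrite (@meanD (M + (e + 2 * M)))//.
  - by rewrite (meanZ _ mh hM).
  - by apply: measurable_funM.
  - by move=> w; have := gM w; lra.
  - by move=> w; case: s1 => ->; rewrite ?mul1r ?mulN1r ?normrN; have := hM w; lra.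
rewrite -meanh ler_norml; apply/andP; split.
  rewrite lerBrDl -[X in _ + X]mulN1r -mgh; last by right.
  apply: (@mean_mono (M + (e + 2 * M))) => // w; first by apply: bnd; right.
  by have := fgh w; rewrite ler_norml mulN1r => /andP[]; lra.
rewrite lerBlDl -[X in _ + X]mul1r -mgh; last by left.
apply: (@mean_mono (M + (e + 2 * M))) => // w; first by apply: bnd; left.
by have := fgh w; rewrite ler_norml mul1r => /andP[]; lra.
Qed.

Lemma mean_markov M e f A : 0 < e -> measurable A ->
  (forall w, 0 <= f w <= M) -> (forall w, A w -> e <= f w) ->
  prob A <= mean f / e.
Proof.
move=> e0 mA f0M Af; rewrite ler_pdivlMr// mulrC.
have mI : measurable_fun setT (\1_A : T -> R) by exact: measurable_indic.
have I1 w : `|\1_A w : R| <= 1.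
  by rewrite indicE; case: (_ \in _); rewrite ?normr0 ?normr1 ?ler01.
rewrite -mean_indic// -(meanZ e mI I1).
apply: (@mean_mono (M + e)) => w.
- rewrite indicE; have /andP[f0 fM] := f0M w.
  by case: (_ \in _); rewrite ?mulr1 ?mulr0 ?normr0 ?ger0_norm; lra.
- by have /andP[f0 fM] := f0M w; rewrite ger0_norm//; lra.
- rewrite indicE; have /andP[f0 fM] := f0M w.
  by case: (boolP (_ \in _)); rewrite ?inE ?mulr1 ?mulr0// => /Af.
Qed.

Lemma mean_cvg M (f : nat -> T -> R) g : (forall n, measurable_fun setT (f n)) ->
  measurable_fun setT g -> (forall n w, `|f n w| <= M) ->
  (forall w, f n w @[n --> \oo] --> g w) -> mean (f n) @[n --> \oo] --> mean g.
Proof.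
move=> mf mg fM fg.
have gM w : `|g w| <= M.
  have h : `|f n w| @[n --> \oo] --> `|g w| by apply: cvg_norm; exact: fg.
  rewrite -(cvg_lim _ h)//; apply: limr_le; first by apply/cvg_ex; exists `|g w|.
  by apply: nearW => n; exact: fM.
have := @dominated_convergence _ _ _ P setT measurableT (fun n => EFin \o f n)
  (EFin \o g) (cst M%:E).
case.
- by move=> n; exact/measurable_EFinP.
- exact/measurable_EFinP.
- by apply: aeW => w _ /=; apply: cvg_EFin; [exact: nearW|exact: fg].
- by apply: finite_measure_integrable_cst.
- by apply: aeW => w n _ /=; rewrite lee_fin.
move=> _ _; rewrite /= => h.
have -> : (fun n => mean (f n)) = fun n => fine (\int[P]_w (f n w)%:E).
  by apply/funext => n; rewrite /mean unlock.
rewrite /mean unlock.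
apply: fine_cvg; rewrite fineK//.
by have := meanE gM; rewrite unlock => ->.
Qed.

End means.

(** * J1-Lipschitz functionals *)

(** Domination in both directions makes the two sets bounded above together, so that the default
    value of [sup] is taken for both or for none. *)
Lemma sup_out_le {R : realType} (A B : set R) (e : R) : 0 <= e -> B !=set0 ->
  (forall a, A a -> exists2 b, B b & a <= b + e) ->
  (forall b, B b -> exists2 a, A a & b <= a + e) -> sup A <= sup B + e.
Proof.
move=> e0 B0 AB BA.
have A0 : A !=set0 by case: B0 => b /BA[a Aa _]; exists a.
have [[_ [y yB]]|nB] := pselect (has_sup B); last first.
  rewrite (sup_out nB) add0r sup_out// => -[_ [x xA]]; apply: nB; split => //.
  by exists (x + e) => b /BA[a /xA ax] /le_trans; apply; rewrite lerD2r.
apply: ge_sup => // a /AB[b Bb] /le_trans; apply; rewrite lerD2r.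
by apply: ub_le_sup => //; exists y.
Qed.

Section J1_functionals.
Context {R : realType}.
Implicit Types (f g : R -> R) (e K t : R).

Lemma J1_ball_gt0 f e g : J1_ball f e g -> 0 < e.
Proof.
move=> [l _ h]; have [|+ _] := h 0; first by rewrite in_itv /= lexx ler01.
by apply: le_lt_trans.
Qed.

Lemma J1_ball_le f e e' g : e <= e' -> J1_ball f e g -> J1_ball f e' g.
Proof.
move=> ee [l tl h]; exists l => // t /h[h1 h2].
by split; [apply: lt_le_trans h1 _|apply: lt_le_trans h2 _].
Qed.

Lemma J1_ball_uniform f g e e' : e < e' -> 0 < e' ->
  (forall t : R, t \in `[0, 1] -> `|f t - g t| <= e) -> J1_ball f e' g.
Proof.
move=> ee e0 fg; exists id; first exact: time_change_id.
by move=> t t01; rewrite subrr normr0; split => //; apply: le_lt_trans (fg _ t01) ee.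
Qed.

(* Unlike the evaluation at [t], this sup-convolution is J1-Lipschitz in [f]. *)
Definition sup_conv K t f : R := sup [set f s - K * `|s - t| | s in `[0, 1]].

(* A J1-Lipschitz substitute for the modulus of continuity; the cap at 1 makes it
   an admissible test functional for weak convergence. *)
Definition modulus_excess K f : R :=
  sup [set Num.min 1 (`|f st.1 - f st.2| - K * `|st.1 - st.2|) |
       st in `[0, 1] `*` `[0, 1]].

Lemma ler_distDist (x y z : R) : `| `|x - z| - `|y - z| | <= `|x - y|.
Proof.
apply: le_trans (ler_dist_dist _ _) _; rewrite opprB addrA subrK; exact: lexx.
Qed.

(** A point [s] competing for [f] is answered by [l s] for [g]: the value changes by at most [e] and
    the penalty by at most [K * e]. *)
Lemma sup_conv_le K t f e g : 0 <= K -> J1_ball f e g ->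
  sup_conv K t f <= sup_conv K t g + (1 + K) * e.
Proof.
move=> K0 B; have e0 := J1_ball_gt0 B.
have half h1 h2 : J1_ball h1 e h2 -> forall a,
    [set h1 s - K * `|s - t| | s in `[0, 1]] a -> exists2 b,
    [set h2 s - K * `|s - t| | s in `[0, 1]] b & a <= b + (1 + K) * e.
  move=> [l tl h] _ [s s01 <-]; have [ls hs] := h s s01.
  exists (h2 (l s) - K * `|l s - t|).
    by exists (l s) => //; exact: time_change_in.
  have : K * (`|l s - t| - `|s - t|) <= K * e.
    apply: ler_wpM2l => //; apply: le_trans (ler_norm _) _.
    exact: le_trans (ler_distDist _ _ _) (ltW ls).
  move: hs; rewrite ltr_norml => /andP[]; rewrite mulrBr mulrDl mul1r; lra.
apply: sup_out_le.
- by rewrite mulr_ge0 ?addr_ge0// ltW.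
- by exists (g 0 - K * `|0 - t|); exists 0 => //=; rewrite in_itv /= lexx ler01.
- exact: half.
- exact/half/J1_ball_sym.
Qed.

Lemma sup_conv_lipschitz K t f e g : 0 <= K -> J1_ball f e g ->
  `|sup_conv K t f - sup_conv K t g| <= (1 + K) * e.
Proof.
move=> K0 B; have h1 := sup_conv_le t K0 B; have h2 := sup_conv_le t K0 (J1_ball_sym B).
by rewrite ler_norml; lra.
Qed.

(** Moving both points by the time change alters the increment of the path and the distance of the
    points by at most [2 * e] each. *)
Lemma modulus_excess_le K f e g : 0 <= K -> J1_ball f e g ->
  modulus_excess K f <= modulus_excess K g + (2 + 2 * K) * e.
Proof.
move=> K0 B; have e0 := J1_ball_gt0 B.
have half h1 h2 : J1_ball h1 e h2 -> forall a,
    [set Num.min 1 (`|h1 st.1 - h1 st.2| - K * `|st.1 - st.2|) |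
       st in `[0, 1] `*` `[0, 1]] a -> exists2 b,
    [set Num.min 1 (`|h2 st.1 - h2 st.2| - K * `|st.1 - st.2|) |
       st in `[0, 1] `*` `[0, 1]] b & a <= b + (2 + 2 * K) * e.
  move=> [l tl h] _ [[s s'] [/= s01 s01'] <-].
  have [ls hs] := h s s01; have [ls' hs'] := h s' s01'.
  eexists; first by exists (l s, l s') => //=; split; exact: time_change_in.
  rewrite /=.
  have k : K * (`|l s - l s'| - `|s - s'|) <= K * (2 * e).
    apply: ler_wpM2l => //; apply: le_trans (ler_norm _) _.
    apply: le_trans (ler_dist_dist _ _) _.
    rewrite (_ : _ - _ - _ = (l s - s) - (l s' - s')); last by ring.
    by apply: le_trans (ler_normB _ _) _; lra.
  have k' : `|h1 s - h1 s'| - `|h2 (l s) - h2 (l s')| <= 2 * e.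
    apply: le_trans (ler_norm _) _.
    apply: le_trans (ler_dist_dist _ _) _.
    rewrite (_ : _ - _ - _ = (h1 s - h2 (l s)) - (h1 s' - h2 (l s'))); last by ring.
    by apply: le_trans (ler_normB _ _) _; lra.
  have e2 : 0 <= (2 + 2 * K) * e by rewrite mulr_ge0 ?addr_ge0 ?mulr_ge0// ltW.
  rewrite -lerBlDr le_min; apply/andP; split.
    rewrite lerBlDr; apply: (@le_trans _ _ 1); first by rewrite ge_min lexx.
    by rewrite lerDl.
  rewrite lerBlDr ge_min; apply/orP; right.
  move: k; rewrite mulrBr mulrDl => k; lra.
apply: sup_out_le.
- by rewrite mulr_ge0 ?addr_ge0 ?mulr_ge0// ltW.
- by eexists; exists (0, 0) => //=; rewrite in_itv /= lexx ler01.
- exact: half.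
- exact/half/J1_ball_sym.
Qed.

Lemma modulus_excess_lipschitz K f e g : 0 <= K -> J1_ball f e g ->
  `|modulus_excess K f - modulus_excess K g| <= (2 + 2 * K) * e.
Proof.
move=> K0 B; have h1 := modulus_excess_le K0 B.
have h2 := modulus_excess_le K0 (J1_ball_sym B).
by rewrite ler_norml; lra.
Qed.

Lemma modulus_excess_itv K f : 0 <= modulus_excess K f <= 1.
Proof.
have i0 : (0 : R) \in `[0, 1] by rewrite in_itv /= lexx ler01.
apply/andP; split.
  apply: ub_le_sup; first by exists 1 => _ [st _ <-]; rewrite ge_min lexx.
  by exists (0, 0) => //=; rewrite !subrr normr0 mulr0 subrr min_r.
apply: ge_sup; first by eexists; exists (0, 0).
by move=> _ [st _ <-]; rewrite ge_min lexx.
Qed.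

(** Since [e <= 1], the cap cannot be what keeps the terms below [e]. *)
Lemma modulus_excess_lt K f e : e <= 1 -> modulus_excess K f < e ->
  forall s t : R, s \in `[0, 1] -> t \in `[0, 1] ->
  `|f s - f t| <= e + K * `|s - t|.
Proof.
move=> e1 fe s t s01 t01.
have : Num.min 1 (`|f s - f t| - K * `|s - t|) < e.
  apply: le_lt_trans fe; apply: ub_le_sup.
    by exists 1 => _ [st _ <-]; rewrite ge_min lexx.
  by exists (s, t).
by rewrite gt_min ltNge e1 /= ltrBlDr => /ltW.
Qed.

Lemma sup_conv_close K f e t : t \in `[0, 1] ->
  (forall s t : R, s \in `[0, 1] -> t \in `[0, 1] ->
  f s - f t <= e + K * `|s - t|) -> f t <= sup_conv K t f <= f t + e.
Proof.
move=> t01 H.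
have ub : ubound [set f s - K * `|s - t| | s in `[0, 1]] (f t + e).
  move=> _ [s s01 <-]; have := H s t s01 t01; lra.
apply/andP; split.
  apply: ub_le_sup; first by exists (f t + e).
  by exists t => //; rewrite subrr normr0 mulr0 subr0.
by apply: ge_sup => //; exists (f t - K * `|t - t|); exists t.
Qed.

End J1_functionals.

Section lipschitz_functionals.
Context {R : realType}.
Implicit Types (F : D01 R -> R) (L : R).

Definition J1_lipschitz L F : Prop :=
  forall (f g : D01 R) (e : R), J1_ball f e g -> `|F f - F g| <= L * e.

Lemma J1_continuousP F : continuous F <->
  forall (f : D01 R) (e : R), 0 < e -> exists2 r, 0 < r &
    forall g : D01 R, J1_ball f r g -> `|F f - F g| < e.
Proof.
split=> [cF f e e0|H f].
  have /cvgrPdist_lt/(_ _ e0) := cF f.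
  by move=> /nbhs_ballP[r r0 h]; exists r => // g /h.
apply: (@cvgrPdist_lt _ _ _ (nbhs f) (nbhs_filter f) F (F f)).2 => e.
move=> /(H f)[r r0 h].
by apply/nbhs_ballP; exists r => // g /h.
Qed.

Lemma J1_lipschitz_continuous L F : J1_lipschitz L F -> continuous F.
Proof.
move=> FL; apply/J1_continuousP => f e e0.
have L1 : 0 < `|L| + 1 by rewrite ltr_wpDl.
exists (e / (`|L| + 1)); first by rewrite divr_gt0.
move=> g /FL h; apply: le_lt_trans h _; rewrite mulrA ltr_pdivrMr// mulrC ltr_pM2l//.
by apply: le_lt_trans (ler_norm _) _; rewrite ltrDl.
Qed.

(** The radius [e] of a ball containing [g] stands for the J1 distance between [f] and [g]; the
    infimum over all radii amounts to using the distance itself. *)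
Definition inf_conv (k : R) F (f : D01 R) : R :=
  inf [set x | exists (g : D01 R) e, J1_ball f e g /\ x = F g + k * e].

Variables (F : D01 R -> R) (M : R).
Hypotheses (cF : continuous F) (FM : forall f, `|F f| <= M).

Let conv_lb (k : R) (f : D01 R) : 0 <= k ->
  lbound [set x | exists (g : D01 R) e, J1_ball f e g /\ x = F g + k * e] (- M).
Proof.
move=> k0 _ [g [e [B ->]]]; have := FM g; rewrite ler_norml => /andP[h _].
by apply: le_trans h _; rewrite lerDl mulr_ge0// ltW// (J1_ball_gt0 B).
Qed.

Let conv_ne (k : R) (f : D01 R) : 0 <= k ->
  [set x | exists (g : D01 R) e, J1_ball f e g /\ x = F g + k * e] !=set0.
Proof. by move=> k0; exists (F f + k * 1), f, 1; split => //; exact: J1_ball_center. Qed.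

Lemma inf_conv_le (k : R) (f : D01 R) : 0 <= k -> inf_conv k F f <= F f.
Proof.
move=> k0; apply/ler_addgt0Pr => e e0.
have k1 : 0 < k + 1 by rewrite ltr_wpDl.
apply: (@le_trans _ _ (F f + k * (e / (k + 1)))).
  apply: ge_inf; first by exists (- M); exact: conv_lb.
  by exists f, (e / (k + 1)); split => //; apply: J1_ball_center; rewrite divr_gt0.
by rewrite lerD2l mulrA ler_pdivrMr// mulrC ler_pM2l// lerDl.
Qed.

Lemma inf_conv_ge (k : R) (f : D01 R) : 0 <= k -> - M <= inf_conv k F f.
Proof. by move=> k0; apply: lb_le_inf; [exact: conv_ne|exact: conv_lb]. Qed.

Lemma inf_conv_norm (k : R) (f : D01 R) : 0 <= k -> `|inf_conv k F f| <= M.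
Proof.
move=> k0; rewrite ler_norml inf_conv_ge//=; apply: le_trans (inf_conv_le f k0) _.
by apply: le_trans (FM f); exact: ler_norm.
Qed.

Lemma inf_conv_lipschitz (k : R) : 0 <= k -> J1_lipschitz k (inf_conv k F).
Proof.
move=> k0.
suff H (f g : D01 R) (e : R) : J1_ball f e g -> inf_conv k F f <= inf_conv k F g + k * e.
  move=> f g e B; rewrite ler_norml; have := H _ _ _ B.
  have := H _ _ _ (J1_ball_sym B); lra.
move=> B; rewrite -lerBlDr; apply: lb_le_inf; first exact: conv_ne.
move=> _ [h [e' [B' ->]]]; rewrite lerBlDr -addrA -mulrDr.
apply: ge_inf; first by exists (- M); exact: conv_lb.
by exists h, (e' + e); split => //; rewrite addrC; exact: J1_ball_triangle B B'.
Qed.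

Lemma inf_conv_cvg (f : D01 R) : inf_conv n%:R F f @[n --> \oo] --> F f.
Proof.
apply/cvgrPdist_le => e e0.
have [r r0 h] := (J1_continuousP F).1 cF f e e0.
near=> n; have n0 : 0 <= n%:R :> R by [].
rewrite ger0_norm ?subr_ge0 ?inf_conv_le// lerBlDr -lerBlDl.
apply: lb_le_inf; first exact: conv_ne.
move=> _ [g [e' [B ->]]].
have e'0 := J1_ball_gt0 B.
have [er|re] := le_or_lt e' r.
  have := h g (J1_ball_le er B); rewrite ltr_norml => /andP[_ h1].
  have : 0 <= n%:R * e' by rewrite mulr_ge0// ltW.
  lra.
(* Outside the ball the penalty alone is at least [2 * M], the largest possible drop of [F]. *)
have : n%:R * r <= n%:R * e' by rewrite ler_wpM2l// ltW.
have : 2 * M <= n%:R * r.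
  rewrite -ler_pdivrMr//; near: n; exact: nbhs_infty_ger.
have := FM f; have := FM g; rewrite !ler_norml => /andP[? ?] /andP[? ?]; lra.
Unshelve. all: by end_near. Qed.

End lipschitz_functionals.

(** * Càdlàg paths *)

Section cadlag_paths.
Context {R : realType}.

Lemma toDE (f : R -> R) : cadlag01 f -> D01_fun (toD f) = f.
Proof. by move=> cf; rewrite /toD; case: pselect. Qed.

Lemma cadlag_truncn (V : nat -> R) (n : nat) :
  cadlag01 (fun t => V (Num.truncn (n%:R * t))).
Proof.
have [->|n0] := posnP n.
  have -> : (fun t : R => V (Num.truncn (0%:R * t))) = cst (V 0%N).
    by apply/funext => t; rewrite mul0r truncn0.
  exact: cadlag01_cst.
have nR : 0 < n%:R :> R by rewrite ltr0n.
split=> t; rewrite in_itv /= => /andP[t0 t1].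
  have nt0 : 0 <= n%:R * t by rewrite mulr_ge0.
  have /andP[tl tr] := truncn_itv nt0.
  apply: cvg_near_cst; near=> x; congr V.
  apply: truncn_def; apply/andP; split.
    apply: le_trans tl _; rewrite ler_pM2l//; near: x; exact: nbhs_right_ge.
  rewrite mulrC -ltr_pdivlMr//; near: x; apply: nbhs_right_lt.
  by rewrite ltr_pdivlMr// mulrC.
have [k /andP[kl kr]] : exists k, k%:R < n%:R * t <= k.+1%:R.
  have mx : exists i, n%:R * t <= i%:R.
    by exists (Num.truncn (n%:R * t)).+1; apply: ltW; exact: truncnS_gt.
  case: (@ex_minnP (fun i => n%:R * t <= i%:R) mx) => -[|i] si imin.
    by move: si; rewrite leNgt mulr_gt0.
  by exists i; rewrite si andbT ltNge; apply/negP => /imin; rewrite ltnn.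
apply/cvg_ex; exists (V k); apply: cvg_near_cst; near=> x; congr V.
apply: truncn_def; apply/andP; split.
  rewrite mulrC -ler_pdivrMr//; apply: ltW; near: x; apply: nbhs_left_gt.
  by rewrite ltr_pdivrMr// mulrC.
apply: lt_le_trans kr; rewrite ltr_pM2l//; near: x; exact: nbhs_left_lt.
Unshelve. all: by end_near. Qed.

Lemma cadlag_step_path m (a : nat -> R) : cadlag01 (step_path m a).
Proof. exact: cadlag_truncn. Qed.

(** Pulling a point [y > l t] back through the inverse of [l] yields a right neighbourhood of [t]
    that is mapped below [y]. Strict monotonicity keeps the image to the right of [l t], as
    one-sided limits require. *)
Lemma time_change_at_right (l : R -> R) (t : R) : time_change l ->
  t \in `[0, 1[ -> l x @[x --> t^'+] --> (l t)^'+.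
Proof.
move=> tl; have [li _ _] := tl; have [k [tk lk kl]] := time_change_inv tl.
have [ki _ _] := tk.
rewrite in_itv /= => /andP[t0 t1].
have tI : t \in `[0, 1] by rewrite in_itv /= t0 ltW.
have i1 : (1 : R) \in `[0, 1] by rewrite in_itv /= lexx ler01.
have lt1 : l t < 1.
  apply: lt_le_trans (li _ _ tI i1 t1) _.
  by have := time_change_in tl i1; rewrite in_itv /= => /andP[].
have lt0 : 0 <= l t by have := time_change_in tl tI; rewrite in_itv /= => /andP[].
move=> Q [e /= e0 hQ].
pose y := Num.min 1 (l t + e).
have ly : l t < y by rewrite lt_min lt1 ltrDl.
have yI : y \in `[0, 1] by rewrite in_itv /= (le_trans lt0 (ltW ly)) ge_min lexx.
have tky : t < k y by rewrite -[ltLHS]lk// ki// time_change_in.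
have kyI := time_change_in tk yI.
suff : \forall x \near t^'+, Q (l x) by [].
near=> x.
have tx : t < x by near: x; exact: nbhs_right_gt.
have xy : x < k y by near: x; exact: nbhs_right_lt.
have xI : x \in `[0, 1].
  rewrite in_itv /= (le_trans t0 (ltW tx)) (le_trans (ltW xy))//.
  by move: kyI; rewrite in_itv /= => /andP[].
have lxy : l x < y by rewrite -[ltRHS]kl// li.
have ltx : l t < l x by rewrite li.
apply: hQ => //=; rewrite distrC gtr0_norm ?subr_gt0// ltrBlDl.
by apply: lt_le_trans lxy _; rewrite ge_min lexx orbT.
Unshelve. all: by end_near. Qed.

Lemma time_change_at_left (l : R -> R) (t : R) : time_change l ->
  t \in `]0, 1] -> l x @[x --> t^'-] --> (l t)^'-.
Proof.
move=> tl; have [li _ _] := tl; have [k [tk lk kl]] := time_change_inv tl.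
have [ki _ _] := tk.
rewrite in_itv /= => /andP[t0 t1].
have tI : t \in `[0, 1] by rewrite in_itv /= ltW.
have i0 : (0 : R) \in `[0, 1] by rewrite in_itv /= lexx ler01.
have lt0 : 0 < l t.
  apply: le_lt_trans (li _ _ i0 tI t0).
  by have := time_change_in tl i0; rewrite in_itv /= => /andP[].
have lt1 : l t <= 1 by have := time_change_in tl tI; rewrite in_itv /= => /andP[].
move=> Q [e /= e0 hQ].
pose y := Num.max 0 (l t - e).
have ly : y < l t by rewrite gt_max lt0 ltrBlDr ltrDl.
have yI : y \in `[0, 1] by rewrite in_itv /= (le_trans (ltW ly) lt1) le_max lexx.
have tky : k y < t by rewrite -[ltRHS]lk// ki// time_change_in.
have kyI := time_change_in tk yI.
suff : \forall x \near t^'-, Q (l x) by [].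
near=> x.
have tx : x < t by near: x; exact: nbhs_left_lt.
have xy : k y < x by near: x; exact: nbhs_left_gt.
have xI : x \in `[0, 1].
  rewrite in_itv /= (le_trans (ltW tx) t1) (le_trans _ (ltW xy))//.
  by move: kyI; rewrite in_itv /= => /andP[].
have lxy : y < l x by rewrite -[ltLHS]kl// li.
have ltx : l x < l t by rewrite li.
apply: hQ => //=; rewrite gtr0_norm ?subr_gt0// ltrBlDl -ltrBlDr.
by apply: le_lt_trans lxy; rewrite le_max lexx orbT.
Unshelve. all: by end_near. Qed.

(** One-sided limits survive a time change and a uniform error. On the right the candidate is [Z t];
    on the left there is none, and the image filter is shown to be Cauchy instead. *)
Lemma cadlag_J1_closure (Z : R -> R) :
  (forall e : R, 0 < e -> exists2 A, cadlag01 A & J1_ball Z e A) -> cadlag01 Z.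
Proof.
move=> H; split=> t t01.
  apply/cvgrPdist_lt => e e0.
  have e3 : 0 < e / 3 by lra.
  have [A [Ar _] [l tl ZA]] := H _ e3.
  have [t0 t1] : 0 <= t /\ t < 1 by move: t01; rewrite in_itv /= => /andP[].
  have tI : t \in `[0, 1] by rewrite in_itv /= t0 ltW.
  have lt1 : l t \in `[0, 1[.
    have [li _ _] := tl; have i1 : (1 : R) \in `[0, 1] by rewrite in_itv /= lexx ler01.
    have := time_change_in tl i1; have := time_change_in tl tI.
    rewrite !in_itv /= => /andP[-> _] /andP[_]; apply: lt_le_trans; exact: li.
  have /cvgrPdist_lt/(_ _ e3) := cvg_comp _ _ (time_change_at_right tl t01) (Ar _ lt1).
  move=> h; near=> x.
  have xI : x \in `[0, 1].
    rewrite in_itv /=; apply/andP; split.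
      by apply: le_trans t0 _; near: x; exact: nbhs_right_ge.
    by near: x; exact: nbhs_right_ltW.
  have [_ h1] := ZA _ tI; have [_ h2] := ZA _ xI.
  have h3 : `|A (l t) - A (l x)| < e / 3 by near: x.
  move: h1 h2 h3; rewrite !ltr_norml; lra.
have [t0 t1] : 0 < t /\ t <= 1 by move: t01; rewrite in_itv /= => /andP[].
apply/cauchy_cvgP; apply/cauchy_exP => e e0.
have e4 : 0 < e / 4 by lra.
have [A [_ Al] [l tl ZA]] := H _ e4.
have tI : t \in `[0, 1] by rewrite in_itv /= t1 ltW.
have lt1 : l t \in `]0, 1].
  have [li _ _] := tl; have i0 : (0 : R) \in `[0, 1] by rewrite in_itv /= lexx ler01.
  have := time_change_in tl i0; have := time_change_in tl tI.
  rewrite !in_itv /= => /andP[_ ->] /andP[+ _]; rewrite andbT => /le_lt_trans; apply.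
  exact: li.
have /cvg_ex[/= c Ac] := Al _ lt1.
have /cvgrPdist_lt/(_ _ e4) := cvg_comp _ _ (time_change_at_left tl t01) Ac.
move=> h; exists c; rewrite /nbhs /= /ball /=; near=> x.
have xI : x \in `[0, 1].
  rewrite in_itv /=; apply/andP; split.
    by apply: ltW; near: x; exact: nbhs_left_gt.
  by apply: le_trans t1; apply: ltW; near: x; exact: nbhs_left_lt.
have [_ h2] := ZA _ xI.
have h3 : `|c - A (l x)| < e / 4 by near: x.
rewrite /ball_ /=; move: h2 h3; rewrite !ltr_norml; lra.
Unshelve. all: by end_near. Qed.

End cadlag_paths.

(** * Measurability and independence *)

Section measurability.
Context d (T : measurableType d) (R : realType).

Lemma measurable_countable_comp (I : countType) (z : T -> I) (h : I -> R) :
  (forall i, measurable (z @^-1` [set i])) -> measurable_fun setT (h \o z).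
Proof.
move=> mz _ Y mY; rewrite setTI.
have -> : (h \o z) @^-1` Y =
    \bigcup_i (if `[< Y (h i) >] then z @^-1` [set i] else set0).
  apply/seteqP; split => [w Yw|w [i _]] /=.
    by exists (z w) => //; rewrite asboolT.
  by case: asboolP => // Yi /= ->.
apply: countable_bigcupT_measurable; first exact: countableP.
by move=> i; case: ifP.
Qed.

Lemma measurable_floor_fiber (x : T -> R) (i : int) : measurable_fun setT x ->
  measurable ((fun w => Num.floor (x w)) @^-1` [set i]).
Proof.
move=> mx; have -> : (fun w => Num.floor (x w)) @^-1` [set i] =
    setT `&` x @^-1` `[i%:~R, (i + 1)%:~R[%classic.
  rewrite setTI; apply/seteqP; split => w /=.
    by move=> <-; rewrite in_itv /= floor_le_tmp floorD1_gt.
  by rewrite in_itv /=; exact: floor_def.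
by apply: mx.
Qed.

(* Rounding the coordinates to multiples of [1 / k] makes the map factor through a
   countable set, so that continuity of [G] suffices for measurability. *)
Lemma measurable_fin_comp (n : nat) (a : nat -> T -> R) (G : (nat -> R) -> R) :
  (forall i, measurable_fun setT (a i)) ->
  (forall (x : nat -> nat -> R) y, (forall i, x ^~ i @ \oo --> y i) ->
    G (x k) @[k --> \oo] --> G y) ->
  (forall x y, (forall i, (i <= n)%N -> x i = y i) -> G x = G y) ->
  measurable_fun setT (fun w => G (a ^~ w)).
Proof.
move=> ma cG dG.
pose fl (k i : nat) w : int := Num.floor (k.+1%:R * a i w).
apply: (@measurable_fun_cvg _ _ _ _
    (fun k w => G (fun i => (fl k i w)%:~R / k.+1%:R))).
  move=> k.
  pose z w := [ffun i : 'I_n.+1 => fl k i w].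
  pose h (v : {ffun 'I_n.+1 -> int}) :=
    G (fun i => (v (inord i))%:~R / k.+1%:R).
  have -> : (fun w => G (fun i => (fl k i w)%:~R / k.+1%:R)) = h \o z.
    apply/funext => w /=; apply: dG => i ilen.
    by rewrite ffunE inordK.
  apply: measurable_countable_comp => v.
  have -> : z @^-1` [set v] =
      \bigcap_(i in [set: 'I_n.+1]) ((fun w => fl k i w) @^-1` [set v i]).
    apply/seteqP; split => [w /= <- i _ /=|w H]; first by rewrite ffunE.
    by apply/ffunP => i; rewrite ffunE; exact: (H i I).
  apply: fin_bigcap_measurable; first exact: finite_finset.
  by move=> i _; apply: measurable_floor_fiber; exact: measurable_funM.
move=> w _; apply: cG => i.
apply/cvgrPdist_le => e e0; near=> k.
have k0 : 0 < k.+1%:R :> R by [].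
rewrite -(ler_pM2r k0) -[X in _ * X <= _](gtr0_norm k0) -normrM mulrBl divfK ?gt_eqF//.
rewrite mulrC -/(fl k i w) ger0_norm; last by rewrite subr_ge0 floor_le_tmp.
apply: (@le_trans _ _ 1).
  by rewrite lerBlDl -[1]/(1%:~R) -intrD ltW// floorD1_gt.
rewrite mulrC -ler_pdivrMr// div1r; apply: (@le_trans _ _ k%:R); last by rewrite ler_nat.
near: k; exact: nbhs_infty_ger.
Unshelve. all: by end_near. Qed.

End measurability.

(** * Measurability of suprema over càdlàg paths *)

Section dense_suprema.
Context d (T : measurableType d) (R : realType).

(** Right continuity provides a rational slightly to the right of [s]; the endpoint 1, where there
    is no room to the right, is itself rational. *)
Lemma cadlag_rat_approx (f : R -> R) (s e : R) : cadlag01 f -> s \in `[0, 1] ->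
  0 < e -> exists q : rat, [/\ (ratr q : R) \in `[0, 1], `|s - ratr q| < e &
    `|f s - f (ratr q)| < e].
Proof.
move=> [fr _]; rewrite in_itv /= => /andP[s0 s1] e0.
have [->|s1'] := eqVneq s 1.
  exists 1; rewrite rmorph1 !subrr normr0; split => //.
  by rewrite in_itv /= lexx ler01.
have s1_ : s < 1 by rewrite lt_neqAle s1'.
have sI : s \in `[0, 1[ by rewrite in_itv /= s0.
have /cvgrPdist_lt/(_ _ e0) := fr s sI.
case=> r /= r0 h.
pose y := Num.min 1 (s + Num.min e r).
have sy : s < y by rewrite lt_min s1_ ltrDl lt_min e0.
have [q] := rat_in_itvoo sy; rewrite in_itv /= => /andP[sq qy].
have : (ratr q : R) < 1 /\ ratr q < s + e /\ ratr q < s + r.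
  move: qy; rewrite /y lt_min => /andP[q1]; rewrite -ltrBlDl lt_min.
  by move=> /andP[qe qr]; split => //; split; rewrite -ltrBlDl.
move=> [q1 [qe qr]]; exists q; split.
- by rewrite in_itv /= (le_trans s0 (ltW sq)) ltW.
- by rewrite distrC gtr0_norm ?subr_gt0// ltrBlDl.
- by apply: h => //=; rewrite distrC gtr0_norm ?subr_gt0// ltrBlDl.
Qed.

Variable X : R -> T -> R.
Hypotheses (mX : forall t : R, t \in `[0, 1] -> measurable_fun setT (X t))
  (cX : forall w, cadlag01 (X ^~ w)).

(** By right continuity the superlevel sets are countable unions over rational times. The upper
    bound on the paths keeps [sup] away from its default value. *)
Lemma measurable_sup_conv (K t : R) : 0 <= K ->
  (forall w, exists M, forall s : R, s \in `[0, 1] -> X s w <= M) ->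
  measurable_fun setT (fun w => sup_conv K t (X ^~ w)).
Proof.
move=> K0 bX _; apply: (measurability _ (RGenOInfty.measurableE R)) => //.
move=> _ [_ [x ->] <-]; rewrite setTI.
have -> : (fun w => sup_conv K t (X ^~ w)) @^-1` `]x, +oo[ =
    \bigcup_(q : rat) (if (ratr q : R) \in `[0, 1] then
      (fun w => X (ratr q) w - K * `|ratr q - t|) @^-1` `]x, +oo[ else set0).
  apply/seteqP; split => [w|w [q _]] /=.
    rewrite in_itv /= andbT => /sup_gt[].
      by exists (X 0 w - K * `|0 - t|), 0 => //=; rewrite in_itv /= lexx ler01.
    move=> _ [s s01 <-]; rewrite -subr_gt0 => xs.
    (* Moving to a rational point costs [e] in the value and [K * e] in the penalty, half of the
       margin altogether. *)
    pose e := (X s w - K * `|s - t| - x) / (2 * (1 + K)).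
    have K1 : 0 < 2 * (1 + K) by lra.
    have e0 : 0 < e by rewrite divr_gt0.
    have [q [q01 qs qX]] := cadlag_rat_approx (cX w) s01 e0.
    exists q => //; rewrite q01 /= in_itv /= andbT.
    have h : K * (`|ratr q - t| - `|s - t|) <= K * e.
      apply: ler_wpM2l => //; apply: le_trans (ler_norm _) _.
      by apply: le_trans (ler_distDist _ _ _) _; rewrite distrC ltW.
    have : (1 + K) * e = (X s w - K * `|s - t| - x) / 2.
      by rewrite /e; field; lra.
    move: qX h; rewrite ltr_norml mulrBr mulrDl mul1r => /andP[_ h1] h2 h3; lra.
  case: ifP => // q01; rewrite /= !in_itv /= !andbT => h.
  apply: lt_le_trans h _; apply: ub_le_sup; last by exists (ratr q).
  have [M HM] := bX w; exists M => _ [s s01 <-].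
  by apply: le_trans (HM s s01); rewrite lerBlDr lerDl mulr_ge0.
apply: bigcupT_measurable_rat => q; case: ifP => // q01.
rewrite -[X in measurable X]setTI; apply: measurable_funB => //; exact: mX.
Qed.

Lemma measurable_modulus_excess (K : R) : 0 <= K ->
  measurable_fun setT (fun w => modulus_excess K (X ^~ w)).
Proof.
move=> K0 _; apply: (measurability _ (RGenOInfty.measurableE R)) => //.
move=> _ [_ [x ->] <-]; rewrite setTI.
have -> : (fun w => modulus_excess K (X ^~ w)) @^-1` `]x, +oo[ =
    \bigcup_(q : (rat * rat)%type)
    (if ((ratr q.1 : R) \in `[0, 1]) && ((ratr q.2 : R) \in `[0, 1]) then
      (fun w => Num.min 1 (`|X (ratr q.1) w - X (ratr q.2) w|
         - K * `|ratr q.1 - ratr q.2|)) @^-1` `]x, +oo[ else set0).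
  apply/seteqP; split => [w|w [q _]] /=.
    rewrite in_itv /= andbT => /sup_gt[].
      by eexists; exists (0, 0) => //=; rewrite in_itv /= lexx ler01.
    move=> _ [[s s'] [/= s01 s01'] <-]; rewrite lt_min => /andP[x1 xs].
    rewrite -subr_gt0 in xs.
    (* Two points move here, at a cost of [2 * (1 + K) * e], two thirds of the margin. *)
    pose e := (`|X s w - X s' w| - K * `|s - s'| - x) / (3 * (1 + K)).
    have K1 : 0 < 3 * (1 + K) by lra.
    have e0 : 0 < e by rewrite divr_gt0.
    have [q [q01 qs qX]] := cadlag_rat_approx (cX w) s01 e0.
    have [q' [q01' qs' qX']] := cadlag_rat_approx (cX w) s01' e0.
    exists (q, q') => //; rewrite q01 q01' /= in_itv /= andbT lt_min x1 /=.
    have k : K * (`|ratr q - ratr q'| - `|s - s'|) <= K * (2 * e).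
      apply: ler_wpM2l => //; apply: le_trans (ler_norm _) _.
      apply: le_trans (ler_dist_dist _ _) _.
      rewrite (_ : _ - _ - _ = (s' - ratr q') - (s - ratr q)); last by ring.
      by apply: le_trans (ler_normB _ _) _; lra.
    have k' : `|X s w - X s' w| - `|X (ratr q) w - X (ratr q') w| <= 2 * e.
      apply: le_trans (ler_norm _) _.
      apply: le_trans (ler_dist_dist _ _) _.
      rewrite (_ : _ - _ - _ = (X s w - X (ratr q) w) -
        (X s' w - X (ratr q') w)); last by ring.
      by apply: le_trans (ler_normB _ _) _; lra.
    have : (1 + K) * e = (`|X s w - X s' w| - K * `|s - s'| - x) / 3.
      by rewrite /e; field; lra.
    move: k k'; rewrite mulrBr mulrDl mul1r => k k'; lra.
  case: ifP => // /andP[q01 q01']; rewrite /= !in_itv /= !andbT => h.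
  apply: lt_le_trans h _; apply: ub_le_sup; last by exists (ratr q.1, ratr q.2).
  by exists 1 => _ [st _ <-]; rewrite ge_min lexx.
apply: countable_bigcupT_measurable; first exact: countableP.
move=> q; case: ifP => // /andP[q01 q01'].
rewrite -[X in measurable X]setTI; apply: measurable_minr => //.
apply: measurable_funB => //; apply: measurableT_comp => //.
by apply: measurable_funB; exact: mX.
Qed.

End dense_suprema.

(** * Factorization of means under independence *)

Section mean_independence.
Context d (T : measurableType d) (R : realType) (P : probability T R).

(** For a step function constant on sets [f @^-1] [[a, b[] the factorization is the independence of
    events. Such functions approximate [f] uniformly within [1 / k.+1], and the error enters once on
    each side of the equation. *)
Lemma mean_independent (G1 G2 : set (set T)) (f : T -> R) (A : set T) (M : R) :
  independent_sigma P G1 G2 -> measurable_fun setT f ->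
  (forall a b : R, G1 (f @^-1` `[a, b[)) -> (forall w, `|f w| <= M) ->
  G2 A -> measurable A -> mean P (fun w => f w * \1_A w) = mean P f * prob P A.
Proof.
move=> ind mf G1f fM G2A mA.
have prob01 : 0 <= prob P A <= 1 by rewrite prob_ge0 prob_le1.
have mI B : measurable B -> measurable_fun setT (\1_B : T -> R).
  by move=> mB; exact: measurable_indic.
have I01 B (w : T) : 0 <= (\1_B w : R) <= 1.
  by rewrite indicE; case: (_ \in _); rewrite ?lexx ?ler01.
have I1 B (w : T) : `|\1_B w : R| <= 1.
  by have /andP[h1 h2] := I01 B w; rewrite ger0_norm.
have fIM w : `|f w * \1_A w| <= M.
  rewrite normrM; apply: le_trans (fM w); by rewrite ler_piMr.
have simple k : `|mean P (fun w => f w * \1_A w) - mean P f * prob P A| <=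
    2 / k.+1%:R.
  have k0 : 0 < k.+1%:R :> R by [].
  have [n Mn] : exists n, k.+1%:R * (M + M) < n%:R.
    by exists (Num.truncn (k.+1%:R * (M + M))).+1; exact: truncnS_gt.
  (* [f] rounded down to a multiple of [1 / k.+1], counted from [- M]. *)
  pose tr w := Num.truncn (k.+1%:R * (f w + M)).
  have fM0 w : 0 <= f w + M by have := fM w; rewrite ler_norml => /andP[]; lra.
  have tr_itv w : (tr w)%:R <= k.+1%:R * (f w + M) < (tr w).+1%:R.
    by apply: truncn_itv; rewrite mulr_ge0.
  have trn w : (tr w < n)%N.
    rewrite -(ltr_nat R); apply: le_lt_trans Mn; case/andP: (tr_itv w) => h _.
    apply: le_trans h _; rewrite ler_pM2l// lerD2r.
    by apply: le_trans (fM w); exact: ler_norm.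
  pose L (i : 'I_n) := tr @^-1` [set (i : nat)].
  pose v (i : nat) : R := i%:R / k.+1%:R - M.
  have LE i : L i = f @^-1` `[v i, v i.+1[.
    apply/seteqP; split => w /=; rewrite in_itv /= /v.
      move=> wi; have := tr_itv w; rewrite wi.
      rewrite !lerBlDr ltrBrDr ler_pdivrMr// ltr_pdivlMr//.
      by rewrite !(mulrC _ k.+1%:R).
    rewrite !lerBlDr ltrBrDr ler_pdivrMr// ltr_pdivlMr// !(mulrC _ k.+1%:R).
    exact: truncn_def.
  have GL i : G1 (L i) by rewrite LE; exact: G1f.
  have mL i : measurable (L i).
    by rewrite LE -[X in measurable X]setTI; apply: mf.
  have V0 : 0 <= `|M| + n%:R / k.+1%:R by rewrite addr_ge0// divr_ge0.
  have vV (i : 'I_n) : `|v i| <= `|M| + n%:R / k.+1%:R.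
    apply: le_trans (ler_normB _ _) _; rewrite addrC lerD2l ger0_norm ?divr_ge0//.
    by rewrite ler_pM2r ?invr_gt0// ler_nat ltnW.
  have mvL (i : 'I_n) : measurable_fun setT (fun w => v i * \1_(L i) w).
    by apply: measurable_funM => //; exact: mI.
  have vLV (i : 'I_n) B w : `|v i * \1_(L i) w * \1_B w| <= `|M| + n%:R / k.+1%:R.
    rewrite -mulrA normrM; apply: le_trans (vV i); rewrite ler_piMr// normrM.
    by apply: mulr_ile1.
  pose fk w := \sum_(i < n) v i * \1_(L i) w.
  have fkE w : fk w = v (tr w).
    rewrite /fk (bigD1 (Ordinal (trn w)))//= indicE mem_set ?mulr1//.
    rewrite big1 ?addr0// => i; rewrite -val_eqE /= => ni.
    by rewrite indicE memNset ?mulr0// /L /= => /esym/eqP; rewrite (negbTE ni).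
  have mfk : mean P fk * prob P A = mean P (fun w => fk w * \1_A w).
    have -> : (fun w => fk w * \1_A w) =
        fun w => \sum_(i < n) v i * \1_(L i) w * \1_A w.
      by apply/funext => w; rewrite /fk mulr_suml.
    rewrite (@mean_sum _ _ _ _ _ (`|M| + n%:R / k.+1%:R))//; last first.
      by move=> i w; rewrite -[X in `|X|]mulr1; have := vLV i setT w; rewrite indicT.
    rewrite (@mean_sum _ _ _ _ _ (`|M| + n%:R / k.+1%:R)); last 2 first.
    - by move=> i; apply: measurable_funM => //; exact: mI.
    - by move=> i w; exact: vLV.
    rewrite mulr_suml; apply: eq_bigr => i _.
    rewrite (meanZ P _ (mI _ (mL i)) (I1 _)) mean_indic//.
    have -> : (fun w => v i * \1_(L i) w * \1_A w) =
        fun w => v i * \1_(L i `&` A) w.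
      by apply/funext => w; rewrite indicI /= mulrA.
    have mLA : measurable (L i `&` A) by exact: measurableI.
    rewrite (meanZ P _ (mI _ mLA) (I1 _)) mean_indic// -mulrA; congr (_ * _).
    by rewrite /prob ind// fineM// fin_num_measure.
  have close w : `|f w - fk w| <= 1 / k.+1%:R.
    rewrite fkE /v (_ : _ - _ = (k.+1%:R * (f w + M) - (tr w)%:R) / k.+1%:R).
      rewrite normrM normfV (gtr0_norm k0) ler_pM2r ?invr_gt0//.
      have /andP[h1 h2] := tr_itv w.
      by rewrite ger0_norm ?subr_ge0// lerBlDl natr1 ltW.
    by field; rewrite gt_eqF.
  have M0 (w : T) : 0 <= M by apply: le_trans (fM w).
  have fkM w : `|fk w| <= M + 1 / k.+1%:R.
    have -> : fk w = f w - (f w - fk w) by rewrite opprB addrC subrK.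
    by apply: le_trans (ler_normB _ _) (lerD (fM w) (close w)).
  have k1 : 0 <= 1 / k.+1%:R :> R by rewrite divr_ge0.
  have mfkm : measurable_fun setT fk by apply: measurable_sum.
  have fM' w : `|f w| <= M + 1 / k.+1%:R by rewrite (le_trans (fM w))// lerDl.
  have prob0 : prob P set0 = 0 by rewrite /prob measure0.
  have h1 : `|mean P f - mean P fk| <= 1 / k.+1%:R.
    have := mean_sandwich P k1 measurable0 mfkm fM' fkM (fun w _ => close w).
    by rewrite prob0 mulr0 addr0.
  have h2 : `|mean P (fun w => f w * \1_A w) - mean P (fun w => fk w * \1_A w)|
      <= 1 / k.+1%:R.
    have b1 w : `|f w * \1_A w| <= M + 1 / k.+1%:R.
      by rewrite (le_trans (fIM w))// lerDl.
    have b2 w : `|fk w * \1_A w| <= M + 1 / k.+1%:R.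
      by rewrite normrM; apply: le_trans (fkM w); rewrite ler_piMr.
    have b3 : measurable_fun setT (fun w => fk w * \1_A w).
      by apply: measurable_funM => //; exact: mI.
    have b4 w : ~ set0 w -> `|f w * \1_A w - fk w * \1_A w| <= 1 / k.+1%:R.
      by move=> _; rewrite -mulrBl normrM; apply: le_trans (close w); rewrite ler_piMr.
    have := mean_sandwich P k1 measurable0 b3 b1 b2 b4.
    by rewrite prob0 mulr0 addr0.
  have h3 : `|mean P f * prob P A - mean P fk * prob P A| <= 1 / k.+1%:R.
    rewrite -mulrBl normrM; apply: le_trans h1.
    by case/andP: prob01 => p0 p1; rewrite ler_piMr// ger0_norm.
  rewrite -[2]/(1 + 1) mulrDl; apply: le_trans (lerD h2 h3).
  rewrite (distrC (_ * _) (_ * _)) mfk; exact: ler_distD.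
apply/eqP; rewrite -subr_eq0 -normr_le0; apply/ler_addgt0Pr => e e0.
have [k ke] : exists k, 2 / e < k%:R.
  by exists (Num.truncn (2 / e)).+1; exact: truncnS_gt.
rewrite add0r; apply: le_trans (simple k) _; rewrite ler_pdivrMr//.
rewrite mulrC -ler_pdivrMr//; apply: le_trans (ltW ke) _; by rewrite ler_nat.
Qed.

End mean_independence.

(** * Discretized paths *)

Lemma cvg_finsum {R : realType} (I : Type) (r : seq I) (f : I -> nat -> R) (l : I -> R) :
  (forall i, f i n @[n --> \oo] --> l i) ->
  \sum_(i <- r) f i n @[n --> \oo] --> \sum_(i <- r) l i.
Proof.
move=> fl; elim: r => [|i r IH].
  by rewrite big_nil; under eq_fun do rewrite big_nil; exact: cvg_cst.
by rewrite big_cons; under eq_fun do rewrite big_cons; exact: cvgD.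
Qed.

Section discretization.
Context {R : realType}.

Definition discretize (m : nat) (dl K : R) (c : nat -> nat) (f : R -> R) : D01 R :=
  toD (step_path m (bumped dl (fun i => sup_conv K (i%:R / m%:R) f) c)).

Lemma discretizeE m dl K c f : D01_fun (discretize m dl K c f) =
  step_path m (bumped dl (fun i => sup_conv K (i%:R / m%:R) f) c).
Proof. exact/toDE/cadlag_step_path. Qed.

Lemma truncn_grid_le (m : nat) (t : R) : t \in `[0, 1] ->
  (Num.truncn (m%:R * t) <= m)%N.
Proof.
rewrite in_itv /= => /andP[t0 t1].
have := @le_truncn R (m%:R * t) m%:R; rewrite natrK; apply.
by rewrite ler_piMr.
Qed.

Lemma step_path_dist m (a b : nat -> R) (e : R) :
  (forall i, (i <= m)%N -> `|a i - b i| <= e) ->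
  forall t : R, t \in `[0, 1] -> `|step_path m a t - step_path m b t| <= e.
Proof.
move=> ab t t01; apply: runmax_dist => i ik; apply: ab.
by apply: leq_trans ik _; exact: truncn_grid_le.
Qed.

(** Both images are step paths on the same grid with the same levels, so that the identity serves as
    time change: [1 + K] is the Lipschitz constant of the sup-convolutions, and the remaining [e]
    makes the bound strict. *)
Lemma discretize_J1 m dl K c (f g : R -> R) (e : R) : 0 <= K -> J1_ball f e g ->
  J1_ball (discretize m dl K c f) ((2 + K) * e) (discretize m dl K c g).
Proof.
move=> K0 B; have e0 := J1_ball_gt0 B; rewrite !discretizeE.
apply: (@J1_ball_uniform _ _ _ ((1 + K) * e)).
- by rewrite ltr_pM2r//; lra.
- by rewrite mulr_gt0//; lra.
apply: step_path_dist => -[|i] _ /=; first exact: sup_conv_lipschitz.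
by rewrite opprD addrACA subrr addr0; exact: sup_conv_lipschitz.
Qed.

(** The two step paths agree on [[0, 1]] but may differ elsewhere, so they are only at J1 distance
    zero; a continuous functional does not separate them. *)
Lemma discretize_ext m dl K c c' f : (forall j, (j < m)%N -> c j = c' j) ->
  forall F : D01 R -> R, continuous F ->
  F (discretize m dl K c f) = F (discretize m dl K c' f).
Proof.
move=> cc F /J1_continuousP cF; apply/eqP; rewrite -subr_eq0 -normr_le0.
apply/ler_addgt0Pr => e e0; rewrite add0r.
have [r r0 h] := cF (discretize m dl K c f) e e0.
apply/ltW/h; rewrite !discretizeE; apply: (@J1_ball_uniform _ _ _ 0) => //.
apply: step_path_dist => -[|i] im /=; first by rewrite subrr normr0.
by rewrite cc// subrr normr0.
Qed.

Lemma lipschitz_discretize m dl K c L (F : D01 R -> R) : 0 <= K ->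
  J1_lipschitz L F -> J1_lipschitz (L * (2 + K)) (fun f : D01 R =>
    F (discretize m dl K c f)).
Proof.
by move=> K0 FL f g e B; rewrite -mulrA; apply: FL; exact: discretize_J1.
Qed.

(** On step paths over a fixed grid, [F] is a continuous function of the [m.+1] values, since
    uniform closeness implies J1 closeness. Measurability is thus obtained without a sigma-algebra
    on the path space. *)
Lemma measurable_step_functional d (T : measurableType d) m (F : D01 R -> R)
    (a : nat -> T -> R) : continuous F -> (forall i, measurable_fun setT (a i)) ->
  measurable_fun setT (fun w => F (toD (step_path m (a ^~ w)))).
Proof.
move=> cF ma.
have key (x y : nat -> R) (r : R) : 0 < r ->
    (forall i, (i <= m)%N -> `|x i - y i| < r) ->
    J1_ball (toD (step_path m x)) r (toD (step_path m y)).
  move=> r0 xy; rewrite !toDE; [|exact: cadlag_step_path..].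
  pose r' := \big[Num.max/0]_(i < m.+1) `|x i - y i|.
  apply: (@J1_ball_uniform _ _ _ r') => //.
    by apply: bigmax_lt => // i _; apply: xy; rewrite -ltnS.
  apply: step_path_dist => i im.
  exact: (le_bigmax 0 (fun i : 'I_m.+1 => `|x i - y i|) (Ordinal (im : (i < m.+1)%N))).
apply: (@measurable_fin_comp _ _ _ m a
    (fun x => F (toD (step_path m x)))) => //.
- move=> x y xy; apply/cvgrPdist_lt => e e0.
  have [r r0 h] := (J1_continuousP F).1 cF (toD (step_path m y)) e e0.
  have : \forall k \near \oo, forall i : 'I_m.+1, `|y i - x k i| < r.
    apply: filter_forall => i; have /cvgrPdist_lt := xy i; exact.
  apply: filterS => k H; apply: h; apply: key => // i im.
  exact: (H (Ordinal (im : (i < m.+1)%N))).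
- move=> x y xy; apply/eqP; rewrite -subr_eq0 -normr_le0.
  apply/ler_addgt0Pr => e e0; rewrite add0r.
  have [r r0 h] := (J1_continuousP F).1 cF (toD (step_path m x)) e e0.
  by apply/ltW/h/key => // i im; rewrite xy// subrr normr0.
Qed.

Lemma measurable_discretize d (T : measurableType d) (X : R -> T -> R)
    m dl K (c : nat -> nat) (F : D01 R -> R) : continuous F ->
  (forall t : R, measurable_fun setT (fun w => sup_conv K t (X ^~ w))) ->
  measurable_fun setT (fun w => F (discretize m dl K c (X ^~ w))).
Proof.
move=> cF mX; apply: (@measurable_step_functional _ _ _ _ (fun i w =>
  bumped dl (fun i => sup_conv K (i%:R / m%:R) (X ^~ w)) c i)) => // -[|i] /=.
  exact: mX.
by apply: measurable_funD => //; exact: mX.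
Qed.

End discretization.

(** * Finite configurations of levels *)

Section cells.
Context d (T : measurableType d) (R : realType) (P : probability T R).
Variables (m : nat) (C : T -> nat -> nat).
Hypothesis mC : forall j k, measurable [set w | (C w j <= k)%N].

Definition orthant (k : nat -> nat) : set T :=
  [set w | forall j, (j < m)%N -> (C w j <= k j)%N].

Definition cell (k : nat -> nat) : set T :=
  [set w | forall j, (j < m)%N -> C w j = k j].

(* Interpolates between [orthant] and [cell], one coordinate at a time. *)
Definition mixed (r : nat) (k : nat -> nat) : set T :=
  [set w | forall j, (j < m)%N -> if (j < r)%N then C w j = k j else (C w j <= k j)%N].

Lemma measurable_finite_forall (Q : nat -> set T) : (forall j, measurable (Q j)) ->
  measurable [set w | forall j, (j < m)%N -> Q j w].
Proof.
move=> mQ; rewrite (_ : [set w | _] = \bigcap_(j in `I_m) Q j).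
  by apply: fin_bigcap_measurable => //; exact: finite_II.
by apply/seteqP; split.
Qed.

Lemma measurable_level_eq j k : measurable [set w | C w j = k].
Proof.
case: k => [|k].
  rewrite (_ : [set w | _] = [set w | (C w j <= 0)%N])//.
  by apply/seteqP; split => w /=; [move=> ->|rewrite leqn0 => /eqP].
rewrite (_ : [set w | _] = [set w | (C w j <= k.+1)%N] `\` [set w | (C w j <= k)%N]).
  exact: measurableD.
apply/seteqP; split => w /=; first by move=> ->; rewrite leqnn ltnn.
move=> [h /negP]; rewrite -ltnNge => h'; apply/eqP; by rewrite eqn_leq h.
Qed.

Lemma measurable_mixed r k : measurable (mixed r k).
Proof.
apply: (measurable_finite_forall (Q := fun j => [set w |
  if (j < r)%N then C w j = k j else (C w j <= k j)%N])) => j.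
by case: (j < r)%N; [exact: measurable_level_eq|exact: mC].
Qed.

Lemma measurable_cell k : measurable (cell k).
Proof.
apply: (measurable_finite_forall (Q := fun j => [set w | C w j = k j])) => j.
exact: measurable_level_eq.
Qed.

Lemma mixed0 k : mixed 0 k = orthant k.
Proof. by apply/seteqP; split => w h j jm; exact: (h j jm). Qed.

Lemma mixed_full k : mixed m k = cell k.
Proof. by apply/seteqP; split => w h j jm; have := h j jm; rewrite jm. Qed.

Lemma mixedS_0 r k : (r < m)%N -> k r = 0%N -> mixed r.+1 k = mixed r k.
Proof.
move=> rm k0; apply/seteqP; split => w h j jm; have := h j jm;
  rewrite [(j < r.+1)%N]ltnS [(j <= r)%N]leq_eqVlt; have [->|jr] := eqVneq j r.
- by rewrite ltnn => ->.
- by [].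
- by rewrite ltnn k0 leqn0 => /eqP.
- by [].
Qed.

(** The event [C w r = i.+1] is [C w r <= i.+1] without [C w r <= i]. *)
Lemma prob_mixedS r k i : (r < m)%N -> k r = i.+1 ->
  prob P (mixed r.+1 k) = prob P (mixed r k) -
    prob P (mixed r (fun j => if j == r then i else k j)).
Proof.
move=> rm ki; rewrite -prob_setD; [|exact: measurable_mixed..|].
  congr prob; apply/seteqP; split => [w h|w [h nh] j jm].
    split.
      move=> j jm; have := h j jm; rewrite [(j < r.+1)%N]ltnS [(j <= r)%N]leq_eqVlt.
      by have [->|jr] := eqVneq j r; first by rewrite ltnn => ->.
    by move=> /(_ r rm); rewrite ltnn eqxx; have := h r rm; rewrite ltnSn ki => ->; rewrite ltnn.
  have := h j jm; rewrite [(j < r.+1)%N]ltnS [(j <= r)%N]leq_eqVlt.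
  have [->|//] := eqVneq j r.
  rewrite ltnn /= => hr; apply/eqP; rewrite eqn_leq hr ki ltnNge; apply/negP => hi.
  apply: nh => j' jm'; have := h j' jm'; have [->|//] := eqVneq j' r.
  by rewrite ltnn.
move=> w h j jm; have := h j jm; have [->|//] := eqVneq j r.
by rewrite ltnn ki => /leq_trans; apply.
Qed.

Variable N : nat.
Hypothesis CN : forall w j, (C w j <= N)%N.

(** Configurations of levels on the [m] cells form a finite type, over which sums can be taken;
    [code] reads one back as a sequence, with value 0 beyond the last cell. *)
Definition code (k : {ffun 'I_m -> 'I_N.+1}) (j : nat) : nat :=
  if insub j is Some i then k i else 0%N.

(** Once the levels are frozen at a configuration, only the path is random in the functional, and
    the indicator of that configuration factors out by independence. *)
Lemma mean_discretize (X : R -> T -> R) (F : D01 R -> R) (M dl K : R) :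
  continuous F -> (forall f, `|F f| <= M) ->
  (forall c, measurable_fun setT (fun w => F (discretize m dl K c (X ^~ w)))) ->
  (forall c k, mean P (fun w => F (discretize m dl K c (X ^~ w)) * \1_(cell k) w) =
     mean P (fun w => F (discretize m dl K c (X ^~ w))) * prob P (cell k)) ->
  measurable_fun setT (fun w => F (discretize m dl K (C w) (X ^~ w))) /\
  mean P (fun w => F (discretize m dl K (C w) (X ^~ w))) =
  \sum_(k : {ffun 'I_m -> 'I_N.+1})
    mean P (fun w => F (discretize m dl K (code k) (X ^~ w))) * prob P (cell (code k)).
Proof.
move=> cF FM mF ind.
have mI B : measurable B -> measurable_fun setT (\1_B : T -> R).
  by move=> mB; exact: measurable_indic.
have -> : (fun w => F (discretize m dl K (C w) (X ^~ w))) =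
  fun w => \sum_(k : {ffun 'I_m -> 'I_N.+1})
    F (discretize m dl K (code k) (X ^~ w)) * \1_(cell (code k)) w.
  apply/funext => w; pose k0 := [ffun j : 'I_m => (inord (C w j) : 'I_N.+1)].
  have k0E j : (j < m)%N -> C w j = code k0 j.
    by move=> jm; rewrite /code insubT ffunE inordK// ltnS.
  rewrite (bigD1 k0)//= indicE mem_set//= mulr1 big1 ?addr0.
    exact: discretize_ext.
  move=> k kk0; rewrite indicE memNset ?mulr0// => h; move: kk0 => /eqP; apply.
  apply/ffunP => j; apply/val_inj; rewrite /= ffunE inordK ?ltnS//.
  by rewrite (h j (ltn_ord j)) /code valK.
split.
  apply: measurable_sum => k; apply: measurable_funM => //.
  by apply: mI; exact: measurable_cell.
rewrite (@mean_sum _ _ _ _ _ M).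
- by apply: eq_bigr => k _; exact: ind.
- by move=> k; apply: measurable_funM => //; apply: mI; exact: measurable_cell.
- move=> k w; rewrite normrM; apply: (le_trans _ (FM (discretize m dl K (code k) (X ^~ w)))).
  rewrite ler_piMr//.
  by rewrite indicE; case: (_ \in _); rewrite ?normr0 ?normr1 ?ler01.
Qed.

End cells.

(** * Joint convergence of path and levels *)

Section joint_convergence.
Context {R : realType} d (T : measurableType d) (P : probability T R)
  d' (T' : measurableType d') (P' : probability T' R).
Variables (m N : nat) (C : nat -> T -> nat -> nat) (C' : T' -> nat -> nat).
Hypotheses (mC : forall n j k, measurable [set w | (C n w j <= k)%N])
  (mC' : forall j k, measurable [set w | (C' w j <= k)%N])
  (CN : forall n w j, (C n w j <= N)%N) (CN' : forall w j, (C' w j <= N)%N)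
  (Cc : forall k, prob P (orthant m (C n) k) @[n --> \oo] --> prob P' (orthant m C' k)).

(** Probabilities of cells are finite combinations of differences of orthant probabilities, one
    coordinate after the other; a coordinate equal to 0 needs no difference. *)
Lemma cvg_cell k : prob P (cell m (C n) k) @[n --> \oo] --> prob P' (cell m C' k).
Proof.
rewrite -mixed_full; under eq_fun do rewrite -mixed_full.
suff H r : (r <= m)%N -> forall k, prob P (mixed m (C n) r k) @[n --> \oo] -->
    prob P' (mixed m C' r k) by exact: H.
elim: r => [_|r IH rm] {}k.
  by rewrite mixed0; under eq_fun do rewrite mixed0; exact: Cc.
case kr : (k r) => [|i].
  rewrite mixedS_0//; under eq_fun do rewrite mixedS_0//.
  exact: IH (ltnW rm) _.
rewrite (prob_mixedS _ _ rm kr)//; under eq_fun do rewrite (prob_mixedS _ _ rm kr)//.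
by apply: cvgB; exact: IH (ltnW rm) _.
Qed.

(** In the finite sum over configurations each term is the mean of a Lipschitz functional of the
    path, to which the convergence of [S] applies, times a cell probability. *)
Lemma cvg_mean_discretize (S : nat -> R -> T -> R) (B : R -> T' -> R)
    (F : D01 R -> R) (M L dl K : R) : 0 <= K ->
  cvg_in_distr_D01 P P' S B ->
  (forall n w, cadlag01 (S n ^~ w)) -> (forall w, cadlag01 (B ^~ w)) ->
  J1_lipschitz L F -> (forall f, `|F f| <= M) ->
  (forall n c, measurable_fun setT (fun w => F (discretize m dl K c (S n ^~ w)))) ->
  (forall c, measurable_fun setT (fun w => F (discretize m dl K c (B ^~ w)))) ->
  (forall n c k, mean P (fun w => F (discretize m dl K c (S n ^~ w)) *
      \1_(cell m (C n) k) w) =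
    mean P (fun w => F (discretize m dl K c (S n ^~ w))) * prob P (cell m (C n) k)) ->
  (forall c k, mean P' (fun w => F (discretize m dl K c (B ^~ w)) *
      \1_(cell m C' k) w) =
    mean P' (fun w => F (discretize m dl K c (B ^~ w))) * prob P' (cell m C' k)) ->
  mean P (fun w => F (discretize m dl K (C n w) (S n ^~ w))) @[n --> \oo] -->
  mean P' (fun w => F (discretize m dl K (C' w) (B ^~ w))).
Proof.
move=> K0 [_ _ hS] cS cB FL FM mS mB indS indB.
have cF := J1_lipschitz_continuous FL.
rewrite (mean_discretize mC' CN' cF FM mB indB).2.
under eq_fun do rewrite (mean_discretize (mC _) (CN _) cF FM (mS _) (indS _)).2.
apply: cvg_finsum => k; apply: cvgM; last exact: cvg_cell.
have cG := J1_lipschitz_continuous (lipschitz_discretize m dl (code k) K0 FL).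
have bG : exists M0, forall f : D01 R, `|F (discretize m dl K (code k) f)| <= M0.
  by exists M.
have := hS _ cG bG.
rewrite (_ : (fun w => F (discretize m dl K (code k) (toD (B ^~ w)))) =
  fun w => F (discretize m dl K (code k) (B ^~ w))); last first.
  by apply/funext => w; rewrite toDE.
rewrite (meanE P' (fun w => FM (discretize m dl K (code k) (B ^~ w)))) => h.
rewrite [X in X @ _ --> _](_ : _ = fine \o (fun n =>
    'E_P[fun w => F (discretize m dl K (code k) (toD (S n ^~ w)))]%E)).
  exact: fine_cvg h.
apply/funext => n.
by rewrite /mean /=; congr (fine ('E_P[_])); apply/funext => w; rewrite toDE.
Qed.

End joint_convergence.

(** * Convergence in distribution by approximation *)

Section convergence_by_approximation.
Context {R : realType} d (T : measurableType d) (P : probability T R)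
  d' (T' : measurableType d') (P' : probability T' R).
Variables (W : nat -> R -> T -> R) (Z : R -> T' -> R).

(** The hypothesis of a converging-together theorem, with the same [e] for the distance and for the
    exceptional probabilities. The approximants are tested on Lipschitz functionals only, because
    discretization turns these into Lipschitz functionals of the path. *)
Definition J1_approximable (e : R) : Prop :=
  exists (A : nat -> T -> D01 R) (A' : T' -> D01 R) (E : nat -> set T) (E' : set T'),
  [/\ forall n w, ~ E n w -> J1_ball (A n w) e (W n ^~ w),
      forall w, ~ E' w -> J1_ball (A' w) e (Z ^~ w),
      (forall n, measurable (E n)) /\ measurable E',
      (\forall n \near \oo, prob P (E n) <= e) /\ prob P' E' <= e &
      forall (F : D01 R -> R) (L M : R), J1_lipschitz L F -> (forall f, `|F f| <= M) ->
        [/\ forall n, measurable_fun setT (F \o A n), measurable_fun setT (F \o A') &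
            mean P (F \o A n) @[n --> \oo] --> mean P' (F \o A')]].

Hypotheses (cW : forall n w, cadlag01 (W n ^~ w))
  (approx : forall e, 0 < e -> J1_approximable e).

(* Borel-Cantelli along the accuracies [2 ^- (k + 1)]. *)
Lemma exists_full_set : exists Om : set T', [/\ measurable Om, prob P' (~` Om) = 0 &
  exists A : nat -> T' -> D01 R,
    (forall (F : D01 R -> R) (L M : R), J1_lipschitz L F -> (forall f, `|F f| <= M) ->
       forall k, measurable_fun setT (F \o A k)) /\
    forall w, Om w -> forall e, 0 < e -> \forall k \near \oo,
      J1_ball (A k w) e (Z ^~ w)].
Proof.
pose p (k : nat) : R := 1 / (2 ^ k.+1)%:R.
have p0 k : 0 < p k by rewrite divr_gt0// ltr0n expn_gt0.
have /choice[AE AEP] : forall k, exists AE : (T' -> D01 R) * set T',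
    [/\ measurable AE.2, prob P' AE.2 <= p k,
        forall w, ~ AE.2 w -> J1_ball (AE.1 w) (p k) (Z ^~ w) &
        forall (F : D01 R -> R) (L M : R), J1_lipschitz L F ->
          (forall f, `|F f| <= M) -> measurable_fun setT (F \o AE.1)].
  move=> k; have [A [A' [E [E' [_ h2 [_ h3] [_ h4] h5]]]]] := approx (p0 k).
  by exists (A', E'); split => // F L M FL FM; have [] := h5 F L M FL FM.
pose E k := (AE k).2; have mE k : measurable (E k) by have [] := AEP k.
have EP k : (P' (E k) <= (p k)%:E)%E.
  by have [mEk ? _ _] := AEP k; rewrite probE// lee_fin.
have s0 : (P' (lim_sup_set E) = 0)%E.
  apply: lim_sup_set_cvg0 => //.
  apply: (@le_lt_trans _ _ (\sum_(0 <= k <oo) (p k)%:E)%E).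
    by apply: lee_nneseries => // k _; exact: EP.
  apply: le_lt_trans (epsilon_trick0 xpredT ler01) _; exact: ltry.
exists (~` lim_sup_set E); split.
- by apply: measurableC; apply: bigcap_measurableType => j _; apply: bigcup_measurable.
- by rewrite setCK /prob s0.
exists (fun k => (AE k).1); split => [F L M FL FM k|w Ow e e0].
  by have [_ _ _ /(_ F L M FL FM)] := AEP k.
have [n0 En0] : exists n0, forall k, (n0 <= k)%N -> ~ E k w.
  apply: contrapT => H; apply: Ow => n _ /=.
  apply: contrapT => H'; apply: H; exists n => k nk Ekw; apply: H'.
  by exists k.
near=> k; have [_ _ h _] := AEP k.
apply: (J1_ball_le (e := p k)); last first.
  by apply: h; apply: En0; near: k; exact: nbhs_infty_ge.
rewrite /p ler_pdivrMr ?ltr0n ?expn_gt0// mulrC -ler_pdivrMr//.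
apply: (@le_trans _ _ k%:R); first by near: k; exact: nbhs_infty_ger.
rewrite ler_nat; apply: leq_trans (ltnW (ltn_expl k (leqnn 2))) _.
by rewrite leq_exp2l.
Unshelve. all: by end_near. Qed.

Lemma ae_cadlag_limit : {ae P', forall w, cadlag01 (Z ^~ w)}.
Proof.
have [Om [mO PO [A [_ OZ]]]] := exists_full_set.
exists (~` Om); split; first exact: measurableC.
  by rewrite (probE P')// ?PO//; exact: measurableC.
apply: subsetC => w Ow; apply: cadlag_J1_closure => e e0.
have [k _ /(_ k (leqnn k)) h] := OZ w Ow e e0.
by exists (A k w); [exact: D01_cadlag|exact: J1_ball_sym].
Qed.

(** For Lipschitz [F] the product is the limit of the measurable [F (A k)] on [Om]; continuous [F]
    follow through inf-convolutions. The indicator discards the null set on which nothing is known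
    about [Z]. *)
Let full_set_limit : exists Om : set T', [/\ measurable Om, prob P' (~` Om) = 0,
    forall w, Om w -> cadlag01 (Z ^~ w) &
    forall (F : D01 R -> R) (M : R), continuous F -> (forall f, `|F f| <= M) ->
      measurable_fun setT (fun w => F (toD (Z ^~ w)) * \1_Om w)].
Proof.
have [Om [mO PO [A [mA OZ]]]] := exists_full_set.
have cZ w : Om w -> cadlag01 (Z ^~ w).
  move=> Ow; apply: cadlag_J1_closure => e e0.
  have [k _ /(_ k (leqnn k)) h] := OZ w Ow e e0.
  by exists (A k w); [exact: D01_cadlag|exact: J1_ball_sym].
have mO1 : measurable_fun setT (\1_Om : T' -> R) by exact: measurable_indic.
exists Om; split => //.
suff mlip (F : D01 R -> R) (L M : R) : J1_lipschitz L F -> (forall f, `|F f| <= M) ->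
    measurable_fun setT (fun w => F (toD (Z ^~ w)) * \1_Om w).
  move=> F M cF FM.
  apply: (@measurable_fun_cvg _ _ _ _
    (fun n w => inf_conv n%:R F (toD (Z ^~ w)) * \1_Om w)).
    move=> n; apply: (mlip _ n%:R M); first exact: inf_conv_lipschitz FM _ _.
    by move=> f; apply: inf_conv_norm FM _ _ _.
  by move=> w _; apply: cvgM; [exact: inf_conv_cvg FM _|exact: cvg_cst].
move=> FL FM; apply: (@measurable_fun_cvg _ _ _ _
    (fun k w => F (A k w) * \1_Om w)).
  by move=> k; apply: measurable_funM => //; exact: mA FL FM k.
move=> w _; rewrite indicE; case: (boolP (w \in Om)); last first.
  by move=> _; rewrite mulr0; under eq_fun do rewrite mulr0; exact: cvg_cst.
rewrite inE mulr1 => Ow; under eq_fun do rewrite mulr1.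
apply/cvgrPdist_lt => e e0.
have [r r0 h] := (J1_continuousP F).1 (J1_lipschitz_continuous FL)
  (toD (Z ^~ w)) e e0.
have := OZ w Ow r r0; apply: filterS => k B; apply: h.
by rewrite toDE; [exact: J1_ball_sym|exact: cZ].
Qed.

Let mean_limit_lipschitz (F : D01 R -> R) (L M : R) :
  J1_lipschitz L F -> (forall f, `|F f| <= M) ->
  mean P (fun w => F (toD (W n ^~ w))) @[n --> \oo] -->
  mean P' (fun w => F (toD (Z ^~ w))).
Proof.
move=> FL FM; apply/cvgrPdist_le => eta eta0.
have M0 : 0 <= M by apply: le_trans (FM (toD (cst 0))).
have D0 : 0 < 2 * `|L| + 4 * M + 1.
  by rewrite ltr_wpDl// addr_ge0// mulr_ge0.
(* The denominator collects [|L| + 2 * M] for each of the two approximations, and 1 for the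
   convergence of the approximants. *)
pose e := eta / (2 * `|L| + 4 * M + 1).
have e0 : 0 < e by rewrite divr_gt0.
have [A [A' [E [E' [AW AZ [mE mE'] [PE PE'] lim]]]]] := approx e0.
have [Om [mO PO cZ _]] := full_set_limit.
have [mA mA' /cvgrPdist_le/(_ _ e0) mcv] := lim F L M FL FM.
have Le0 : 0 <= `|L| * e by rewrite mulr_ge0// ltW.
have hZ : `|mean P' (fun w => F (toD (Z ^~ w))) - mean P' (F \o A')| <=
    `|L| * e + 2 * M * (prob P' (E' `|` ~` Om)).
  apply: mean_sandwich => //.
  - by apply: measurableU => //; exact: measurableC.
  - by move=> w; exact: FM.
  move=> w /not_orP[nE nO]; rewrite distrC.
  apply: (@le_trans _ _ (L * e)).
    apply: FL; rewrite toDE; first exact: AZ.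
    by apply: cZ; exact: contrapT.
  by rewrite ler_wpM2r ?(ltW e0)// ler_norm.
have hO : prob P' (E' `|` ~` Om) <= e.
  apply: le_trans (prob_setU P' mE' (measurableC mO)) _.
  by rewrite PO addr0.
near=> n.
have hW : `|mean P (fun w => F (toD (W n ^~ w))) - mean P (F \o A n)| <=
    `|L| * e + 2 * M * (prob P (E n)).
  apply: mean_sandwich => // w; first exact: FM.
  move=> nE; rewrite distrC.
  apply: (@le_trans _ _ (L * e)).
    by apply: FL; rewrite toDE; [exact: AW|exact: cW].
  by rewrite ler_wpM2r ?(ltW e0)// ler_norm.
have hE : prob P (E n) <= e by near: n.
have hm : `|mean P' (F \o A') - mean P (F \o A n)| <= e by near: n.
have h1 : 2 * M * prob P (E n) <= 2 * M * e by rewrite ler_wpM2l ?mulr_ge0.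
have h2 : 2 * M * (prob P' (E' `|` ~` Om)) <= 2 * M * e by rewrite ler_wpM2l ?mulr_ge0.
have -> : eta = (2 * `|L| + 4 * M + 1) * e by rewrite /e mulrC divfK// gt_eqF.
move: hZ hW hm h1 h2.
set a := mean P' _; set b := mean P' _; set c := mean P _; set c' := mean P _.
move: (2 * M * prob P _) (2 * M * prob P' _) => x y hZ hW hm h1 h2.
have : `|a - c| <= `|a - b| + `|b - c'| + `|c - c'|.
  rewrite (distrC c); apply: le_trans (ler_distD c' _ _) _; rewrite lerD2r.
  exact: ler_distD.
rewrite !mulrDl mul1r -!mulrA in h1 h2 *.
move: (`|L| * e) (M * e) hZ hW h1 h2 => u v hZ hW h1 h2; lra.
Unshelve. all: by end_near. Qed.

(** An inf-convolution lies below [F], its means converge along [W], and its mean at [Z] is close to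
    that of [F] for a large index. This gives one inequality; the other one comes from [- F]. *)
Let liminf_mean (F : D01 R -> R) (M e : R) : continuous F ->
  (forall f, `|F f| <= M) -> 0 < e -> \forall n \near \oo,
  mean P' (fun w => F (toD (Z ^~ w))) - e <= mean P (fun w => F (toD (W n ^~ w))).
Proof.
move=> cF FM e0.
have [Om [mO PO cZ mZ]] := full_set_limit.
have mO1 : measurable_fun setT (\1_Om : T' -> R) by exact: measurable_indic.
(* Restricting to [Om] does not change the mean and makes the integrand measurable, as bounded
   convergence requires. *)
have onO (G : D01 R -> R) : continuous G -> (forall f, `|G f| <= M) ->
    mean P' (fun w => G (toD (Z ^~ w))) = mean P' (fun w => G (toD (Z ^~ w)) * \1_Om w).
  move=> cG GM; apply/eqP; rewrite -subr_eq0 -normr_le0.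
  have -> : 0 = 0 + 2 * M * prob P' (~` Om) by rewrite PO mulr0 addr0.
  apply: mean_sandwich => //; first exact: measurableC.
  - exact: mZ GM.
  - move=> w; rewrite normrM (le_trans _ (GM (toD (Z ^~ w))))// ler_piMr//.
    by rewrite indicE; case: (_ \in _); rewrite ?normr0 ?normr1 ?ler01.
  - by move=> w /contrapT Ow; rewrite indicE mem_set// mulr1 subrr normr0.
have cI n := J1_lipschitz_continuous (inf_conv_lipschitz FM (ler0n R n)).
have bI n f := inf_conv_norm FM f (ler0n R n).
have cvI : mean P' (fun w => inf_conv n%:R F (toD (Z ^~ w))) @[n --> \oo] -->
    mean P' (fun w => F (toD (Z ^~ w))).
  rewrite (onO F)//; under eq_fun do rewrite onO//.
  apply: (@mean_cvg _ _ _ _ M).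
  - by move=> n; apply: mZ => //; exact: bI.
  - exact: mZ FM.
  - move=> n w; rewrite normrM (le_trans _ (bI n (toD (Z ^~ w))))// ler_piMr//.
    by rewrite indicE; case: (_ \in _); rewrite ?normr0 ?normr1 ?ler01.
  - by move=> w; apply: cvgM; [exact: inf_conv_cvg FM _|exact: cvg_cst].
have e2 : 0 < e / 2 by rewrite divr_gt0.
have /cvgrPdist_le/(_ _ e2)[k _ /(_ k (leqnn k)) hk] := cvI.
have /cvgrPdist_le/(_ _ e2) hn := mean_limit_lipschitz
  (inf_conv_lipschitz FM (ler0n R k)) (bI k).
near=> n.
have h1 : `|mean P' (fun w => inf_conv k%:R F (toD (Z ^~ w))) -
   mean P (fun w => inf_conv k%:R F (toD (W n ^~ w)))| <= e / 2 by near: n.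
have h2 : mean P (fun w => inf_conv k%:R F (toD (W n ^~ w))) <=
    mean P (fun w => F (toD (W n ^~ w))).
  apply: (@mean_mono _ _ _ _ M) => w.
  - exact: bI.
  - exact: FM.
  - exact: (inf_conv_le FM (toD (W n ^~ w)) (ler0n R k)).
move: hk h1; rewrite !ler_norml; lra.
Unshelve. all: by end_near. Qed.

Lemma cvg_expectation_approximable (F : D01 R -> R) : continuous F ->
  (exists M, forall f, `|F f| <= M) ->
  'E_P[fun w => F (toD (W n ^~ w))]%E @[n --> \oo] -->
  'E_P'[fun w => F (toD (Z ^~ w))]%E.
Proof.
move=> cF [M FM].
rewrite (meanE P' (fun w => FM (toD (Z ^~ w)))).
under eq_fun do rewrite (meanE P (fun w => FM (toD (W _ ^~ w)))).
apply: cvg_EFin; first exact: nearW.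
apply/cvgrPdist_le => e e0.
have cN : continuous (fun f => - F f).
  apply/J1_continuousP => f r r0; have [s s0 h] := (J1_continuousP F).1 cF f r r0.
  by exists s => // g /h; rewrite -opprD normrN.
have NM f : `|- F f| <= M by rewrite normrN.
near=> n.
have h1 : mean P' (fun w => F (toD (Z ^~ w))) - e <=
    mean P (fun w => F (toD (W n ^~ w))).
  by near: n; apply: liminf_mean FM e0.
have h2 : mean P' (fun w => - F (toD (Z ^~ w))) - e <=
    mean P (fun w => - F (toD (W n ^~ w))).
  by near: n; apply: (liminf_mean cN NM e0).
move: h2; rewrite (meanN P' (fun w => FM (toD (Z ^~ w)))).
rewrite (meanN P (fun w => FM (toD (W n ^~ w)))) => h2.
have key (x y : R) : x - e <= y -> - x - e <= - y -> `|x - y| <= e.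
  by move=> *; rewrite ler_norml; lra.
exact: key h1 h2.
Unshelve. all: by end_near. Qed.

End convergence_by_approximation.

(** * Poisson points *)

Section power_tail.
Context {R : realType}.
Implicit Types (p x a b : R).

Lemma powRN_cvg0 p : 0 < p -> x `^ (- p) @[x --> +oo] --> 0.
Proof.
move=> p0; apply/cvgrPdist_le => e e0; near=> x.
have x1 : e^-1 `^ p^-1 <= x by near: x; exact: nbhs_pinfty_ge.
rewrite sub0r normrN ger0_norm ?powR_ge0// powRN -[leRHS]invrK.
rewrite lef_pV2 ?posrE ?invr_gt0//; last first.
  apply: powR_gt0; apply: lt_le_trans x1; apply: powR_gt0; by rewrite invr_gt0.
have -> : e^-1 = (e^-1 `^ p^-1) `^ p.
  by rewrite -powRrM mulVf ?gt_eqF// powRr1// invr_ge0 ltW.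
by apply: ge0_ler_powR => //; rewrite ?nnegrE ?powR_ge0 ?(ltW p0)// (le_trans _ x1)// powR_ge0.
Unshelve. all: by end_near. Qed.

Lemma integral_power_tail p x : 0 < p -> 0 < x ->
  (\int[lebesgue_measure]_(y in `]x, +oo[) (p * y `^ (- 1 - p))%:E =
   (x `^ (- p))%:E)%E.
Proof.
move=> p0 x0.
have dG (y : R) : 0 < y -> is_derive y 1 (fun y => - y `^ (- p)) (p * y `^ (- 1 - p)).
  move=> y0; have := is_deriveN (is_derive1_powR (- p) y0).
  by rewrite mulNr opprK (addrC (- p)).
have dg (y : R) : 0 < y -> is_derive y 1 (fun y => y `^ (- 1 - p)) ((-1 - p) * y `^ (-1 - p - 1)).
  exact: is_derive1_powR.
have cg (y : R) : 0 < y -> {for y, continuous (fun y => p * y `^ (- 1 - p))}.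
  move=> y0; have dy := @ex_derive _ _ _ _ _ _ _ (dg y y0).
  have cy : {for y, continuous (fun y => y `^ (- 1 - p))}.
    by apply/differentiable_continuous/derivable1_diffP.
  by apply: cvgM; [exact: cvg_cst|exact: cy].
rewrite integral_itv_obnd_cbnd; last first.
  apply/measurable_EFinP/measurable_funTS; apply: measurable_funM => //.
rewrite (@ge0_continuous_FTC2y _ _ (fun y => - y `^ (- p)) x 0).
- by rewrite EFinN oppeK add0e.
- by move=> y _; rewrite mulr_ge0 ?powR_ge0// ltW.
- apply/continuous_within_itvcyP; split.
    move=> y; rewrite in_itv /= andbT => xy; apply: cg; exact: lt_trans xy.
  apply: cvg_at_right_filter; exact: cg.
- by rewrite -oppr0; apply: cvgN; exact: powRN_cvg0.
- move=> y xy; apply: ex_derive; apply: dG; exact: lt_trans xy.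
- have dx := @ex_derive _ _ _ _ _ _ _ (dG x x0).
  have cx : {for x, continuous (fun y => - y `^ (- p))}.
    by apply/differentiable_continuous/derivable1_diffP.
  exact: cvg_at_right_filter cx.
- move=> y; rewrite in_itv /= andbT => xy; rewrite derive1E.
  by have [_] := dG y (lt_trans x0 xy).
Qed.

End power_tail.

Section intensity.
Context {R : realType}.

(** By Tonelli, the time variable contributes [v] and the mark variable the power tail of exponent
    [H^-1]. *)
Lemma jump_intensity_rectangle (H x v : R) (J : set R) : 0 < H -> 0 < x ->
  measurable J -> lebesgue_measure J = v%:E ->
  jump_intensity H (`]x, +oo[ `*` J) = (v * x `^ (- H^-1))%:E.
Proof.
move=> H0 x0 mJ Jv; rewrite /jump_intensity integral_mkcond.
have p0 : 0 < H^-1 by rewrite invr_gt0.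
have v0 : 0 <= v by rewrite -lee_fin -Jv.
pose f (z : R * R) : \bar R := (H^-1 * z.1 `^ (- 1 - H^-1) *
  (\1_(`]x, +oo[%classic : set R) z.1 * \1_J z.2))%:E.
have -> : (fun z : R * R => (H^-1 * z.1 `^ (- 1 - H^-1))%:E) \_ (`]x, +oo[ `*` J) = f.
  apply/funext => -[u y]; rewrite /f /patch /=.
  case: ifPn => [|/negP]; rewrite inE /= => h.
    by case: h => hu hv; rewrite !indicE !mem_set// mulr1 mulr1.
  rewrite !indicE; case: (boolP (u \in _)); case: (boolP (y \in _)) => hv hu;
    rewrite ?mulr0 ?mul0r ?mulr0//.
  by exfalso; apply: h; split; [rewrite inE in hu|rewrite inE in hv].
have f0 z : (0 <= f z)%E.
  rewrite /f lee_fin !mulr_ge0 ?powR_ge0 ?(ltW p0)//.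
have mf : measurable_fun setT f.
  apply/measurable_EFinP; apply: measurable_funM.
    apply: measurable_funM => //.
    exact: (measurableT_comp (measurable_powR _)).
  apply: measurable_funM; apply: measurableT_comp => //; exact: measurable_indic.
rewrite fubini_tonelli1//.
transitivity (\int[lebesgue_measure]_u ((H^-1 * u `^ (- 1 - H^-1))%:E *
   (v * \1_(`]x, +oo[%classic : set R) u)%:E))%E.
  apply: eq_integral => u _; rewrite /fubini_F.
  under eq_integral do rewrite /f /= mulrA EFinM.
  rewrite ge0_integralZl//; last 2 first.
  - by apply/measurable_EFinP; exact: measurable_indic.
  - by rewrite lee_fin !mulr_ge0 ?powR_ge0 ?(ltW p0).
  rewrite integral_indic// setIT [X in (_ * X)%E](_ : _ = v%:E)//.
  by rewrite -!EFinM; congr (_%:E); ring.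
under eq_integral do rewrite muleC -EFinM mulrAC -mulrA EFinM.
rewrite ge0_integralZl//; last 2 first.
- apply/measurable_EFinP; apply: measurable_funM.
    by apply: measurable_funM => //; exact: measurable_powR.
  exact: measurable_indic.
- by move=> u _; rewrite lee_fin !mulr_ge0 ?powR_ge0 ?(ltW p0).
rewrite EFinM; congr (_ * _)%E.
rewrite -integral_power_tail// [RHS]integral_mkcond; apply: eq_integral => u _.
rewrite /patch indicE; by case: ifP => _; rewrite ?mulr1 ?mulr0.
Qed.

End intensity.

Section independent_products.
Context d (T : measurableType d) (R : realType) (P : probability T R).

Lemma prob_independent_bigcap d' (E : measurableType d') (X : nat -> T -> E)
    (A : nat -> set E) (n : nat) : mutually_independent P X ->
  (forall i, measurable (A i)) -> (forall i, measurable_fun setT (X i)) ->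
  prob P (\bigcap_(i in `I_n) (X i @^-1` A i)) =
  \prod_(i < n) prob P (X i @^-1` A i).
Proof.
move=> indX mA mX.
have mXA i : measurable (X i @^-1` A i) by rewrite -[X in measurable X]setTI; exact: mX.
pose J : {fset nat} := [fset i | i in iota 0 n]%fset.
have JE : [set` J] = `I_n.
  apply/seteqP; split => i /=; first by move=> /imfsetP[j /= + ->]; rewrite mem_iota.
  by move=> iN; apply/imfsetP; exists i => //=; rewrite mem_iota.
have := indX J A mA; rewrite JE /prob => ->.
have -> : (\prod_(i <- J) P (X i @^-1` A i) =
    \prod_(i <- iota 0 n) P (X i @^-1` A i))%E.
  apply: perm_big; apply: uniq_perm; rewrite ?fset_uniq ?iota_uniq// => i.
  by apply/imfsetP/idP => [[j /= + ->]//|ii]; exists i.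
rewrite -[n in iota 0 n]subn0 -/(index_iota 0 n) big_mkord.
elim: n {J JE} => [|n IH]; first by rewrite !big_ord0.
rewrite !big_ord_recr /= fineM ?IH//; last by rewrite fin_num_measure.
by apply: prode_fin_num => i _; rewrite fin_num_measure.
Qed.

End independent_products.

Section poisson_counts.
Context {R : realType} d (T : measurableType d) (P : probability T R).
Variables (H : R) (eta U : nat -> T -> R).
Hypotheses (H0 : 0 < H)
  (ppp : poisson_point_process P point_space (jump_intensity H) eta U).

Lemma measurable_point_count A : measurable A ->
  measurable_fun setT (point_count eta U A).
Proof.
have [mEU _ _ _ _] := ppp.
move=> mA; apply: ge0_emeasurable_sum => [k w _ _|k _]; first by rewrite lee_fin.
apply/measurable_EFinP.
apply: (measurableT_comp (f := \1_A : R * R -> R)); first exact: measurable_indic.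
by apply/measurable_fun_pair; have [] := mEU k.
Qed.

Lemma point_count_eq0 A w : point_count eta U A w = 0%E <->
  forall i, ~ A (eta i w, U i w).
Proof.
split=> [c0 i Ai|nA].
  have h0 k : (0 <= k)%N -> xpredT k -> (0 <= (\1_A (eta k w, U k w) : R)%:E)%E.
    by move=> _ _; rewrite lee_fin.
  have := nneseries_lim_ge i.+1 h0.
  rewrite -/(point_count eta U A w) c0 big_nat_recr//=.
  rewrite sumEFin -EFinD lee_fin indicE mem_set//=.
  have : 0 <= \sum_(0 <= j < i) (\1_A (eta j w, U j w) : R) by exact: sumr_ge0.
  lra.
by apply: eseries0 => i _ _; rewrite indicE memNset.
Qed.

Lemma point_count_ge2 A w i j : i != j -> A (eta i w, U i w) -> A (eta j w, U j w) ->
  point_count eta U A w != 0%E /\ point_count eta U A w != 1%E.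
Proof.
wlog ij : i j / (i < j)%N.
  move=> h; rewrite neq_ltn => /orP[ij|ji] Ai Aj.
    by apply: (h i j) => //; rewrite neq_ltn ij.
  by apply: (h j i) => //; rewrite neq_ltn ji.
move=> _ Ai Aj.
suff h2 : (2%:E <= point_count eta U A w)%E.
  split; apply: contraTneq h2 => ->; rewrite lee_fin -ltNge; lra.
apply: le_trans (@nneseries_lim_ge R (fun i => (\1_A (eta i w, U i w))%:E)
  xpredT 0 j.+1 _); last first.
  by move=> k _ _; rewrite lee_fin.
rewrite sumEFin lee_fin big_nat_recr//= big_mkord (bigD1 (Ordinal ij))//=.
rewrite !indicE !mem_set//=.
have : 0 <= \sum_(k < j | k != Ordinal ij) (\1_A (eta k w, U k w) : R) by exact: sumr_ge0.
lra.
Qed.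

Variables (x v : R) (J : set R).
Hypotheses (x0 : 0 < x) (mJ : measurable J) (Jv : lebesgue_measure J = v%:E)
  (J0 : J `<=` `[0, +oo[).

Let A : set (R * R) := `]x, +oo[ `*` J.
Let lam := v * x `^ (- H^-1).

Lemma measurable_strip : measurable A. Proof. exact: measurableX. Qed.

Lemma strip_point_space : A `<=` point_space.
Proof.
move=> [u t] /= [xu /J0 tJ]; split => //.
by move: xu => /=; rewrite !in_itv /= !andbT; exact: lt_trans.
Qed.

Let v0 : 0 <= v. Proof. by rewrite -lee_fin -Jv. Qed.

Let lam0 : 0 <= lam. Proof. by rewrite mulr_ge0// powR_ge0. Qed.

Lemma measurable_count_eq (c : \bar R) B : measurable B ->
  measurable [set w | point_count eta U B w = c].
Proof.
move=> mB; rewrite -[X in measurable X]setTI.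
exact: (measurable_point_count mB measurableT (emeasurable_set1 c)).
Qed.

Lemma prob_count (k : nat) : prob P [set w | point_count eta U A w = k%:R%:E] =
  lam ^+ k / k`!%:R * expR (- lam).
Proof.
have [_ _ h _ _] := ppp.
have nu : jump_intensity H A = lam%:E by exact: jump_intensity_rectangle.
by rewrite /prob h ?nu ?ltry//; [exact: measurable_strip|exact: strip_point_space].
Qed.

Lemma prob_void : prob P [set w | point_count eta U A w = 0%E] = expR (- lam).
Proof. by have := prob_count 0; rewrite expr0 fact0 divr1 mul1r. Qed.

Lemma prob_nonvoid_le : prob P (~` [set w | point_count eta U A w = 0%E]) <= lam.
Proof.
rewrite prob_setC ?prob_void; last first.
  by apply: measurable_count_eq; exact: measurable_strip.
have := expR_ge1Dx (- lam); lra.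
Qed.

(** From [expR (- lam) >= 1 - lam] one gets [1 - (1 + lam) expR (- lam) <= 1 - (1 + lam) (1 - lam)],
    which is [lam ^+ 2]. *)
Lemma prob_two_points_le :
  prob P (~` ([set w | point_count eta U A w = 0%E] `|`
              [set w | point_count eta U A w = 1%E])) <= lam ^+ 2.
Proof.
have mc c : measurable [set w | point_count eta U A w = c].
  by apply: measurable_count_eq; exact: measurable_strip.
have E1 : prob P [set w | point_count eta U A w = 1%E] = lam * expR (- lam).
  by have := prob_count 1; rewrite expr1 factS fact0 muln1 divr1.
rewrite setCU -setDE prob_setD//; last 2 first.
- exact: measurableC.
- by move=> w /= ->; apply/eqP; rewrite eqe oner_eq0.
rewrite prob_setC// prob_void E1.
have := expR_ge1Dx (- lam); rewrite expr2.
have : 0 <= expR (- lam) * lam by rewrite mulr_ge0// expR_ge0.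
move: lam0 (expR (- lam)) => l0 e e1 e2; nra.
Qed.

End poisson_counts.

(** * The limit process *)

Section continuous_paths.
Context {R : realType}.
Variable f : R -> R.
Hypothesis cf : {within `[0, +oo[, continuous f}.

Lemma continuous_path_local (t e : R) : 0 <= t -> 0 < e ->
  exists2 r, 0 < r & forall y, 0 <= y -> `|t - y| < r -> `|f t - f y| < e.
Proof.
move=> t0 e0; have tI : `[0, +oo[%classic t by rewrite /= in_itv /= t0.
have /subspace_continuousP/(_ t tI)/cvgrPdist_lt/(_ _ e0) := cf.
case=> r /= r0 h; exists r => // y y0 ty; apply: h => //=.
by rewrite in_itv /= y0.
Qed.

Lemma continuous_path_cadlag : cadlag01 f.
Proof.
split=> t; rewrite in_itv /= => /andP[t0 t1].
  apply/cvgrPdist_lt => e e0; have [r r0 h] := continuous_path_local t0 e0.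
  near=> x; have tx : t <= x by near: x; exact: nbhs_right_ge.
  apply: h; first exact: le_trans tx.
  rewrite distrC ger0_norm ?subr_ge0//; near: x; exact: nbhs_right_ltDr.
apply/cvg_ex; exists (f t).
apply/cvgrPdist_lt => e e0; have [r r0 h] := continuous_path_local (ltW t0) e0.
near=> x; have tx : x < t by near: x; exact: nbhs_left_lt.
apply: h; first by apply: ltW; near: x; exact: nbhs_left_gt.
rewrite ger0_norm ?subr_ge0 ?(ltW tx)//; near: x; exact: nbhs_left_ltBl.
Unshelve. all: by end_near. Qed.

Lemma continuous_path_bounded : exists M, forall s : R, s \in `[0, 1] -> `|f s| <= M.
Proof.
have cf1 : {within `[0, 1], continuous f}.
  apply: continuous_subspaceW cf => x /=; by rewrite !in_itv /= => /andP[->].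
have cNf1 : {within `[0, 1], continuous (fun x => - f x)}.
  by move=> x; apply: cvgN; exact: cf1.
have [c _ hc] := EVT_max (@ler01 R) cf1.
have [c' _ hc'] := EVT_max (@ler01 R) cNf1.
exists (`|f c| + `|f c'|) => s s01; rewrite ler_norml.
have := hc s s01; have := hc' s s01.
have := ler_norm (f c); have := ler_norm (- f c'); rewrite normrN.
have := normr_ge0 (f c); have := normr_ge0 (f c').
move=> h1 h2 h3 h4 h5 h6; apply/andP; split; lra.
Qed.

(** If [r] is the radius of continuity at [x], points near [x] are compared with any [y]: at
    distance at least [r / 2] the penalty exceeds the total oscillation [2 * M] for a large slope,
    and otherwise both points lie in the [r]-neighbourhood of [x]. Compactness makes the slope
    uniform in [x]. *)
Lemma continuous_path_modulus :
  modulus_excess n%:R f @[n --> \oo] --> 0.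
Proof.
have [M fM] := continuous_path_bounded.
apply/cvgrPdist_le => e e0.
have : \forall n \near \oo, `[0, 1]%classic `<=` (fun x : R =>
    forall y : R, y \in `[0, 1] -> `|f x - f y| - n%:R * `|x - y| <= e).
  have /compact_near_coveringP/near_covering_withinP := @segment_compact R 0 1.
  apply=> x; rewrite /= in_itv /= => /andP[x0 x1].
  have e2 : 0 < e / 2 by rewrite divr_gt0.
  have [r r0 h] := continuous_path_local x0 e2.
  have [k Mk] : exists k, 4 * M / r < k%:R.
    by exists (Num.truncn (4 * M / r)).+1; exact: truncnS_gt.
  have r2 : 0 < r / 2 by rewrite divr_gt0.
  exists (ball x (r / 2), [set n | (k <= n)%N]) => /=.
    split; first by exists (r / 2).
    exact: nbhs_infty_ge.
  move=> [z n] [/= xz kn] z01 y y01.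
  have [z0 z1] : 0 <= z /\ z <= 1 by move: z01; rewrite in_itv /= => /andP[].
  have [y0 y1] : 0 <= y /\ y <= 1 by move: y01; rewrite in_itv /= => /andP[].
  have xz' : `|x - z| < r / 2 by exact: xz.
  have [zy|zy] := le_or_lt (r / 2) `|z - y|.
    have h1 : `|f z - f y| <= 2 * M.
      apply: le_trans (ler_normB _ _) _; have := fM z z01; have := fM y y01; lra.
    have h2 : 2 * M <= n%:R * `|z - y|.
      apply: (@le_trans _ _ (n%:R * (r / 2))); last by rewrite ler_wpM2l.
      rewrite mulrA ler_pdivlMr// -ler_pdivrMr//; apply: le_trans (_ : k%:R <= _).
        by apply: le_trans (ltW Mk); rewrite ler_pM2r ?invr_gt0//; lra.
      by rewrite ler_nat.
    lra.
  have h1 : `|f x - f z| < e / 2 by apply: h => //; lra.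
  have h2 : `|f x - f y| < e / 2.
    apply: h => //; apply: le_lt_trans (ler_distD z _ _) _; lra.
  have h3 : 0 <= n%:R * `|z - y| by rewrite mulr_ge0.
  have h4 : `|f z - f y| <= `|f x - f z| + `|f x - f y|.
    rewrite (distrC (f x) (f z)); exact: ler_distD.
  lra.
move=> H; near=> n.
have H' : `[0, 1]%classic `<=` (fun x : R =>
    forall y : R, y \in `[0, 1] -> `|f x - f y| - n%:R * `|x - y| <= e) by near: n.
rewrite sub0r normrN ger0_norm; last by case/andP: (modulus_excess_itv n%:R f).
apply: ge_sup.
  by eexists; exists (0, 0) => //=; rewrite in_itv /= lexx ler01.
move=> _ [[s t] [/= s01 t01] <-]; rewrite ge_min; apply/orP; right.
exact: H'.
Unshelve. all: by end_near. Qed.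

End continuous_paths.

Lemma exists_in_cell {R : realType} (m : nat) (p : R) : (0 < m)%N -> 0 < p <= 1 ->
  exists2 j, (j < m)%N & in_cell m j p.
Proof.
move=> m0 /andP[p0 p1]; have mR : 0 < m%:R :> R by rewrite ltr0n.
have mx : exists i, m%:R * p <= i%:R by exists m; rewrite ger_pMr.
case: (@ex_minnP (fun i => m%:R * p <= i%:R) mx) => -[|i] si imin.
  by move: si; rewrite leNgt mulr_gt0.
exists i; first by apply: imin; rewrite ger_pMr.
by rewrite /in_cell si andbT ltNge; apply/negP => /imin; rewrite ltnn.
Qed.

Lemma in_cellE {R : realType} (m j : nat) (p : R) : (0 < m)%N ->
  in_cell m j p <-> p \in `]j%:R / m%:R, j.+1%:R / m%:R].
Proof.
move=> m0; have mR : 0 < m%:R :> R by rewrite ltr0n.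
by rewrite in_itv /= ltr_pdivrMr// ler_pdivlMr// mulrC.
Qed.

Section limit_process.
Context {R : realType} d (T : measurableType d) (P : probability T R).
Variables (H : R) (eta U : nat -> T -> R).
Hypotheses (H0 : 0 < H)
  (ppp : poisson_point_process P point_space (jump_intensity H) eta U).

Definition strip (x : R) (J : set R) : set (R * R) := `]x, +oo[ `*` J.

Definition cell_itv (m j : nat) : set R := `]j%:R / m%:R, j.+1%:R / m%:R].

Definition two_points (A : set (R * R)) : set T :=
  ~` ([set w | point_count eta U A w = 0%E] `|`
      [set w | point_count eta U A w = 1%E]).

Lemma cell_itv_ge0 m j : cell_itv m j `<=` `[0, +oo[.
Proof.
move=> y; rewrite /cell_itv /= !in_itv /= andbT => /andP[h _].
by apply: le_trans (ltW h); rewrite divr_ge0.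
Qed.

Lemma lebesgue_cell_itv m j : (0 < m)%N ->
  lebesgue_measure (cell_itv m j) = (m%:R^-1 : R)%:E.
Proof.
move=> m0; have mR : 0 < m%:R :> R by rewrite ltr0n.
rewrite /cell_itv lebesgue_measure_itv /= lte_fin ltr_pM2r ?invr_gt0// ltr_nat ltnSn.
by rewrite -EFinB -mulrBl -natr1 addrAC subrr add0r mul1r.
Qed.

Lemma measurable_two_points A : measurable A -> measurable (two_points A).
Proof.
by move=> mA; apply: measurableC; apply: measurableU; exact: measurable_count_eq ppp _ _ mA.
Qed.

Lemma measurable_cell_strip x m j : measurable (strip x (cell_itv m j)).
Proof. by apply: measurableX; exact: measurable_itv. Qed.

(** Each of the [m] cells contributes the square of a mean count proportional to [1 / m]. *)
Lemma prob_two_points_cells x m : 0 < x -> (0 < m)%N ->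
  prob P (\big[setU/set0]_(j < m) two_points (strip x (cell_itv m j))) <=
  (x `^ (- H^-1)) ^+ 2 / m%:R.
Proof.
move=> x0 m0; have mR : 0 < m%:R :> R by rewrite ltr0n.
apply: le_trans (prob_bigcup P m (fun j => measurable_two_points (measurable_cell_strip x m j))) _.
have h j : prob P (two_points (strip x (cell_itv m j))) <=
    (m%:R^-1 * x `^ (- H^-1)) ^+ 2.
  apply: (prob_two_points_le H0 ppp x0 (measurable_itv _)).
    exact: lebesgue_cell_itv.
  exact: cell_itv_ge0.
apply: le_trans (ler_sum _ (fun (j : 'I_m) _ => h j)) _.
rewrite sumr_const card_ord -[leLHS]mulr_natl.
rewrite [leLHS](_ : _ = (x `^ (- H^-1)) ^+ 2 / m%:R)//.
by field; rewrite gt_eqF.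
Qed.

(** Two points at the same time in []0, 1]] share a cell of every grid, an event whose probability
    tends to 0 as the grid is refined, for marks above a fixed height. A point at time 0 lies over a
    Lebesgue-null set of times. *)
Lemma negligible_coincidence : exists N : set T, [/\ measurable N, prob P N = 0 &
  forall w, ~ N w ->
    (forall i j, i != j -> U i w = U j w -> U i w <= 1 -> False) /\
    forall i, U i w != 0].
Proof.
have [mEU S _ _ _] := ppp.
(* Marks are positive, so each one exceeds some [x k]; countably many heights suffice. *)
pose x (k : nat) : R := k.+1%:R^-1; have x0 k : 0 < x k by rewrite invr_gt0.
pose N1 k := \bigcap_M \big[setU/set0]_(j < M.+1) two_points (strip (x k) (cell_itv M.+1 j)).
pose N2 k := ~` [set w | point_count eta U (strip (x k) [set 0]) w = 0%E].
have mN1M k M : measurable (\big[setU/set0]_(j < M.+1) two_points (strip (x k) (cell_itv M.+1 j))).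
  by apply: bigsetU_measurable => j _; apply: measurable_two_points; exact: measurable_cell_strip.
have mN1 k : measurable (N1 k) by exact: bigcapT_measurable.
have m0 : measurable [set (0 : R)] by exact: measurable_set1.
have mN2 k : measurable (N2 k).
  by apply: measurableC; apply: measurable_count_eq ppp _ _ _; exact: measurable_strip.
have pN1 k : prob P (N1 k) = 0.
  apply/eqP; rewrite eq_le prob_ge0 andbT; apply/ler_addgt0Pr => e e0; rewrite add0r.
  pose c := (x k `^ (- H^-1)) ^+ 2.
  pose M := Num.truncn (c / e).
  apply: (@le_trans _ _ (c / M.+1%:R)).
    apply: le_trans (prob_two_points_cells (x0 k) (ltn0Sn M)).
    by apply: prob_le => // w; apply.
  rewrite ler_pdivrMr// mulrC -ler_pdivrMr//; apply: ltW; exact: truncnS_gt.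
have pN2 k : prob P (N2 k) = 0.
  apply/eqP; rewrite eq_le prob_ge0 andbT.
  apply: le_trans (prob_nonvoid_le H0 ppp (x0 k) m0 (lebesgue_measure_set1 0) _) _.
    by move=> _ -> /=; rewrite in_itv /= lexx.
  by rewrite mul0r.
have : P.-negligible ((\bigcup_k N1 k) `|` (\bigcup_k N2 k)).
  apply: negligibleU; apply: negligible_bigcup => k.
    by apply/(negligibleP P (mN1 k)); have := probE P (mN1 k); rewrite pN1.
  by apply/(negligibleP P (mN2 k)); have := probE P (mN2 k); rewrite pN2.
move=> [N [mN PN sub]]; exists N; split => //; first by rewrite /prob PN.
move=> w Nw; have {Nw} /not_orP[n1 n2] := contra_not (@sub w) Nw.
have pos i : exists k, x k < eta i w.
  have [+ _] := S i w; rewrite /= in_itv /= andbT => h.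
  exists (Num.truncn (eta i w)^-1); rewrite /x -[ltRHS]invrK ltf_pV2 ?posrE ?invr_gt0//.
  exact: truncnS_gt.
have U0 i : U i w != 0.
  apply/eqP => Ui; have [k hk] := pos i; apply: n2; exists k => //= /point_count_eq0 h.
  apply: (h i); split => //=; by rewrite in_itv /= hk.
split => // i j ij Uij Ui1.
have [k [hi hj]] : exists k, x k < eta i w /\ x k < eta j w.
  have [k1 h1] := pos i; have [k2 h2] := pos j; exists (maxn k1 k2).
  split; [apply: le_lt_trans h1|apply: le_lt_trans h2];
    by rewrite /x lef_pV2 ?posrE// ler_nat ltnS ?leq_maxl ?leq_maxr.
apply: n1; exists k => // M _.
have Ui0 : 0 < U i w.
  have [_] := S i w; rewrite /= in_itv /= andbT => h; by rewrite lt_neqAle eq_sym U0.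
have [l lM il] : exists2 l, (l < M.+1)%N & in_cell M.+1 l (U i w).
  by apply: exists_in_cell; rewrite // Ui0.
suff : (\bigcup_(j < M.+1) two_points (strip (x k) (cell_itv M.+1 j))) w.
  by rewrite bigcup_mkord.
exists l => //.
have /in_cellE il' := il; have {}il' := il' isT.
have [c0 c1] : point_count eta U (strip (x k) (cell_itv M.+1 l)) w != 0%E /\
    point_count eta U (strip (x k) (cell_itv M.+1 l)) w != 1%E.
  apply: (point_count_ge2 ij); split => //=; rewrite ?in_itv /= ?hi ?hj//.
    by rewrite /cell_itv /= -Uij.
by move=> [|] /= /eqP; rewrite ?(negbTE c0) ?(negbTE c1).
Qed.

End limit_process.

(** * Approximation of the limit along a fixed outcome *)

Section limit_path.
Context {R : realType}.
Variables (kH : R) (b : R -> R) (eta U : nat -> R).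

(** Points after time 1 are dropped, since all marks have to satisfy a common cap. *)
Definition limit_marks (p v : R) : Prop :=
  exists i, [/\ U i = p, v = kH * eta i & p <= 1].

Definition limit_height (s : R) : \bar R :=
  ((b s)%:E + kH%:E * \sum_(0 <= i <oo) (eta i * \1_[set s] (U i))%:E)%E.

(** This is [Z_process] at one outcome, which allows the comparison to be made path by path. *)
Definition limit_path (t : R) : R :=
  fine (ereal_sup [set limit_height s | s in `[0, t]]).

Hypotheses (kH0 : 0 < kH) (eta0 : forall i, 0 < eta i) (U0 : forall i, 0 < U i)
  (Uinj : forall i j, i != j -> U i = U j -> U i <= 1 -> False).

(** No two points share a time up to 1, so the series has at most one nonzero term. *)
Lemma limit_heightE (s : R) : s \in `[0, 1] -> exists2 v,
  limit_height s = (b s + v)%:E & v = 0 \/ exists2 i, U i = s & v = kH * eta i.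
Proof.
rewrite in_itv /= => /andP[s0 s1].
have [[i Ui]|nU] := pselect (exists i, U i = s).
  exists (kH * eta i); last by right; exists i.
  rewrite /limit_height (@nneseriesD1 _ _ i)//; last first.
    by move=> k _; rewrite lee_fin mulr_ge0// ltW.
  rewrite eseries0 => [|k _ /= ki]; last first.
    rewrite indicE memNset ?mulr0// => Uk; apply: (Uinj ki); first by rewrite Uk.
    by rewrite Uk.
  by rewrite adde0 indicE mem_set//= mulr1 -EFinM -EFinD.
exists 0; last by left.
rewrite /limit_height eseries0 ?mule0 ?adde0 ?addr0// => k _ _.
by rewrite indicE memNset ?mulr0// => Uk; apply: nU; exists k.
Qed.

Variables (m N : nat) (e K : R).
Hypotheses (m0 : (0 < m)%N) (e0 : 0 < e) (K0 : 0 <= K) (Km : K <= e * m%:R)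
  (me : 2 / m%:R < 7 * e)
  (bK : forall s t : R, s \in `[0, 1] -> t \in `[0, 1] -> `|b s - b t| <= e + K * `|s - t|)
  (uniq : forall j i i', (j < m)%N -> i != i' -> in_cell m j (U i) -> in_cell m j (U i') ->
     e < kH * eta i -> e < kH * eta i' -> False)
  (last : forall i, in_cell m m.-1 (U i) -> e < kH * eta i -> False)
  (top : forall i, U i <= 1 -> kH * eta i <= e * N.+1%:R).

(** The modulus of [b] and the cap on the marks bound the supremum, so that [fine] loses nothing. *)
Lemma limit_path_fin (t : R) : t \in `[0, 1] ->
  ereal_sup [set limit_height s | s in `[0, t]] = (limit_path t)%:E.
Proof.
rewrite in_itv /= => /andP[t0 t1].
pose M := b 0 + e + K + e * N.+1%:R.
have eN : 0 <= e * N.+1%:R by rewrite mulr_ge0// ltW.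
have i0 : (0 : R) \in `[0, 1] by rewrite in_itv /= lexx ler01.
rewrite /limit_path fineK// fin_real//; apply/andP; split.
  apply: (@lt_le_trans _ _ (limit_height 0)).
    by have [v -> _] := limit_heightE i0; exact: ltNyr.
  by apply: ereal_sup_ubound; exists 0 => //=; rewrite in_itv /= lexx.
apply: (@le_lt_trans _ _ M%:E); last exact: ltry.
apply: ge_ereal_sup => _ [s /= + <-]; rewrite in_itv /= => /andP[s0 st].
have s01 : s \in `[0, 1] by rewrite in_itv /= s0 (le_trans st).
have [v -> hv] := limit_heightE s01; rewrite lee_fin.
have vN : v <= e * N.+1%:R.
  by case: hv => [->//|[i Ui ->]]; apply: top; rewrite Ui (le_trans st).
have := bK s01 i0; rewrite subr0 (ger0_norm s0) ler_norml => /andP[_ h].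
have : K * s <= K by rewrite ler_piMr// (le_trans st).
rewrite /M; move: h vN e0 => h vN e0_ Ks; lra.
Qed.

(** The limit dominates the path and every mark exactly; the upper comparison uses a near-maximizer
    of the supremum, at a cost of [e]. *)
Lemma limit_path_approx :
  J1_ball (discretize m e K (cell_levels m N e limit_marks) b) (7 * e) limit_path.
Proof.
have e0_ : 0 < e by [].
have bK' s t : s \in `[0, 1] -> t \in `[0, 1] -> b s - b t <= e + K * `|s - t|.
  by move=> s01 t01; apply: le_trans (bK s01 t01); exact: ler_norm.
rewrite discretizeE; apply: (@J1_discretized_maximum _ m N e K b) => //.
- move=> j jm; apply: sup_conv_close => //.
  by rewrite in_itv /= divr_ge0//= ler_pdivrMr ?ltr0n// mul1r ler_nat.
- by move=> p v [i [<- _ ->]] _; rewrite U0.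
- move=> j p v p' v' pj pj' [i [Ui -> p1]] [i' [Ui' -> p1']] h h'.
  have [ii|ii] := eqVneq i i'; first by rewrite -Ui -Ui' ii.
  exfalso; apply: (@uniq j i i') => //; rewrite ?Ui ?Ui'//.
  rewrite -(ltr_nat R); case/andP: pj => pj _; apply: lt_le_trans pj _.
  by rewrite ger_pMr ?ltr0n.
- by move=> p v [i [Ui -> p1]] h pm; apply: (last _ h); rewrite Ui.
- by move=> p v [i [Ui -> p1]]; apply: top; rewrite Ui.
- move=> t t01; have t1 : t <= 1 by move: t01; rewrite in_itv /= => /andP[].
  have fin := limit_path_fin t01.
  have sfin : ereal_sup [set limit_height s | s in `[0, t]] \is a fin_num by rewrite fin.
  have [_ [s /= st <-]] := ub_ereal_sup_adherent e0_ sfin.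
  rewrite fin -EFinB; move: st; rewrite in_itv /= => /andP[s0 st].
  have s01 : s \in `[0, 1] by rewrite in_itv /= s0 (le_trans st).
  have [v -> hv] := limit_heightE s01; rewrite lte_fin => h.
  exists s, v; split; rewrite ?s0//; last by lra.
  case: hv => [->|[i Ui ->]]; first by left; exact: ltW.
  by right; exists i; split => //; exact: le_trans t1.
- move=> s v t [i [Ui -> s1]] ev /andP[st t1].
  have s0 : 0 <= s by rewrite -Ui ltW.
  have t01 : t \in `[0, 1] by rewrite in_itv /= (le_trans s0 st).
  have s01 : s \in `[0, 1] by rewrite in_itv /= s0.
  suff : b s + kH * eta i <= limit_path t by lra.
  rewrite -lee_fin -limit_path_fin//.
  have [v' hs hv] := limit_heightE s01.
  have -> : kH * eta i = v'.
    case: hv => [v'0|[i' Ui' ->]]; last first.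
      have [->//|ii] := eqVneq i i'; exfalso; apply: (Uinj ii); rewrite Ui//.
    move: hs; rewrite v'0 /limit_height (@nneseriesD1 _ _ i)//; last first.
      by move=> k _; rewrite lee_fin mulr_ge0// ltW.
    rewrite eseries0 => [|k _ /= ki]; last first.
      rewrite indicE memNset ?mulr0// => Uk; apply: (Uinj ki).
        by rewrite Uk Ui.
      by rewrite Uk.
    rewrite adde0 indicE mem_set//= mulr1 -EFinM -EFinD => hE.
    have h := EFin_inj hE.
    exact: (@addrI _ (b s) _ _ h).
  by rewrite -hs; apply: ereal_sup_ubound; exists s => //=; rewrite in_itv /= s0.
- move=> j t jm /andP[jt t1].
  set s := j%:R / m%:R in jt *.
  have s0 : 0 <= s by rewrite divr_ge0.
  have t01 : t \in `[0, 1] by rewrite in_itv /= (le_trans s0 jt).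
  have s01 : s \in `[0, 1] by rewrite in_itv /= s0 (le_trans jt).
  suff : b s <= limit_path t by lra.
  rewrite -lee_fin -limit_path_fin//.
  have [v hs hv] := limit_heightE s01.
  have v0 : 0 <= v.
    by case: hv => [->//|[i _ ->]]; rewrite mulr_ge0// ltW.
  apply: (@le_trans _ _ (limit_height s)); first by rewrite hs lee_fin lerDl.
  by apply: ereal_sup_ubound; exists s => //=; rewrite in_itv /= s0.
Qed.

End limit_path.

(** * Measurability of the limit at fixed times *)

Section random_time.
Context {R : realType} d (T : measurableType d).
Variables (B : R -> T -> R) (c : T -> R).
Hypotheses (cB : forall w, {within `[0, +oo[, continuous (B ^~ w)})
  (mB : forall t : R, t \in `[0, 1] -> measurable_fun setT (B t))
  (mc : measurable_fun setT c) (c01 : forall w, c w \in `[0, 1]).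

(** Rounding the random time down to multiples of [1 / k.+1] gives finite sums of measurable terms,
    which converge by continuity of the paths. *)
Lemma measurable_random_time : measurable_fun setT (fun w => B (c w) w).
Proof.
have c0 w : 0 <= c w by have := c01 w; rewrite in_itv /= => /andP[].
pose z k w := Num.truncn (k.+1%:R * c w).
have zk k w : (z k w <= k.+1)%N by apply: truncn_grid_le.
have zc k w : (z k w)%:R <= k.+1%:R * c w < (z k w).+1%:R.
  by apply: truncn_itv; rewrite mulr_ge0.
pose L k (j : nat) := [set w | z k w = j].
have mL k j : measurable (L k j).
  have -> : L k j = setT `&` (fun w => k.+1%:R * c w) @^-1` `[j%:R, j.+1%:R[%classic.
    rewrite setTI; apply/seteqP; split => w /=; rewrite in_itv /=.
      by move=> <-; exact: zc.
    exact: truncn_def.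
  by apply: measurable_funM => //; exact: measurable_itv.
have grid k (j : nat) : (j <= k.+1)%N -> (j%:R / k.+1%:R : R) \in `[0, 1].
  by move=> jk; rewrite in_itv /= divr_ge0//= ler_pdivrMr// mul1r ler_nat.
apply: (@measurable_fun_cvg _ _ _ _ (fun k w => B ((z k w)%:R / k.+1%:R) w)).
  move=> k.
  have -> : (fun w => B ((z k w)%:R / k.+1%:R) w) =
      fun w => \sum_(j < k.+2) B (j%:R / k.+1%:R) w * \1_(L k j) w.
    apply/funext => w; have zk' : (z k w < k.+2)%N by rewrite ltnS.
    rewrite (bigD1 (Ordinal zk'))//= indicE mem_set// mulr1 big1 ?addr0// => j.
    rewrite -val_eqE /= => jz; rewrite indicE memNset ?mulr0// /L /= => /esym/eqP.
    by rewrite (negbTE jz).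
  apply: measurable_sum => j; apply: measurable_funM.
    by apply: mB; apply: grid; rewrite -ltnS.
  exact: measurable_indic.
move=> w _; apply/cvgrPdist_lt => e e0.
have [r r0 h] := continuous_path_local (@cB w) (c0 w) e0.
near=> k; apply: h; first by rewrite divr_ge0.
have k0 : 0 < k.+1%:R :> R by [].
rewrite -(ltr_pM2r k0) -[X in _ * X < _](gtr0_norm k0) -normrM mulrBl divfK ?gt_eqF//.
have /andP[h1 h2] := zc k w.
rewrite mulrC ger0_norm ?subr_ge0//; apply: (@lt_trans _ _ 1).
  by rewrite ltrBlDl natr1.
rewrite mulrC -ltr_pdivrMr// div1r; apply: (@le_lt_trans _ _ k%:R); last by rewrite ltr_nat.
near: k; exact: nbhs_infty_ger.
Unshelve. all: by end_near. Qed.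

End random_time.

Section limit_measurability.
Context {R : realType} d (T : measurableType d).
Variables (kH : R) (B : R -> T -> R) (eta U : nat -> T -> R).
Hypotheses (kH0 : 0 < kH) (cB : forall w, {within `[0, +oo[, continuous (B ^~ w)})
  (mB : forall t : R, t \in `[0, 1] -> measurable_fun setT (B t))
  (meta : forall i, measurable_fun setT (eta i)) (mU : forall i, measurable_fun setT (U i))
  (eta0 : forall i w, 0 < eta i w) (U0 : forall i w, 0 <= U i w).

Lemma limit_height_ge (s : R) w :
  ((B s w)%:E <= limit_height kH (B ^~ w) (eta ^~ w) (U ^~ w) s)%E.
Proof.
rewrite /limit_height leeDl// mule_ge0 ?lee_fin ?(ltW kH0)//.
by apply: nneseries_ge0 => i _ _; rewrite lee_fin mulr_ge0// ltW.
Qed.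

(** The minimum with 1 keeps the time in [[0, 1]], where [B] is known to be measurable; it is
    inactive on the event [U i w <= t] with [t <= 1], on which the value will be used. *)
Lemma measurable_limit_height_at i : measurable_fun setT (fun w =>
  limit_height kH (B ^~ w) (eta ^~ w) (U ^~ w) (Num.min (U i w) 1)).
Proof.
have mc : measurable_fun setT (fun w => Num.min (U i w) 1).
  by apply: measurable_minr.
have c01 w : Num.min (U i w) 1 \in `[0, 1].
  by rewrite in_itv /= le_min U0 ler01 /= ge_min lexx orbT.
rewrite /limit_height; apply: emeasurable_funD.
  by apply/measurable_EFinP; exact: measurable_random_time.
apply: measurable_funeM; apply: ge0_emeasurable_sum => [k w _ _|k _].
  by rewrite lee_fin mulr_ge0// ltW.
apply/measurable_EFinP; apply: measurable_funM => //.
rewrite (_ : (fun w => _) = \1_[set w | U k w = Num.min (U i w) 1]); last first.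
  apply/funext => w; rewrite !indicE.
  suff -> : (U k w \in [set Num.min (U i w) 1]) =
    (w \in [set w | U k w = Num.min (U i w) 1]) by [].
  by apply/idP/idP; rewrite !inE.
apply: measurable_indic.
have -> : [set w | U k w = Num.min (U i w) 1] =
    setT `&` (fun w => U k w - Num.min (U i w) 1) @^-1` [set 0].
  rewrite setTI; apply/seteqP; split => w /=; first by move=> ->; rewrite subrr.
  by move=> /eqP; rewrite subr_eq0 => /eqP.
by apply: measurable_funB => //; exact: measurable_set1.
Qed.

(* It suffices to take the supremum over the rational times and the times [U n]. *)
Lemma measurable_limit_path (t : R) : t \in `[0, 1] ->
  measurable_fun setT (fun w => limit_path kH (B ^~ w) (eta ^~ w) (U ^~ w) t).
Proof.
rewrite in_itv /= => /andP[t0 t1].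
(* An enumeration of the rationals of [[0, t]], with default value [t], which must occur as well
   when it is irrational. *)
pose tau n : R := if (choice.unpickle n : option rat) is Some q then
  (if (0 <= ratr q :> R) && (ratr q <= t) then ratr q else t) else t.
have tauI n : 0 <= tau n <= t.
  rewrite /tau; case: choice.unpickle => [q|]; last by rewrite t0 lexx.
  by case: ifP => // _; rewrite t0 lexx.
have tau01 n : tau n \in `[0, 1].
  by have /andP[h1 h2] := tauI n; rewrite in_itv /= h1 (le_trans h2).
pose h n w : \bar R := maxe (B (tau n) w)%:E (if U n w <= t then
  limit_height kH (B ^~ w) (eta ^~ w) (U ^~ w) (Num.min (U n w) 1) else -oo%E).
have -> : (fun w => limit_path kH (B ^~ w) (eta ^~ w) (U ^~ w) t) =
    fun w => fine (esups (h ^~ w) 0).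
  apply/funext => w; congr fine; apply/eqP; rewrite eq_le; apply/andP; split.
    apply: ge_ereal_sup => _ [s /= + <-]; rewrite in_itv /= => /andP[s0 st].
    have [[i Ui]|nU] := pselect (exists i, U i w = s).
      apply: (@le_trans _ _ (h i w)).
        rewrite /h Ui st min_l ?(le_trans st)// le_max; apply/orP; right.
        exact: lexx.
      by apply: ereal_sup_ubound; exists i.
    rewrite /limit_height eseries0 ?mule0 ?adde0; last first.
      by move=> k _ _; rewrite indicE memNset ?mulr0// => Uk; apply: nU; exists k.
    apply/lee_addgt0Pr => e e0.
    have [n hn] : exists n, `|B s w - B (tau n) w| < e.
      have [r r0 hr] := continuous_path_local (@cB w) s0 e0.
      move: st; rewrite le_eqVlt => /orP[/eqP st|st].
        (* The rational -1 is outside [[0, t]], so its code is sent to the default [t]. *)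
        exists (choice.pickle (-1 : rat)); rewrite /tau choice.pickleK rmorphN1 oppr_ge0.
        by rewrite leNgt ltr01 /= st subrr normr0.
      have sy : s < Num.min t (s + r) by rewrite lt_min st ltrDl.
      have [q] := rat_in_itvoo sy; rewrite in_itv /= lt_min => /and3P[sq qt qr].
      exists (choice.pickle q); rewrite /tau choice.pickleK (ltW qt) (le_trans s0 (ltW sq)) /=.
      apply: hr; first exact: le_trans s0 (ltW sq).
      by rewrite distrC gtr0_norm ?subr_gt0// ltrBlDl.
    apply: (@le_trans _ _ ((B (tau n) w)%:E + e%:E)%E).
      rewrite -EFinD lee_fin; move: hn; rewrite ltr_norml => /andP[_ hn].
      by rewrite -lerBlDl ltW.
    rewrite leeD2r//; apply: (@le_trans _ _ (h n w)).
      by rewrite /h le_max lexx.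
    by apply: ereal_sup_ubound; exists n.
  apply: ge_ereal_sup => _ [n _ <-]; rewrite /h ge_max; apply/andP; split.
    apply: le_trans (limit_height_ge _ _) _; apply: ereal_sup_ubound.
    by exists (tau n) => //=; rewrite in_itv /= tauI.
  case: ifPn => [Ut|_]; last exact: leNye.
  apply: ereal_sup_ubound; exists (U n w); first by rewrite /= in_itv /= U0.
  by rewrite min_l// (le_trans Ut).
apply: (measurableT_comp (fine_measurable measurableT)).
apply: measurable_fun_esups => n; apply: measurable_maxe.
  by apply/measurable_EFinP; exact: mB.
apply: measurable_fun_ifT; last exact: measurable_cst.
  by apply: measurable_fun_ler.
exact: measurable_limit_height_at.
Qed.

End limit_measurability.

(** * Law of the levels of the Poisson points *)

Section limit_estimates.
Context {R : realType} d (T : measurableType d) (P : probability T R).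
Variables (H kappa : R) (eta U : nat -> T -> R).
Hypotheses (H0 : 0 < H) (kappa0 : 0 < kappa)
  (ppp : poisson_point_process P point_space (jump_intensity H) eta U).
Variables (m N : nat) (e : R).
Hypotheses (m0 : (0 < m)%N) (e0 : 0 < e).

Let kH := kappa `^ H.

Let kH0 : 0 < kH. Proof. exact: powR_gt0. Qed.

Lemma tail_scale (y : R) : 0 < y -> (y / kH) `^ (- H^-1) = kappa * y `^ (- H^-1).
Proof.
move=> y0; rewrite powRM ?invr_ge0 ?(ltW y0) ?(ltW kH0)// mulrC; congr (_ * _).
rewrite /kH -powRN -powRrM mulNr mulrN opprK mulfV ?gt_eqF// powRr1// ltW//.
Qed.

(** A scaled mark [kH * eta] exceeds [e * k.+1] exactly when [eta] exceeds this value. *)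
Definition threshold (k : nat) : R := e * k.+1%:R / kH.

Lemma threshold_gt0 k : 0 < threshold k.
Proof. by rewrite divr_gt0// mulr_gt0. Qed.

Definition limit_levels (w : T) : nat -> nat :=
  cell_levels m N e (limit_marks kH (eta ^~ w) (U ^~ w)).

Lemma limit_levels_le w j : (limit_levels w j <= N)%N.
Proof. exact: levels_le. Qed.

Lemma in_cell_le1 j (p : R) : (j < m)%N -> in_cell m j p -> p <= 1.
Proof.
move=> jm /andP[_ h]; have mR : 0 < m%:R :> R by rewrite ltr0n.
by rewrite -(ler_pM2l mR) mulr1; apply: le_trans h _; rewrite ler_nat.
Qed.

(** A bound on a level says that a strip is empty, so that the law of the levels can be read off
    void probabilities. *)
Lemma limit_levels_leE w j k : (j < m)%N -> (k < N)%N ->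
  (limit_levels w j <= k)%N <->
  point_count eta U (strip (threshold k) (cell_itv m j)) w = 0%E.
Proof.
move=> jm kN; rewrite leqNgt point_count_eq0.
have lev : (exists p v, [/\ limit_marks kH (eta ^~ w) (U ^~ w) p v, in_cell m j p &
    e * k.+1%:R < v]) <-> (k < limit_levels w j)%N.
  apply: (@levelsP N (fun k => exists p v, [/\ limit_marks kH (eta ^~ w) (U ^~ w) p v,
    in_cell m j p & e * k.+1%:R < v])) => // {kN}k [p [v [Epv pj kv]]].
  exists p, v; split => //; apply: le_lt_trans kv.
  by rewrite ler_pM2l// ler_nat.
split=> [/negP nlt i [/= h1 h2]|h]; last first.
  apply/negP => /lev[p [v [[i [Ui -> p1]] pj kv]]]; apply: (h i); split => /=.
    by rewrite in_itv /= andbT /threshold ltr_pdivrMr// (mulrC (eta i w)).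
  by apply/in_cellE => //; rewrite Ui.
apply: nlt; apply/lev; exists (U i w), (kH * eta i w).
have cj : in_cell m j (U i w) by apply/in_cellE.
split => //; last first.
  by move: h1; rewrite in_itv /= andbT /threshold ltr_pdivrMr// (mulrC (eta i w)).
by exists i; split => //; exact: in_cell_le1 cj.
Qed.

Lemma limit_levels_out w j : (m <= j)%N -> limit_levels w j = 0%N.
Proof.
move=> mj; rewrite /limit_levels /cell_levels /levels big1// => k _.
case: asboolP => // -[p [v [[i [_ _ p1]] /andP[jp _] _]]].
have mR : 0 < m%:R :> R by rewrite ltr0n.
have : m%:R * p <= j%:R by apply: (@le_trans _ _ m%:R); rewrite ?ler_nat// ger_pMr.
by rewrite leNgt jp.
Qed.

Let mstrip k j : measurable (strip (threshold k) (cell_itv m j)).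
Proof. exact: measurable_cell_strip. Qed.

Let strip_sub k j : strip (threshold k) (cell_itv m j) `<=` point_space.
Proof. by apply: strip_point_space (threshold_gt0 k) _; exact: cell_itv_ge0. Qed.

(** The sigma-algebra is left arbitrary in order to cover both the ambient one and the one generated
    by the counts. *)
Lemma sigma_limit_levels (G : set (set T)) : sigma_algebra setT G ->
  (forall k j, G [set w | point_count eta U (strip (threshold k) (cell_itv m j)) w = 0%E]) ->
  forall j k, G [set w | (limit_levels w j <= k)%N].
Proof.
move=> [G0 GC _] Gc j k.
have GT : G setT by have := GC _ G0; rewrite setD0.
have [kN|Nk] := ltnP k N; last first.
  rewrite (_ : [set w | _] = setT)//; apply/seteqP; split => // w _ /=.
  by apply: leq_trans Nk; exact: limit_levels_le.
have [jm|mj] := ltnP j m; last first.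
  rewrite (_ : [set w | _] = setT)//; apply/seteqP; split => // w _ /=.
  by rewrite limit_levels_out.
rewrite (_ : [set w | _] =
  [set w | point_count eta U (strip (threshold k) (cell_itv m j)) w = 0%E])//.
by apply/seteqP; split => w /=; rewrite limit_levels_leE.
Qed.

Lemma measurable_limit_levels j k : measurable [set w | (limit_levels w j <= k)%N].
Proof.
apply: sigma_limit_levels; first exact: sigma_algebra_measurable.
by move=> k' j'; exact: measurable_count_eq ppp _ _ (mstrip k' j').
Qed.

Lemma points_sigma_cell k : points_sigma point_space eta U (cell m limit_levels k).
Proof.
(* Here [T] carries the sigma-algebra generated by the counts, so that measurability is membership
   in [points_sigma]. *)
apply: (@measurable_cell _ (g_sigma_algebraType (\bigcup_(A in
  [set A | measurable A /\ A `<=` point_space])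
  preimage_set_system setT (point_count eta U A) measurable)) m limit_levels).
apply: sigma_limit_levels; first exact: smallest_sigma_algebra.
move=> k' j'; apply: sub_gen_smallest.
exists (strip (threshold k') (cell_itv m j')) => //.
by exists [set 0%E]; [exact: emeasurable_set1|rewrite setTI].
Qed.

(** Void probabilities of strips over disjoint cells multiply. Because of the cap, a bound
    [k j >= N] imposes nothing; it is represented by the empty strip and yields the factor 1. *)
Lemma prob_limit_orthant k : prob P (orthant m limit_levels k) =
  \prod_(j < m) (if (k j < N)%N then
    expR (- (kappa * (e * (k j).+1%:R) `^ (- H^-1) / m%:R)) else 1).
Proof.
have [_ _ _ _ indep] := ppp.
pose A i := if (i < m)%N && (k i < N)%N then strip (threshold (k i)) (cell_itv m i)
  else set0.
have mA i : measurable (A i) /\ A i `<=` point_space.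
  by rewrite /A; case: ifP => _; split.
have tA : trivIset setT A.
  apply/trivIsetP => i j _ _ ij; rewrite /A.
  case: ifP => _; rewrite ?set0I//; case: ifP => _; rewrite ?setI0//.
  apply/seteqP; split => // -[x p] [[_ /= h] [_ /= h']].
  have /andP[h1 h2] : in_cell m i p by apply/in_cellE.
  have /andP[h3 h4] : in_cell m j p by apply/in_cellE.
  move: ij; rewrite neq_ltn => /orP[ij|ji].
    by have := lt_le_trans h3 h2; rewrite ltr_nat ltnS leqNgt ij.
  by have := lt_le_trans h1 h4; rewrite ltr_nat ltnS leqNgt ji.
have mX i : measurable_fun setT (point_count eta U (A i)).
  by apply: measurable_point_count ppp _ _; case: (mA i).
have -> : orthant m limit_levels k =
    \bigcap_(i in `I_m) (point_count eta U (A i) @^-1` [set 0%E]).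
  apply/seteqP; split => w h i /= im; have := h i im; rewrite /A /=.
    rewrite im /=; case: ifPn => kN; first by move/limit_levels_leE; exact.
    by move=> _; apply/point_count_eq0 => l.
  rewrite im /=; case: ifPn => kN; first by move/limit_levels_leE; exact.
  by move=> _; apply: leq_trans (limit_levels_le _ _) _; rewrite leqNgt.
rewrite (prob_independent_bigcap _ (indep A mA tA)) => [|i|i].
- apply: eq_bigr => i _; rewrite /A ltn_ord /=; case: ifPn => kN.
    rewrite (prob_void H0 ppp (threshold_gt0 (k i)) (measurable_itv _)
      (lebesgue_cell_itv _ m0) (@cell_itv_ge0 _ _ _)).
    rewrite /threshold tail_scale ?mulr_gt0//; congr (expR (- _)); ring.
  rewrite (_ : _ @^-1` _ = setT) ?/prob ?probability_setT//.
  by apply/seteqP; split => // w _; apply/point_count_eq0 => l.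
- exact: emeasurable_set1.
- exact: mX.
Qed.

End limit_estimates.

Section limit_bad_set.
Context {R : realType} d (T : measurableType d) (P : probability T R).
Variables (H kappa : R) (B : R -> T -> R) (eta U : nat -> T -> R).
Hypotheses (H0 : 0 < H) (kappa0 : 0 < kappa)
  (ppp : poisson_point_process P point_space (jump_intensity H) eta U)
  (cB : forall w, {within `[0, +oo[, continuous (B ^~ w)})
  (mB : forall t : R, t \in `[0, 1] -> measurable_fun setT (B t)).
Variables (m N : nat) (e K : R).
Hypotheses (m0 : (0 < m)%N) (e0 : 0 < e) (e1 : e <= 1) (K0 : 0 <= K)
  (Km : K <= e * m%:R) (me : 2 / m%:R < 7 * e).

Definition tail (y : R) : R := kappa * y `^ (- H^-1).

(** The four terms bound the probabilities of a large oscillation of [B], of two large marks in one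
    cell, of a large mark in the last cell, and of a mark above the cap; coincident points and
    points at time 0 form a null set. *)
Lemma limit_bad_set : exists E, [/\ measurable E,
  prob P E <= mean P (fun w => modulus_excess K (B ^~ w)) / e +
    tail e ^+ 2 / m%:R + tail e / m%:R + tail (e * N.+1%:R) &
  forall w, ~ E w -> J1_ball
    (discretize m e K (limit_levels H kappa eta U m N e w) (B ^~ w)) (7 * e)
    ((Z_process H kappa B eta U)^~ w)].
Proof.
have [mEU S _ _ _] := ppp.
have mR : 0 < m%:R :> R by rewrite ltr0n.
have cadB w : cadlag01 (B ^~ w) by exact: continuous_path_cadlag.
have [N0 [mN0 pN0 N0P]] := negligible_coincidence H0 ppp.
pose th := threshold H kappa e.
have thE k : th k `^ (- H^-1) = tail (e * k.+1%:R).
  by rewrite /th /threshold tail_scale// mulr_gt0.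
have th0 k : 0 < th k by exact: threshold_gt0.
pose E1 := [set w | e <= modulus_excess K (B ^~ w)].
pose E2 := \big[setU/set0]_(j < m) two_points eta U (strip (th 0%N) (cell_itv m j)).
pose E3 := ~` [set w | point_count eta U (strip (th 0%N) (cell_itv m m.-1)) w = 0%E].
(* [cell_itv 1 0] is the whole of []0, 1]]. *)
pose E4 := ~` [set w | point_count eta U (strip (th N) (cell_itv 1 0)) w = 0%E].
have mme := measurable_modulus_excess mB cadB K0.
have mE1 : measurable E1.
  rewrite -[E1]setTI (_ : E1 = (fun w => modulus_excess K (B ^~ w)) @^-1` `[e, +oo[%classic).
    by apply: mme.
  by apply/seteqP; split => w /=; rewrite in_itv /= andbT.
have mE2 : measurable E2.
  by apply: bigsetU_measurable => j _; apply: (measurable_two_points ppp);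
     exact: measurable_cell_strip.
have mE3 : measurable E3.
  by apply: measurableC; apply: (measurable_count_eq ppp); exact: measurable_cell_strip.
have mE4 : measurable E4.
  by apply: measurableC; apply: (measurable_count_eq ppp); exact: measurable_cell_strip.
have pE1 : prob P E1 <= mean P (fun w => modulus_excess K (B ^~ w)) / e.
  apply: (@mean_markov _ _ _ _ 1) => // w; exact: modulus_excess_itv.
have pE2 : prob P E2 <= tail e ^+ 2 / m%:R.
  apply: le_trans (prob_two_points_cells H0 ppp (th0 0%N) m0) _.
  by rewrite thE mulr1.
have pE3 : prob P E3 <= tail e / m%:R.
  apply: le_trans (prob_nonvoid_le H0 ppp (th0 0%N) (measurable_itv _)
    (lebesgue_cell_itv _ m0) (@cell_itv_ge0 _ _ _)) _.
  by rewrite thE mulr1 mulrC.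
have pE4 : prob P E4 <= tail (e * N.+1%:R).
  apply: le_trans (prob_nonvoid_le H0 ppp (th0 N) (measurable_itv _)
    (lebesgue_cell_itv _ (ltn0Sn 0)) (@cell_itv_ge0 _ _ _)) _.
  by rewrite thE invr1 mul1r.
exists (E1 `|` E2 `|` E3 `|` E4 `|` N0); split.
- by do 4 ?apply: measurableU.
- have mU12 : measurable (E1 `|` E2) by exact: measurableU.
  have mU123 : measurable (E1 `|` E2 `|` E3) by exact: measurableU.
  have mU1234 : measurable (E1 `|` E2 `|` E3 `|` E4) by exact: measurableU.
  have := prob_setU P mU1234 mN0; have := prob_setU P mU123 mE4.
  have := prob_setU P mU12 mE3; have := prob_setU P mE1 mE2.
  move: (mean P _ / e) (tail e ^+ 2 / m%:R) (tail e / m%:R) pE1 pE2 pE3 pE4.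
  by move=> x y z; rewrite pN0; lra.
move=> w /not_orP[/not_orP[/not_orP[/not_orP[nE1 nE2] nE3] nE4] nN0].
have [Uinj Une] := N0P w nN0.
have Upos i : 0 < U i w.
  have [_] := S i w; rewrite /= in_itv /= andbT => h; by rewrite lt_neqAle eq_sym Une.
have kH0 : 0 < kappa `^ H by exact: powR_gt0.
have bigE k i : e * k.+1%:R < kappa `^ H * eta i w -> th k < eta i w.
  by move=> h; rewrite /th /threshold ltr_pdivrMr// (mulrC (eta i w)).
apply: (@limit_path_approx _ (kappa `^ H) (B ^~ w) (eta ^~ w) (U ^~ w)) => //.
- by move=> i; have [] := S i w; rewrite /= in_itv /= andbT.
- move=> s t s01 t01; apply: (@modulus_excess_lt _ K (B ^~ w) e e1 _ s t) => //.
  by rewrite ltNge; apply/negP.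
- move=> j i i' jm ii ci ci' hi hi'; apply: nE2.
  suff : (\bigcup_(j < m) two_points eta U (strip (th 0%N) (cell_itv m j))) w.
    by rewrite bigcup_mkord.
  exists j => //.
  have [c0 c1] : point_count eta U (strip (th 0%N) (cell_itv m j)) w != 0%E /\
      point_count eta U (strip (th 0%N) (cell_itv m j)) w != 1%E.
    apply: (point_count_ge2 ii); split => /=.
    - by rewrite in_itv /= andbT bigE// mulr1.
    - exact/in_cellE.
    - by rewrite in_itv /= andbT bigE// mulr1.
    - exact/in_cellE.
  by move=> [|] /= /eqP; rewrite ?(negbTE c0) ?(negbTE c1).
- move=> i ci hi; apply: nE3 => /point_count_eq0 h; apply: (h i); split => /=.
    by rewrite in_itv /= andbT bigE// mulr1.
  exact/in_cellE.
- move=> i Ui1; rewrite leNgt; apply/negP => hi; apply: nE4 => /point_count_eq0 h.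
  apply: (h i); split => /=; first by rewrite in_itv /= andbT bigE.
  by rewrite /cell_itv /= in_itv /= mul0r divr1 Upos.
Qed.

End limit_bad_set.

(** * The rescaled maxima *)

Section prelimit_path.
Context {R : realType}.
Variables (n m N : nat) (s y M : nat -> R) (e K : R).

Definition prelimit_marks (p v : R) : Prop :=
  exists2 i, (i < n)%N & p = i.+1%:R / n%:R /\ v = y i.

Hypotheses (m0 : (0 < m)%N) (mn : (m <= n)%N) (e0 : 0 < e) (K0 : 0 <= K)
  (Km : K <= e * m%:R) (me : 2 / m%:R < 7 * e)
  (s0 : s 0%N = 0) (M0 : M 0%N = 0)
  (M_ge : forall i k, (i < k)%N -> s i.+1 + y i <= M k)
  (M_le : forall k, exists2 i, (i < k.+1)%N & M k.+1 <= s i.+1 + y i).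

Let b (t : R) := s (Num.truncn (n%:R * t)).
Let W (t : R) := M (Num.truncn (n%:R * t)).

Hypotheses
  (bK : forall t t' : R, t \in `[0, 1] -> t' \in `[0, 1] -> `|b t - b t'| <= e + K * `|t - t'|)
  (uniq : forall j i i', (i < i')%N -> (i' < n)%N ->
     in_cell m j (i.+1%:R / n%:R : R) -> in_cell m j (i'.+1%:R / n%:R : R) ->
     e < y i -> e < y i' -> False)
  (last : forall i, (i < n)%N -> in_cell m m.-1 (i.+1%:R / n%:R : R) -> e < y i -> False)
  (top : forall i, (i < n)%N -> y i <= e * N.+1%:R)
  (* a path value at a grid time is only a lower bound for [M] if the
     perturbation there is not too negative *)
  (low0 : - e <= y 0%N)
  (low : forall j, (j < m)%N -> - e <= y ((n * j.+1) %/ m).-1).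

Lemma truncn_ratio (j : nat) : Num.truncn (n%:R * (j%:R / m%:R) : R) = ((n * j) %/ m)%N.
Proof.
have mR : 0 < m%:R :> R by rewrite ltr0n.
apply: truncn_def; rewrite mulrA ler_pdivlMr// ltr_pdivrMr// -!natrM ler_nat ltr_nat.
by rewrite leq_trunc_div /= ltn_ceil.
Qed.

Lemma prelimit_path_approx :
  J1_ball (discretize m e K (cell_levels m N e prelimit_marks) b) (7 * e) W.
Proof.
have e0_ : 0 < e by [].
have n0 : (0 < n)%N by exact: leq_trans m0 mn.
have nR : 0 < n%:R :> R by rewrite ltr0n.
have mR : 0 < m%:R :> R by rewrite ltr0n.
have gridn (i : nat) : n%:R * (i%:R / n%:R) = i%:R :> R.
  by rewrite mulrC divfK// gt_eqF.
have bgrid i : b (i%:R / n%:R) = s i by rewrite /b gridn natrK.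
have grid01 (i : nat) : (i <= n)%N -> (i%:R / n%:R : R) \in `[0, 1].
  by move=> iln; rewrite in_itv /= divr_ge0//= ler_pdivrMr// mul1r ler_nat.
rewrite discretizeE; apply: (@J1_discretized_maximum _ m N e K b) => //.
- by move=> t t' t01 t01'; apply: le_trans (bK t01 t01'); exact: ler_norm.
- move=> j jm; apply: sup_conv_close => //.
    by rewrite in_itv /= divr_ge0//= ler_pdivrMr// mul1r ler_nat.
  by move=> t t' t01 t01'; apply: le_trans (bK t01 t01'); exact: ler_norm.
- move=> p v [i iN [-> _]] _; rewrite divr_gt0//= ler_pdivrMr// mul1r ler_nat//.
- move=> j p v p' v' pj pj' [i iN [pE vE]] [i' iN' [pE' vE']] h h'.
  rewrite pE in pj; rewrite pE' in pj'; rewrite vE in h; rewrite vE' in h'.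
  rewrite pE pE'; case: (ltngtP i i') => [ii|ii|->//]; exfalso.
    exact: (@uniq j i i').
  exact: (@uniq j i' i).
- by move=> p v [i iN [pE vE]] h pm; apply: (@last i iN); rewrite -?pE -?vE.
- by move=> p v [i iN [_ ->]]; exact: top.
- move=> t; rewrite in_itv /= => /andP[t0 t1].
  have nt0 : 0 <= n%:R * t by rewrite mulr_ge0.
  have ktn : (Num.truncn (n%:R * t) <= n)%N.
    by apply: truncn_grid_le; rewrite in_itv /= t0.
  rewrite /W; case kE : (Num.truncn (n%:R * t)) => [|k].
    exists 0, 0; split; rewrite ?lexx//; first by left; exact: ltW.
    by rewrite /b mulr0 truncn0 s0 M0; lra.
  have [i ik Mi] := M_le k.
  exists (i.+1%:R / n%:R), (y i); split; last by rewrite bgrid; lra.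
    rewrite divr_ge0//= ler_pdivrMr// mulrC.
    apply: (@le_trans _ _ k.+1%:R); first by rewrite ler_nat.
    by rewrite -kE truncn_le.
  right; exists i => //; apply: leq_trans ik _; by rewrite -kE.
- move=> p v t [i iN [-> ->]] ev /andP[st t1]; rewrite bgrid.
  have : s i.+1 + y i <= W t.
    apply: M_ge; rewrite truncn_gt_nat.
    by move: st; rewrite ler_pdivrMr// mulrC.
  lra.
- move=> j t jm /andP[jt t1].
  have t0 : 0 <= t by apply: le_trans jt; rewrite divr_ge0.
  have [j0|j0] := posnP j.
    rewrite j0 mul0r /b mulr0 truncn0 s0 /W.
    case kE : (Num.truncn (n%:R * t)) => [|k]; first by rewrite M0; lra.
    (* The maximum starts at index 1 of the walk, not at 0: the first step costs at most
       [e + K / n <= 2 * e] and the first perturbation at most [e]. This is the origin of the slack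
       [3 * e] in the comparison at grid points. *)
    have h1 := M_ge (ltn0Sn k).
    have := bK (grid01 0%N (leq0n n)) (grid01 1%N n0); rewrite !bgrid s0.
    rewrite ler_norml mul0r sub0r normrN ger0_norm; last by rewrite divr_ge0.
    have : K * (1 / n%:R) <= e.
      rewrite div1r ler_pdivrMr//; apply: le_trans Km _.
      by rewrite ler_pM2l// ler_nat.
    move: low0 h1 => l0 h1 h2 /andP[h3 h4]; lra.
  (* [r] is the last index of the walk up to the grid time [j / m]; it is positive because
     [m <= n]. *)
  pose r := ((n * j) %/ m)%N.
  have br : b (j%:R / m%:R) = s r by rewrite /b truncn_ratio.
  have r0 : (0 < r)%N by rewrite divn_gt0// (leq_trans mn)// leq_pmulr.
  have rk : (r <= Num.truncn (n%:R * t))%N.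
    by rewrite /r -truncn_ratio; apply: le_truncn; rewrite ler_pM2l.
  have h1 : s r + y r.-1 <= W t.
    by have := @M_ge r.-1 (Num.truncn (n%:R * t)); rewrite prednK//; apply.
  have h2 : - e <= y r.-1.
    have jm' : (j.-1 < m)%N by rewrite prednK.
    by have := low jm'; rewrite prednK.
  by rewrite br; lra.
Qed.

End prelimit_path.

(** * Poisson limit for triangular arrays *)

Section product_limit.
Context {R : realType}.

Lemma expR_bound (x D : R) : 0 <= x -> x <= D -> D < 1 ->
  expR (- (x / (1 - D))) <= 1 - x <= expR (- x).
Proof.
move=> x0 xD D1; have D0 : 0 < 1 - D by rewrite subr_gt0.
have x1 : 0 < 1 - x by rewrite subr_gt0 (le_lt_trans xD).
apply/andP; split; last by have := expR_ge1Dx (- x).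
rewrite expRN -[leRHS]invrK lef_pV2 ?posrE ?invr_gt0 ?expR_gt0//.
apply: le_trans (expR_ge1Dx _).
rewrite (_ : (1 - x)^-1 = 1 + x / (1 - x)); last by field; rewrite gt_eqF.
by rewrite lerD2l ler_wpM2l// lef_pV2 ?posrE// lerD2l lerN2.
Qed.

(** Each factor [1 - x] lies between [expR (- (x / (1 - D)))] and [expR (- x)], and [D] tends to 0,
    so both bounds on the product have the same limit. *)
Lemma cvg_prod_expR (x : nat -> nat -> R) (D : nat -> R) (sigma : R) :
  (forall n i, (i < n)%N -> 0 <= x n i <= D n) ->
  D n @[n --> \oo] --> 0 ->
  \sum_(i < n) x n i @[n --> \oo] --> sigma ->
  \prod_(i < n) (1 - x n i) @[n --> \oo] --> expR (- sigma).
Proof.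
move=> xD D0 xs.
have D1 : \forall n \near \oo, D n < 1.
  have /cvgrPdist_lt/(_ 1 ltr01) := D0; apply: filterS => n.
  by rewrite sub0r normrN; apply: le_lt_trans; exact: ler_norm.
apply: (@squeeze_cvgr _ _ _ _ (fun n => expR (- ((\sum_(i < n) x n i) / (1 - D n))))
    (fun n => expR (- (\sum_(i < n) x n i)))).
- apply: filterS D1 => n Dn; rewrite mulr_suml -!sumrN !expR_sum.
  apply/andP; split; apply: ler_prod => i _.
    rewrite expR_ge0 /=; have /andP[h1 h2] := xD n i (ltn_ord i).
    by case/andP: (expR_bound h1 h2 Dn).
  have /andP[h1 h2] := xD n i (ltn_ord i); case/andP: (expR_bound h1 h2 Dn) => h3 ->.
  by rewrite andbT; apply: le_trans h3; exact: expR_ge0.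
- apply: cvg_comp; last exact: continuous_expR.
  have h1 : 1 - D n @[n --> \oo] --> (1 - 0 : R) by apply: cvgB => //; exact: cvg_cst.
  have h2 : (1 - D n)^-1 @[n --> \oo] --> (1 - 0 : R)^-1.
    by apply: cvgV h1; rewrite subr0 oner_neq0.
  rewrite subr0 invr1 in h2; apply: cvgN; rewrite -[sigma]mulr1.
  exact: cvgM xs h2.
- by apply: cvg_comp; [exact: cvgN xs|exact: continuous_expR].
Qed.

Lemma cvg_powRn (H : R) : 0 < H -> n%:R `^ H @[n --> \oo] --> +oo.
Proof.
move=> H0; apply/cvgryPge => A; near=> n.
have h : `|A| `^ H^-1 <= n%:R by near: n; exact: nbhs_infty_ger.
apply: le_trans (ler_norm A) _.
have -> : `|A| = (`|A| `^ H^-1) `^ H by rewrite -powRrM mulVf ?gt_eqF// powRr1.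
by apply: ge0_ler_powR; rewrite ?nnegrE ?powR_ge0 ?ler0n ?(ltW H0).
Unshelve. all: by end_near. Qed.

Lemma cvg_divn_ratio (m a : nat) : (0 < m)%N ->
  ((n * a) %/ m)%N%:R / n%:R @[n --> \oo] --> (a%:R / m%:R : R).
Proof.
move=> m0; have mR : 0 < m%:R :> R by rewrite ltr0n.
apply/cvgrPdist_le => e e0; near=> n.
have n1 : (0 < n)%N by near: n; exact: nbhs_infty_gt.
have nR : 0 < n%:R :> R by rewrite ltr0n.
have ne : e^-1 <= n%:R by near: n; exact: nbhs_infty_ger.
set q := ((n * a) %/ m)%N.
have h1 : (q%:R * m%:R <= n%:R * a%:R :> R) by rewrite -!natrM ler_nat leq_trunc_div.
have h2 : (n%:R * a%:R < q.+1%:R * m%:R :> R) by rewrite -!natrM ltr_nat ltn_ceil.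
have -> : a%:R / m%:R - q%:R / n%:R = (n%:R * a%:R / m%:R - q%:R) / n%:R :> R.
  by field; rewrite !gt_eqF.
rewrite normrM normfV (gtr0_norm nR) ler_pdivrMr//.
apply: (@le_trans _ _ 1); last by rewrite mulrC -ler_pdivrMr// div1r.
rewrite ger0_norm; first by rewrite lerBlDl natr1 ler_pdivrMr// ltW.
by rewrite subr_ge0 ler_pdivlMr.
Unshelve. all: by end_near. Qed.

End product_limit.

Section tail_limit.
Context d (T : measurableType d) (R : realType) (P : probability T R).
Variables (H kappa : R) (Y0 : T -> R).
Hypotheses (H0 : 0 < H) (kappa0 : 0 < kappa) (mY : measurable_fun setT Y0)
  (Ytail : fine (P [set w | x < Y0 w]) / (kappa * x `^ (- H^-1)) @[x --> +oo] --> (1 : R)).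

Definition ptail (n : nat) (y : R) : R := prob P [set w | y * n%:R `^ H < Y0 w].

(** At [x = y n^H] the reference tail [x^(-1/H)] equals [y^(-1/H) / n], and the factor [n] turns the
    tail equivalence into a limit. *)
Lemma ptail_cvg y : 0 < y -> n%:R * ptail n y @[n --> \oo] --> tail H kappa y.
Proof.
move=> y0.
have h : y * n%:R `^ H @[n --> \oo] --> +oo.
  apply/cvgryPge => A.
  have /cvgryPge/(_ (A / y)) := cvg_powRn H0; apply: filterS => n.
  by rewrite ler_pdivrMr// mulrC.
have := cvg_comp _ _ h Ytail => h'.
have h2 : fine (P [set w | y * n%:R `^ H < Y0 w]) /
    (kappa * (y * n%:R `^ H) `^ (- H^-1)) * tail H kappa y @[n --> \oo] --> tail H kappa y.
  by rewrite -[X in _ --> X]mul1r; apply: cvgM h' _; exact: cvg_cst.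
apply: cvg_trans h2; apply: near_eq_cvg; near=> n.
have n1 : (0 < n)%N by near: n; exact: nbhs_infty_gt.
have nR : 0 < n%:R :> R by rewrite ltr0n.
have yp : 0 < y `^ (- H^-1) by exact: powR_gt0.
rewrite /= /tail /ptail /prob powRM ?powR_ge0 ?(ltW y0)//.
rewrite -powRrM mulrN mulfV ?gt_eqF// powR_inv1//.
by field; rewrite !gt_eqF.
Unshelve. all: by end_near. Qed.

Lemma ptail_cvg0 y : 0 < y -> ptail n y @[n --> \oo] --> 0.
Proof.
move=> y0; have h := ptail_cvg y0.
have hn : (n%:R : R)^-1 @[n --> \oo] --> 0.
  apply/gtr0_cvgV0; last exact: cvgr_idn.
  by exists 1%N => // n /= n0; rewrite ltr0n.
have h2 : (n%:R : R)^-1 * (n%:R * ptail n y) @[n --> \oo] --> 0.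
  by rewrite -(mul0r (tail H kappa y)); apply: cvgM hn h.
apply: cvg_trans h2; apply: near_eq_cvg; near=> n.
have n1 : (0 < n)%N by near: n; exact: nbhs_infty_gt.
by rewrite /= mulrA mulVf ?mul1r// pnatr_eq0 -lt0n.
Unshelve. all: by end_near. Qed.

(** At each outcome the indicators vanish eventually, and bounded convergence applies. *)
Lemma left_tail_cvg0 y : 0 < y ->
  prob P [set w | Y0 w < - (y * n%:R `^ H)] @[n --> \oo] --> 0.
Proof.
move=> y0; pose A n := [set w | Y0 w < - (y * n%:R `^ H)].
have mA n : measurable (A n).
  rewrite (_ : A n = setT `&` Y0 @^-1` `]-oo, - (y * n%:R `^ H)[%classic).
    by apply: mY => //; exact: measurable_itv.
  by rewrite setTI; apply/seteqP; split => w /=; rewrite in_itv.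
under eq_fun do rewrite -(mean_indic P (mA _)).
rewrite -(mean_cst P 0).
apply: (@mean_cvg _ _ _ P 1 (fun n => \1_(A n) : T -> R) (fun=> 0)) => //.
- by move=> n w; rewrite indicE; case: (_ \in _); rewrite ?normr0 ?normr1 ?ler01.
move=> w; apply: cvg_near_cst.
have /cvgryPge/(_ (- Y0 w / y)) := cvg_powRn H0; apply: filterS => n.
rewrite ler_pdivrMr// mulrC lerNl => h.
by rewrite indicE memNset// /A /= ltNge h.
Qed.

End tail_limit.

(** * Law of the levels of the perturbations *)

Section prelimit_levels.
Context {R : realType}.
Variables (m N : nat) (e H : R).
Hypotheses (m0 : (0 < m)%N) (e0 : 0 < e).

Definition prelimit_levels (T : Type) (Y : nat -> T -> R) (n : nat) (w : T) : nat -> nat :=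
  cell_levels m N e (prelimit_marks n (fun i => Y i w / n%:R `^ H)).

Lemma prelimit_levels_le (T : Type) (Y : nat -> T -> R) n w j :
  (prelimit_levels Y n w j <= N)%N.
Proof. exact: levels_le. Qed.

Lemma prelimit_levels_leE (T : Type) (Y : nat -> T -> R) n w j k : (k < N)%N ->
  (prelimit_levels Y n w j <= k)%N <->
  forall i, (i < n)%N -> in_cell m j (i.+1%:R / n%:R : R) ->
    Y i w / n%:R `^ H <= e * k.+1%:R.
Proof.
move=> kN; rewrite leqNgt.
have lev : (exists p v, [/\ prelimit_marks n (fun i => Y i w / n%:R `^ H) p v,
    in_cell m j p & e * k.+1%:R < v]) <-> (k < prelimit_levels Y n w j)%N.
  apply: (@levelsP N (fun k => exists p v,
    [/\ prelimit_marks n (fun i => Y i w / n%:R `^ H) p v,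
    in_cell m j p & e * k.+1%:R < v])) => // {kN}k [p [v [Epv pj kv]]].
  exists p, v; split => //; apply: le_lt_trans kv.
  by rewrite ler_pM2l// ler_nat.
split=> [/negP nlt i iN ci|h].
  rewrite leNgt; apply/negP => hi; apply: nlt; apply/lev.
  by exists (i.+1%:R / n%:R), (Y i w / n%:R `^ H); split => //; exists i.
apply/negP => /lev[p [v [[i iN [pE vE]] pj kv]]].
rewrite pE in pj; have := h i iN pj; rewrite -vE leNgt kv. by [].
Qed.

Lemma measurable_prelimit_levels d (T : measurableType d) (Y : nat -> T -> R) n j k :
  (forall i, measurable_fun setT (Y i)) ->
  measurable [set w | (prelimit_levels Y n w j <= k)%N].
Proof.
move=> mY; have [kN|Nk] := ltnP k N; last first.
  rewrite (_ : [set w | _] = setT)//; apply/seteqP; split => // w _ /=.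
  by apply: leq_trans Nk; exact: prelimit_levels_le.
pose Q i := [set w | in_cell m j (i.+1%:R / n%:R : R) -> Y i w / n%:R `^ H <= e * k.+1%:R].
rewrite (_ : [set w | _] = [set w | forall i, (i < n)%N -> Q i w]).
  apply: measurable_finite_forall => i; rewrite /Q.
  have [ci|nci] := pselect (in_cell m j (i.+1%:R / n%:R : R)); last first.
    by rewrite (_ : [set w | _] = setT)//; apply/seteqP; split => // w _ /nci.
  rewrite (_ : [set w | _] = setT `&` (fun w => Y i w / n%:R `^ H) @^-1`
      `]-oo, e * k.+1%:R]%classic).
    by apply: measurable_funM => //; exact: measurable_itv.
  rewrite setTI; apply/seteqP; split => w /=; rewrite in_itv /=; first exact.
  by move=> h _.
by apply/seteqP; split => w /=; rewrite prelimit_levels_leE.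
Qed.

(** Cells are open on the left, so the cell of [(i + 1) / n] is the ceiling of [(i + 1) m / n] minus
    1; subtracting 1 before the integer division computes this. *)
Definition cell_index (n i : nat) : nat := ((i.+1 * m).-1 %/ n)%N.

Lemma cell_index_lt n i : (i < n)%N -> (cell_index n i < m)%N.
Proof.
move=> iN; have n0 : (0 < n)%N by exact: leq_ltn_trans iN.
rewrite /cell_index ltn_divLR// prednK ?muln_gt0//.
by rewrite mulnC leq_mul2l iN orbT.
Qed.

Lemma cell_index_ltE n i j : (i < n)%N ->
  (cell_index n i < j)%N = (i < (n * j) %/ m)%N.
Proof.
move=> iN; have n0 : (0 < n)%N by exact: leq_ltn_trans iN.
rewrite /cell_index ltn_divLR// prednK ?muln_gt0// leq_divRL//.
by rewrite (mulnC n).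
Qed.

Lemma in_cell_index n i j : (i < n)%N ->
  in_cell m j (i.+1%:R / n%:R : R) <-> cell_index n i = j.
Proof.
move=> iN; have n0 : (0 < n)%N by exact: leq_ltn_trans iN.
have nR : 0 < n%:R :> R by rewrite ltr0n.
have E1 : (j%:R < m%:R * (i.+1%:R / n%:R) :> R) = (j <= cell_index n i)%N.
  rewrite mulrA ltr_pdivlMr// -!natrM ltr_nat [in RHS]leqNgt.
  by rewrite cell_index_ltE// leq_divRL// -ltnNge (mulnC n) (mulnC m).
have E2 : (m%:R * (i.+1%:R / n%:R) <= j.+1%:R :> R) = (cell_index n i <= j)%N.
  rewrite mulrA ler_pdivrMr// -!natrM ler_nat -[RHS]ltnS cell_index_ltE//.
  by rewrite leq_divRL// (mulnC n) (mulnC m).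
rewrite /in_cell E1 E2; split => [/andP[h1 h2]|->]; last by rewrite leqnn.
by apply/eqP; rewrite eqn_leq h2.
Qed.

Lemma sum_lt_indicator (n r : nat) : (r <= n)%N ->
  \sum_(i < n) ((i < r)%N%:R : R) = r%:R.
Proof.
move=> rn; rewrite -natr_sum; congr (_%:R).
by rewrite -big_mkcond /= sum1_card; rewrite -[RHS]card_ord (card_ord r) -sum1_card
   (big_ord_narrow rn) sum1_card card_ord.
Qed.

(** The indicator of [cell_index n i = j] is the difference of the indicators of
    [i < (n * j.+1) %/ m] and [i < (n * j) %/ m], which counts the indices of each cell. *)
Lemma sum_cell_index n (g : nat -> R) : (0 < n)%N ->
  \sum_(i < n) g (cell_index n i) =
  \sum_(j < m) g j * (((n * j.+1) %/ m)%N%:R - ((n * j) %/ m)%N%:R).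
Proof.
move=> n0.
have divle j : (j <= m)%N -> ((n * j) %/ m <= n)%N.
  by move=> jm; rewrite -{2}(mulnK n m0); apply: leq_div2r; rewrite leq_mul2l jm orbT.
have -> : \sum_(i < n) g (cell_index n i) =
    \sum_(i < n) \sum_(j < m) g j * ((i < (n * j.+1) %/ m)%N%:R - (i < (n * j) %/ m)%N%:R).
  apply: eq_bigr => i _.
  have h := cell_index_lt (ltn_ord i).
  rewrite (bigD1 (Ordinal h))//= big1 ?addr0 => [|j].
    by rewrite -!cell_index_ltE// ltnSn ltnn subr0 mulr1.
  rewrite -val_eqE /= => jE; rewrite -!cell_index_ltE// ltnS leq_eqVlt.
  by rewrite eq_sym (negbTE jE) subrr mulr0.
rewrite exchange_big /=; apply: eq_bigr => j _.
rewrite -mulr_sumr sumrB !sum_lt_indicator ?divle//; exact: ltnW.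
Qed.

End prelimit_levels.

Section prelimit_orthant.
Context d (T : measurableType d) (R : realType) (P : probability T R).
Variables (H kappa : R) (Y : nat -> T -> R).
Hypotheses (H0 : 0 < H) (kappa0 : 0 < kappa) (mY : forall i, measurable_fun setT (Y i))
  (Ytail : fine (P [set w | x < Y 0%N w]) / (kappa * x `^ (- H^-1)) @[x --> +oo] --> (1 : R))
  (Yindep : mutually_independent P Y) (Yid : identically_distributed P Y).
Variables (m N : nat) (e : R).
Hypotheses (m0 : (0 < m)%N) (e0 : 0 < e).

Lemma measurable_tail_set i (a : R) : measurable [set w | a < Y i w].
Proof.
rewrite (_ : [set w | _] = setT `&` Y i @^-1` `]a, +oo[%classic).
  by apply: mY => //; exact: measurable_itv.
by rewrite setTI; apply/seteqP; split => w /=; rewrite in_itv /= andbT.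
Qed.

Lemma prob_tail_id i n y : prob P [set w | y * n%:R `^ H < Y i w] = ptail P H (Y 0%N) n y.
Proof.
have E k : [set w | y * n%:R `^ H < Y k w] = Y k @^-1` `]y * n%:R `^ H, +oo[%classic.
  by apply/seteqP; split => w /=; rewrite in_itv /= andbT.
by rewrite /ptail /prob !E Yid//; exact: measurable_itv.
Qed.

(** In terms of the perturbations, the orthant asks each [Y i] to stay below a bound that depends on
    its cell only. *)
Lemma prob_prelimit_orthant n k : (0 < n)%N ->
  prob P (orthant m (prelimit_levels m N e H Y n) k) =
  \prod_(i < n) (1 - (if (k (cell_index m n i) < N)%N then
     ptail P H (Y 0%N) n (e * (k (cell_index m n i)).+1%:R) else 0)).
Proof.
move=> n0; have nH : 0 < n%:R `^ H :> R by rewrite powR_gt0 ?ltr0n.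
pose A i : set R := if (k (cell_index m n i) < N)%N then
  `]-oo, e * (k (cell_index m n i)).+1%:R * n%:R `^ H]%classic else setT.
have mA i : measurable (A i) by rewrite /A; case: ifP => _ //; exact: measurable_itv.
have -> : orthant m (prelimit_levels m N e H Y n) k = \bigcap_(i in `I_n) (Y i @^-1` A i).
  apply/seteqP; split => w h.
    move=> i /= iN; rewrite /A /=; case: ifPn => // kN.
    have := h _ (cell_index_lt m0 iN); rewrite prelimit_levels_leE// => /(_ i iN).
    move=> /(_ ((in_cell_index m0 _ iN).2 (erefl _))).
    by rewrite /= in_itv /= ler_pdivrMr.
  move=> j jm; have [kN|kN] := ltnP (k j) N; last first.
    by apply: leq_trans kN; exact: prelimit_levels_le.
  apply/prelimit_levels_leE => // i iN /(in_cell_index m0 _ iN) c.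
  have := h i iN; rewrite /A /= c kN /= in_itv /= ler_pdivrMr//.
rewrite prob_independent_bigcap//; apply: eq_bigr => i _; rewrite /A.
case: ifPn => kN; last by rewrite preimage_setT /prob probability_setT subr0.
rewrite -(prob_tail_id i) -prob_setC; last exact: measurable_tail_set.
congr prob; apply/seteqP; split => w /=; rewrite in_itv /=; first by rewrite leNgt => /negP.
by move=> /negP; rewrite -leNgt.
Qed.

(** The tail probabilities are summed cell by cell. A cell contains a proportion of the [n] indices
    tending to [1 / m], which produces the exponents of the Poisson void probabilities. *)
Lemma cvg_prelimit_orthant k :
  prob P (orthant m (prelimit_levels m N e H Y n) k) @[n --> \oo] -->
  \prod_(j < m) (if (k j < N)%N then
    expR (- (kappa * (e * (k j).+1%:R) `^ (- H^-1) / m%:R)) else 1 : R).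
Proof.
have mR : 0 < m%:R :> R by rewrite ltr0n.
pose g n j : R := if (k j < N)%N then ptail P H (Y 0%N) n (e * (k j).+1%:R) else 0.
pose q j : R := if (k j < N)%N then tail H kappa (e * (k j).+1%:R) else 0.
have ek0 i : 0 < e * i.+1%:R by rewrite mulr_gt0.
have ng j : n%:R * g n j @[n --> \oo] --> q j.
  rewrite /g /q; case: ifP => _; first exact: ptail_cvg.
  by under eq_fun do rewrite mulr0; exact: cvg_cst.
have -> : \prod_(j < m) (if (k j < N)%N then
    expR (- (kappa * (e * (k j).+1%:R) `^ (- H^-1) / m%:R)) else 1 : R) =
    expR (- (\sum_(j < m) q j / m%:R)).
  rewrite -sumrN expR_sum; apply: eq_bigr => j _; rewrite /q /tail.
  by case: ifP => _ //; rewrite mul0r oppr0 expR0.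
have step : \prod_(i < n) (1 - g n (cell_index m n i)) @[n --> \oo] -->
    expR (- (\sum_(j < m) q j / m%:R)).
  (* The smallest threshold is [e], so [ptail] at [e] dominates all the terms. *)
  apply: (@cvg_prod_expR _ (fun n i => g n (cell_index m n i)) (fun n => ptail P H (Y 0%N) n e)).
  - move=> n i iN; rewrite /g; case: ifP => _; last by rewrite lexx prob_ge0.
    rewrite prob_ge0 /=; apply: prob_le; try exact: measurable_tail_set.
    move=> w /=; apply: le_lt_trans; rewrite ler_wpM2r ?powR_ge0//.
    by rewrite ler_peMr ?(ltW e0)// ler1n.
  - exact: (ptail_cvg0 (kappa := kappa)).
  have h : \sum_(j < m) (n%:R * g n j) * (((n * j.+1) %/ m)%N%:R / n%:R -
      ((n * j) %/ m)%N%:R / n%:R) @[n --> \oo] --> \sum_(j < m) q j / m%:R.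
    apply: cvg_finsum => j; apply: cvgM; first exact: ng.
    have -> : m%:R^-1 = j.+1%:R / m%:R - j%:R / m%:R :> R.
      by rewrite -mulrBl -natr1 addrAC subrr add0r mul1r.
    by apply: cvgB; exact: cvg_divn_ratio.
  apply: cvg_trans h; apply: near_eq_cvg; near=> n.
  have n0 : (0 < n)%N by near: n; exact: nbhs_infty_gt.
  have nR : n%:R != 0 :> R by rewrite pnatr_eq0 -lt0n.
  rewrite (sum_cell_index m0 (g n))//; apply: eq_bigr => j _.
  by field.
apply: cvg_trans step; apply: near_eq_cvg; near=> n.
have n0 : (0 < n)%N by near: n; exact: nbhs_infty_gt.
by rewrite prob_prelimit_orthant.
Unshelve. all: by end_near. Qed.

End prelimit_orthant.

Section perturbed_max_facts.
Context {R : realType} (T : Type).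
Variables (X Y : nat -> T -> R).

Lemma perturbed_max_ge i k w : (i < k)%N ->
  walk X i.+1 w + Y i w <= perturbed_max X Y k w.
Proof.
case: k => // k ik /=.
exact: (le_bigmax _ (fun i : 'I_k.+1 => walk X i.+1 w + Y i w) (Ordinal ik)).
Qed.

Lemma perturbed_max_attained k w : exists2 i, (i < k.+1)%N &
  perturbed_max X Y k.+1 w = walk X i.+1 w + Y i w.
Proof.
rewrite /=; elim/big_ind: _ => [|x y [i ik ->] [j jk ->]|i _].
- by exists 0%N => //; rewrite /walk big_ord1.
- by rewrite /Num.max; case: ifP => _; [exists j|exists i].
- by exists i.
Qed.

Lemma cadlag_rescaled H (V : nat -> T -> R) n w : cadlag01 (rescaled H V n ^~ w).
Proof. exact: (cadlag_truncn (fun k => V k w / n%:R `^ H) n). Qed.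

End perturbed_max_facts.

Section prelimit_measurability.
Context {R : realType} d (T : measurableType d).
Variables (X Y : nat -> T -> R) (H : R).
Hypothesis mX : forall i, measurable_fun setT (X i).

Lemma measurable_walk k : measurable_fun setT (walk X k).
Proof. by apply: measurable_sum => i; exact: mX. Qed.

Lemma measurable_rescaled_walk n t : measurable_fun setT (rescaled H (walk X) n t).
Proof. by apply: measurable_funM => //; exact: measurable_walk. Qed.

Hypothesis mY : forall i, measurable_fun setT (Y i).

Lemma measurable_perturbed_max k : measurable_fun setT (perturbed_max X Y k).
Proof.
case: k => [|k]; first exact: measurable_cst.
rewrite /perturbed_max; elim: (index_enum _) => [|i r IH].
  by under eq_fun do rewrite big_nil; exact: measurable_funD.
under eq_fun do rewrite big_cons; apply: measurable_maxr => //.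
by apply: measurable_funD => //; exact: measurable_walk.
Qed.

Lemma measurable_rescaled_perturbed_max n t :
  measurable_fun setT (rescaled H (perturbed_max X Y) n t).
Proof. by apply: measurable_funM => //; exact: measurable_perturbed_max. Qed.

End prelimit_measurability.

(** * Exceptional events for the rescaled maxima *)

Section prelimit_bad_set.
Context d (T : measurableType d) (R : realType) (P : probability T R).
Variables (H : R) (X Y : nat -> T -> R).
Hypotheses (mX : forall i, measurable_fun setT (X i)) (mY : forall i, measurable_fun setT (Y i))
  (Yindep : mutually_independent P Y) (Yid : identically_distributed P Y).
Variables (m N : nat) (e K : R).
Hypotheses (m0 : (0 < m)%N) (e0 : 0 < e) (e1 : e <= 1) (K0 : 0 <= K)
  (Km : K <= e * m%:R) (me : 2 / m%:R < 7 * e).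

Let pt n y := ptail P H (Y 0%N) n y.
Let lowtail n := prob P [set w | Y 0%N w < - (e * n%:R `^ H)].

Lemma prob_two_large i j n y : i != j ->
  prob P ([set w | y * n%:R `^ H < Y i w] `&` [set w | y * n%:R `^ H < Y j w]) = pt n y ^+ 2.
Proof.
move=> ij; have := @Yindep [fset i; j]%fset (fun=> `]y * n%:R `^ H, +oo[%classic)
  (fun=> measurable_itv _).
have E k : [set w | y * n%:R `^ H < Y k w] = Y k @^-1` `]y * n%:R `^ H, +oo[%classic.
  by apply/seteqP; split => w /=; rewrite in_itv /= andbT.
rewrite (big_fsetD1 i) ?fset21//= (big_fsetD1 j) ?in_fsetD1 ?fset22 ?(eq_sym j) ?ij//=.
rewrite big1_fset ?mule1 => [h|k]; last first.
  rewrite !in_fsetD1 => /and3P[kj ki]; rewrite !inE => /orP[/eqP kE|/eqP kE].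
    by rewrite kE eqxx in ki.
  by rewrite kE eqxx in kj.
rewrite /prob (_ : _ `&` _ = \bigcap_(k in [set` [fset i; j]%fset])
    Y k @^-1` `]y * n%:R `^ H, +oo[%classic); last first.
  rewrite !E; apply/seteqP; split => w.
    by move=> [h1 h2] k /=; rewrite !inE => /orP[/eqP ->|/eqP ->].
  by move=> hw; split; apply: hw; rewrite /= !inE eqxx ?orbT.
have mYA k : measurable (Y k @^-1` `]y * n%:R `^ H, +oo[%classic).
  by rewrite -E; exact: measurable_tail_set.
rewrite h fineM ?fin_num_measure// -(E i) -(E j).
by rewrite expr2 /pt -{1}(prob_tail_id H Yid i n y) -(prob_tail_id H Yid j n y).
Qed.

Lemma prob_bigcup_le n (F : nat -> set T) c : (forall i, measurable (F i)) ->
  (forall i, (i < n)%N -> prob P (F i) <= c) ->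
  prob P (\big[setU/set0]_(i < n) F i) <= n%:R * c.
Proof.
move=> mF Fc; apply: le_trans (prob_bigcup P n mF) _.
apply: (@le_trans _ _ (\sum_(i < n) c)); first by apply: ler_sum => i _; exact: Fc.
by rewrite sumr_const card_ord mulr_natl.
Qed.

(* The terms bound the probabilities of, respectively, a large oscillation of the
   walk, two large marks in one cell, a large mark in the last cell, a mark above
   the cap [e * (N + 1)], and a very negative mark at a grid time. *)
Definition prelimit_bound (n : nat) : R :=
  mean P (fun w => modulus_excess K (rescaled H (walk X) n ^~ w)) / e +
  n%:R * ((n %/ m)%N%:R * pt n e ^+ 2) + (n %/ m).+1%:R * pt n e +
  n%:R * pt n (e * N.+1%:R) + m.+1%:R * lowtail n.

Lemma measurable_low_set i a : measurable [set w | Y i w < a].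
Proof.
rewrite (_ : [set w | _] = setT `&` Y i @^-1` `]-oo, a[%classic).
  by apply: mY => //; exact: measurable_itv.
by rewrite setTI; apply/seteqP; split => w /=; rewrite in_itv.
Qed.

Lemma prob_low_id i a : prob P [set w | Y i w < a] = prob P [set w | Y 0%N w < a].
Proof.
have E k : [set w | Y k w < a] = Y k @^-1` `]-oo, a[%classic.
  by apply/seteqP; split => w /=; rewrite in_itv.
by rewrite /prob !E Yid//; exact: measurable_itv.
Qed.

Lemma prelimit_bad_set n : (m <= n)%N -> exists E, [/\ measurable E,
  prob P E <= prelimit_bound n &
  forall w, ~ E w -> J1_ball
    (discretize m e K (prelimit_levels m N e H Y n w) (rescaled H (walk X) n ^~ w)) (7 * e)
    (rescaled H (perturbed_max X Y) n ^~ w)].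
Proof.
move=> mn; have n0 : (0 < n)%N by exact: leq_trans m0 mn.
have nR : 0 < n%:R :> R by rewrite ltr0n.
have mR : 0 < m%:R :> R by rewrite ltr0n.
have nH : 0 < n%:R `^ H :> R by exact: powR_gt0.
pose big i := [set w | e * n%:R `^ H < Y i w].
have mbig i : measurable (big i) by exact: measurable_tail_set.
pose E1 := [set w | e <= modulus_excess K (rescaled H (walk X) n ^~ w)].
(* Two indices in one cell differ by at most [n %/ m], so the pairs are listed by their difference
   [q.+1]. *)
pose E2 := \big[setU/set0]_(i < n) \big[setU/set0]_(q < n %/ m) (big i `&` big (i + q.+1)%N).
(* The indices of the last cell are at most [n %/ m] below [n.-1]. *)
pose E3 := \big[setU/set0]_(q < (n %/ m).+1) big (n.-1 - q)%N.
pose E4 := \big[setU/set0]_(i < n) [set w | (e * N.+1%:R) * n%:R `^ H < Y i w].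
(* The index of the perturbation used at each grid point; no perturbation sits at time 0, so grid
   point 0 uses the first one. *)
pose f j := if j is j'.+1 then ((n * j'.+1) %/ m).-1 else 0%N.
pose E5 := \big[setU/set0]_(j < m.+1) [set w | Y (f j) w < - (e * n%:R `^ H)].
have mme : measurable_fun setT (fun w => modulus_excess K (rescaled H (walk X) n ^~ w)).
  apply: measurable_modulus_excess => // [t _|w].
    exact: measurable_rescaled_walk.
  exact: cadlag_rescaled.
have mE1 : measurable E1.
  rewrite (_ : E1 = setT `&` (fun w => modulus_excess K (rescaled H (walk X) n ^~ w)) @^-1`
    `[e, +oo[%classic).
    by apply: mme => //; exact: measurable_itv.
  by rewrite setTI; apply/seteqP; split => w /=; rewrite in_itv /= andbT.
have mI i q : measurable (big i `&` big (i + q.+1)%N) by exact: measurableI.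
have mU i : measurable (\big[setU/set0]_(q < n %/ m) (big i `&` big (i + q.+1)%N)).
  by apply: bigsetU_measurable.
have mE2 : measurable E2 by apply: bigsetU_measurable.
have mE3 : measurable E3 by apply: bigsetU_measurable.
have mE4 : measurable E4 by apply: bigsetU_measurable => i _; exact: measurable_tail_set.
have mE5 : measurable E5 by apply: bigsetU_measurable => i _; exact: measurable_low_set.
have pE1 : prob P E1 <= mean P (fun w => modulus_excess K (rescaled H (walk X) n ^~ w)) / e.
  by apply: (@mean_markov _ _ _ _ 1) => // w; exact: modulus_excess_itv.
have pE2 : prob P E2 <= n%:R * ((n %/ m)%N%:R * pt n e ^+ 2).
  apply: (@prob_bigcup_le _ (fun i : nat =>
    \big[setU/set0]_(q < n %/ m) (big i `&` big (i + q.+1)%N))) => // i _.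
  apply: (@prob_bigcup_le _ (fun q => big i `&` big (i + q.+1)%N)) => // q _.
  by rewrite /big prob_two_large// neq_ltn -addSnnS leq_addr.
have pE3 : prob P E3 <= (n %/ m).+1%:R * pt n e.
  apply: (@prob_bigcup_le _ (fun q => big (n.-1 - q)%N)) => // q _.
  by rewrite /big (prob_tail_id H Yid).
have pE4 : prob P E4 <= n%:R * pt n (e * N.+1%:R).
  apply: (@prob_bigcup_le _ (fun i => [set w | (e * N.+1%:R) * n%:R `^ H < Y i w])).
    by move=> i; exact: measurable_tail_set.
  by move=> i _; rewrite (prob_tail_id H Yid).
have pE5 : prob P E5 <= m.+1%:R * lowtail n.
  apply: (@prob_bigcup_le _ (fun j => [set w | Y (f j) w < - (e * n%:R `^ H)])).
    by move=> i; exact: measurable_low_set.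
  by move=> i _; rewrite prob_low_id.
exists (E1 `|` E2 `|` E3 `|` E4 `|` E5); split.
- by do 4 ?apply: measurableU.
- have mU12 : measurable (E1 `|` E2) by exact: measurableU.
  have mU123 : measurable (E1 `|` E2 `|` E3) by exact: measurableU.
  have mU1234 : measurable (E1 `|` E2 `|` E3 `|` E4) by exact: measurableU.
  rewrite /prelimit_bound.
  apply: le_trans (prob_setU P mU1234 mE5) _; apply: lerD => //.
  apply: le_trans (prob_setU P mU123 mE4) _; apply: lerD => //.
  apply: le_trans (prob_setU P mU12 mE3) _; apply: lerD => //.
  by apply: le_trans (prob_setU P mE1 mE2) _; apply: lerD.
move=> w /not_orP[/not_orP[/not_orP[/not_orP[nE1 nE2] nE3] nE4] nE5].
have bigE i : e < Y i w / n%:R `^ H -> big i w by rewrite ltr_pdivlMr.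
apply: (@prelimit_path_approx _ n m N (fun k => walk X k w / n%:R `^ H)
  (fun i => Y i w / n%:R `^ H) (fun k => perturbed_max X Y k w / n%:R `^ H)) => //.
- by rewrite /walk big_ord0 mul0r.
- by rewrite /= mul0r.
- by move=> i k ik; rewrite -mulrDl ler_pM2r ?invr_gt0//; exact: perturbed_max_ge.
- move=> k; have [i ik h] := perturbed_max_attained X Y k w.
  by exists i => //; rewrite h mulrDl.
- move=> s t s01 t01.
  apply: (@modulus_excess_lt _ K (rescaled H (walk X) n ^~ w) e e1 _ s t) => //.
  by rewrite ltNge; apply/negP.
- move=> j i i' ii iN ci ci' hi hi'; apply: nE2.
  suff : (\bigcup_(i < n) \big[setU/set0]_(q < n %/ m) (big i `&` big (i + q.+1)%N)) w.
    by rewrite bigcup_mkord.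
  exists i; first exact: ltn_trans ii iN.
  suff : (\bigcup_(q < n %/ m) (big i `&` big (i + q.+1)%N)) w by rewrite bigcup_mkord.
  have di : ((i' - i).-1.+1 = i' - i)%N by rewrite prednK// subn_gt0.
  exists (i' - i).-1.
    rewrite /= di leq_divRL// -(ler_nat R) natrM natrB ?(ltnW ii)//.
    case/andP: ci => ci _; case/andP: ci' => _ ci'.
    move: ci ci'; rewrite !mulrA ltr_pdivlMr// ler_pdivrMr// -!natr1.
    by move=> h1 h2; lra.
  by rewrite di subnKC ?(ltnW ii)//; split; exact: bigE.
- move=> i iN ci hi; apply: nE3.
  suff : (\bigcup_(q < (n %/ m).+1) big (n.-1 - q)%N) w by rewrite bigcup_mkord.
  have ile : (i <= n.-1)%N by rewrite -ltnS prednK.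
  exists (n.-1 - i)%N.
    rewrite /= ltnS leq_divRL// -(ler_nat R) natrM natrB// -!subn1 natrB//.
    case/andP: ci => ci _; move: ci.
    by rewrite mulrA ltr_pdivlMr// -natr1 -subn1 natrB// => h1; lra.
  have -> : (n.-1 - (n.-1 - i))%N = i by rewrite subKn.
  exact: bigE.
- move=> i iN; rewrite leNgt; apply/negP => hi; apply: nE4.
  suff : (\bigcup_(i < n) [set w | (e * N.+1%:R) * n%:R `^ H < Y i w]) w by rewrite bigcup_mkord.
  by exists i => //=; rewrite -ltr_pdivlMr.
- rewrite leNgt; apply/negP => hi; apply: nE5.
  suff : (\bigcup_(j < m.+1) [set w | Y (f j) w < - (e * n%:R `^ H)]) w by rewrite bigcup_mkord.
  by exists 0%N => //=; rewrite -mulNr -ltr_pdivrMr.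
- move=> j jm; rewrite leNgt; apply/negP => hi; apply: nE5.
  suff : (\bigcup_(j < m.+1) [set w | Y (f j) w < - (e * n%:R `^ H)]) w by rewrite bigcup_mkord.
  by exists j.+1 => //=; rewrite -mulNr -ltr_pdivrMr.
Qed.

End prelimit_bad_set.

(** * The invariance principle *)

Section sigma_families.
Context {R : realType} d (T : measurableType d).

(** With the generated sigma-algebra put on [T] in place of the ambient one, the measurability
    lemmas yield membership in [sigma_family]. *)
Lemma measurable_sigma_family (I : Type) (D : set I) (X : I -> T -> R) (i : I) : D i ->
  measurable_fun (setT : set (g_sigma_algebraType
    (\bigcup_(i in D) preimage_set_system setT (X i) (@measurable _ R)))) (X i).
Proof.
move=> Di _ A mA; rewrite setTI; apply: sub_gen_smallest.
by exists i => //; exists A; rewrite ?setTI.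
Qed.

Lemma rescaled_walk_bounded (X : nat -> T -> R) (H : R) n w : exists M,
  forall s : R, s \in `[0, 1] -> rescaled H (walk X) n s w <= M.
Proof.
exists (\sum_(k < n.+1) `|walk X k w / n%:R `^ H|) => s s01.
have sn : (Num.truncn (n%:R * s) < n.+1)%N by rewrite ltnS truncn_grid_le.
rewrite (bigD1 (Ordinal sn))//=; apply: le_trans (ler_norm _) _.
by rewrite lerDl sumr_ge0.
Qed.

Lemma measurable_discretize_walk (X : nat -> T -> R) (H dl K : R) m n c (F : D01 R -> R) :
  continuous F -> 0 <= K -> (forall i, measurable_fun setT (X i)) ->
  measurable_fun setT (fun w => F (discretize m dl K c (rescaled H (walk X) n ^~ w))).
Proof.
move=> cF K0 mX; apply: measurable_discretize => // t.
apply: measurable_sup_conv => // [s _|w|w].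
- exact: measurable_rescaled_walk.
- exact: cadlag_rescaled.
- exact: rescaled_walk_bounded.
Qed.

Lemma measurable_discretize_continuous (B : R -> T -> R) (dl K : R) m c (F : D01 R -> R) :
  continuous F -> 0 <= K -> (forall w, {within `[0, +oo[, continuous (B ^~ w)}) ->
  (forall t : R, t \in `[0, 1] -> measurable_fun setT (B t)) ->
  measurable_fun setT (fun w => F (discretize m dl K c (B ^~ w))).
Proof.
move=> cF K0 cB mB; apply: measurable_discretize => // t.
apply: measurable_sup_conv => // [w|w]; first exact: continuous_path_cadlag.
have [M BM] := continuous_path_bounded (@cB w); exists M => s s01.
by apply: le_trans (BM s s01); exact: ler_norm.
Qed.

End sigma_families.

Section invariance_principle.
Context {R : realType} (H kappa : R) (hH0 : 0 < H) (hkappa : 0 < kappa)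
    (d : measure_display) (T : measurableType d) (P : probability T R)
    (X Y : nat -> T -> R).
Hypotheses (mX : forall i, measurable_fun setT (X i))
    (mY : forall i, measurable_fun setT (Y i))
    (hXY : independent_sigma P (sigma_family setT X) (sigma_family setT Y)).
Context (d' : measure_display) (T' : measurableType d') (P' : probability T' R)
    (B : R -> T' -> R) (eta U : nat -> T' -> R).
Hypotheses (cB : forall w, {within `[0, +oo[, continuous (B ^~ w)})
    (hPPP : poisson_point_process P' point_space (jump_intensity H) eta U)
    (hBPPP : independent_sigma P' (sigma_family `[0, +oo[ B)
                                  (points_sigma point_space eta U))
    (hS : cvg_in_distr_D01 P P' (rescaled H (walk X)) B)
    (hYindep : mutually_independent P Y)
    (hYid : identically_distributed P Y)
    (hYtail : fine (P [set w | x < Y 0%N w]) / (kappa * x `^ (- H^-1))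
                @[x --> +oo] --> (1 : R)).

Let mB (t : R) : t \in `[0, 1] -> measurable_fun setT (B t).
Proof. by have [_ [+ _] _] := hS; exact. Qed.

Let S n := rescaled H (walk X) n.

Let continuous_modulus (K : R) : 0 <= K ->
  continuous (fun f : D01 R => modulus_excess K f).
Proof.
move=> K0; apply: (@J1_lipschitz_continuous _ (2 + 2 * K)) => f g e.
exact: modulus_excess_lipschitz.
Qed.

Lemma cvg_mean_modulus (K : R) : 0 <= K ->
  mean P (fun w => modulus_excess K (S n ^~ w)) @[n --> \oo] -->
  mean P' (fun w => modulus_excess K (B ^~ w)).
Proof.
move=> K0; have [_ _ h] := hS.
have bnd f : `|modulus_excess K f| <= 1.
  by have /andP[h1 h2] := modulus_excess_itv K f; rewrite ger0_norm.
have bD : exists M : R, forall f : D01 R, `|modulus_excess K f| <= M.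
  by exists 1 => f; exact: bnd.
have := h _ (continuous_modulus K0) bD.
rewrite (_ : (fun w => modulus_excess K (toD (B ^~ w))) =
    fun w => modulus_excess K (B ^~ w)); last first.
  by apply/funext => w; rewrite toDE//; exact: continuous_path_cadlag.
rewrite (meanE P' (fun w => bnd (B ^~ w))) => h1.
rewrite [X in X @ _ --> _](_ : _ = fine \o (fun n =>
    'E_P[fun w => modulus_excess K (toD (S n ^~ w))]%E)).
  exact: fine_cvg h1.
apply/funext => n; rewrite /mean /=; congr (fine ('E_P[_])); apply/funext => w.
by rewrite toDE//; exact: cadlag_rescaled.
Qed.

(** With [p] the tail probability at [e], the term for pairs is [(n p)^2] times [(n %/ m) / n],
    hence of order [1 / m] in the limit. The term for very negative perturbations disappears because
    their number [m.+1] does not grow with [n]. *)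
Lemma cvg_prelimit_bound m N (e K : R) : (0 < m)%N -> 0 < e -> 0 <= K ->
  prelimit_bound P H X Y m N e K n @[n --> \oo] -->
  mean P' (fun w => modulus_excess K (B ^~ w)) / e +
    tail H kappa e ^+ 2 / m%:R + tail H kappa e / m%:R + tail H kappa (e * N.+1%:R).
Proof.
move=> m0 e0 K0.
have np := ptail_cvg hH0 hkappa hYtail e0.
have p0 := ptail_cvg0 hH0 hkappa hYtail e0.
have nm : ((n %/ m)%N%:R / n%:R : R) @[n --> \oo] --> (m%:R^-1 : R).
  have := @cvg_divn_ratio R m 1 m0; rewrite mul1r.
  by under eq_fun do rewrite muln1.
have eN0 : 0 < e * N.+1%:R by rewrite mulr_gt0.
rewrite -[X in _ --> X]addr0; apply: cvgD; last first.
  by rewrite -(mulr0 (m.+1%:R)); apply: cvgM; [exact: cvg_cst|exact: left_tail_cvg0].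
apply: cvgD; last exact: ptail_cvg.
have n1 : \forall n \near \oo, (n%:R : R) != 0.
  by exists 1%N => // n /= n0; rewrite pnatr_eq0 -lt0n.
apply: cvgD; [apply: cvgD|].
- by apply: cvgM; [exact: cvg_mean_modulus|exact: cvg_cst].
- have h : (n%:R * ptail P H (Y 0%N) n e) * (n%:R * ptail P H (Y 0%N) n e) *
      ((n %/ m)%N%:R / n%:R) @[n --> \oo] --> tail H kappa e * tail H kappa e / m%:R.
    by apply: cvgM => //; exact: cvgM.
  rewrite expr2; apply: cvg_trans h; apply: near_eq_cvg; apply: filterS n1 => n n1.
  by field.
- have h : (n%:R * ptail P H (Y 0%N) n e) * ((n %/ m)%N%:R / n%:R) +
      ptail P H (Y 0%N) n e @[n --> \oo] --> tail H kappa e / m%:R + 0.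
    by apply: cvgD => //; exact: cvgM.
  rewrite -[X in _ --> X]addr0; apply: cvg_trans h; apply: near_eq_cvg.
  by apply: filterS n1 => n n1; rewrite -natr1; field.
Qed.

(** [K] makes the modulus of [B] small in mean, below [t * e] because of the division by [e]; [N] is
    taken from the decay of the tail, and [m] comes last. Each of the four terms is then at most
    [t]. *)
Lemma exists_parameters (e t : R) : 0 < e -> 0 < t -> exists (K : R) (N m : nat),
  [/\ 0 <= K, (0 < m)%N, K <= e * m%:R, 2 / m%:R < 7 * e &
    mean P' (fun w => modulus_excess K (B ^~ w)) / e +
    tail H kappa e ^+ 2 / m%:R + tail H kappa e / m%:R + tail H kappa (e * N.+1%:R)
    <= 4 * t].
Proof.
move=> e0 t0.
have cadB w : cadlag01 (B ^~ w) by exact: continuous_path_cadlag.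
have hK : mean P' (fun w => modulus_excess k%:R (B ^~ w)) @[k --> \oo] --> 0.
  rewrite -(mean_cst P' 0).
  apply: (@mean_cvg _ _ _ P' 1 (fun k w => modulus_excess k%:R (B ^~ w)) (fun=> 0)) => //.
  - by move=> k; exact: measurable_modulus_excess.
  - move=> k w; have /andP[h1 h2] := modulus_excess_itv k%:R (B ^~ w).
    by rewrite ger0_norm.
  - by move=> w; exact: continuous_path_modulus.
have et : 0 < t * e by rewrite mulr_gt0.
have [k hk] : exists k : nat, mean P' (fun w => modulus_excess k%:R (B ^~ w)) <= t * e.
  have /cvgrPdist_le/(_ _ et)[k _ /(_ k (leqnn k)) /=] := hK.
  rewrite sub0r normrN => h; exists k; apply: le_trans h; exact: ler_norm.
have [N hN] : exists N : nat, tail H kappa (e * N.+1%:R) <= t.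
  have p0 : 0 < H^-1 by rewrite invr_gt0.
  have tk : 0 < t / kappa by rewrite divr_gt0.
  have /cvgrPdist_le/(_ _ tk)[A [_ hA]] := powRN_cvg0 p0.
  exists (Num.truncn (A / e)).
  have /hA : A < e * (Num.truncn (A / e)).+1%:R.
    by rewrite mulrC -ltr_pdivrMr//; exact: truncnS_gt.
  rewrite sub0r normrN ger0_norm ?powR_ge0// ler_pdivlMr// mulrC; exact.
(* The sum of the lower bounds on [m] coming from the two grid conditions and from the two terms
   divided by [m]. *)
pose D := k%:R / e + 2 / (7 * e) + tail H kappa e ^+ 2 / t + tail H kappa e / t.
have te0 : 0 <= tail H kappa e by rewrite mulr_ge0 ?powR_ge0// ltW.
have D1 : 0 <= k%:R / e by rewrite divr_ge0// ltW.
have D2 : 0 <= 2 / (7 * e) by rewrite divr_ge0 ?mulr_ge0// ltW.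
have D3 : 0 <= tail H kappa e ^+ 2 / t by rewrite divr_ge0 ?exprn_ge0// ltW.
have D4 : 0 <= tail H kappa e / t by rewrite divr_ge0// ltW.
pose m := (Num.truncn D).+1.
have Dm : D < m%:R by exact: truncnS_gt.
have mR : 0 < m%:R :> R by [].
exists k%:R, N, m; split => //.
- by rewrite mulrC -ler_pdivrMr//; move: Dm; rewrite /D; lra.
- rewrite ltr_pdivrMr// -ltr_pdivrMl ?mulr_gt0//.
  by rewrite mulrC; move: Dm; rewrite /D; lra.
have h1 : mean P' (fun w => modulus_excess k%:R (B ^~ w)) / e <= t by rewrite ler_pdivrMr.
have h2 : tail H kappa e ^+ 2 / m%:R <= t.
  by rewrite ler_pdivrMr// mulrC -ler_pdivrMr//; move: Dm; rewrite /D; lra.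
have h3 : tail H kappa e / m%:R <= t.
  by rewrite ler_pdivrMr// mulrC -ler_pdivrMr//; move: Dm; rewrite /D; lra.
lra.
Qed.

Lemma perturbed_max_approximable (e : R) : 0 < e ->
  J1_approximable P P' (rescaled H (perturbed_max X Y)) (Z_process H kappa B eta U) e.
Proof.
(* [e1 <= 1] keeps the cap of [modulus_excess] inactive, and [7 * e1 <= e] absorbs the factor of the
   pathwise comparison. With [t = e / 8] the limiting bound is [e / 2], which leaves room for the
   convergence error. *)
move=> eps0; pose e1 := Num.min 1 (e / 7).
have e10 : 0 < e1 by rewrite lt_min ltr01 divr_gt0.
have e1le : e1 <= 1 by rewrite ge_min lexx.
have e17 : 7 * e1 <= e by rewrite mulrC -ler_pdivlMr// ge_min lexx orbT.
have t0 : 0 < e / 8 by rewrite divr_gt0.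
have [K [N [m [K0 m0 Km me bnd]]]] := exists_parameters e10 t0.
have cadS n w : cadlag01 (S n ^~ w) by exact: cadlag_rescaled.
have cadB w : cadlag01 (B ^~ w) by exact: continuous_path_cadlag.
have [E' [mE' pE' hE']] := limit_bad_set hH0 hkappa hPPP cB mB N m0 e10 e1le K0 Km me.
have /choice[E hE] : forall n, exists E, [/\ measurable E,
    (m <= n)%N -> prob P E <= prelimit_bound P H X Y m N e1 K n &
    forall w, ~ E w -> J1_ball
      (discretize m e1 K (prelimit_levels m N e1 H Y n w) (S n ^~ w)) e
      (rescaled H (perturbed_max X Y) n ^~ w)].
  (* For the finitely many [n < m] the whole space serves as exceptional event. *)
  move=> n; have [mn|nm] := leqP m n; last first.
    by exists setT; split => // w /(_ I).
  have [E [mE pE h]] := prelimit_bad_set H mX mY hYindep hYid N m0 e10 e1le K0 Km me mn.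
  by exists E; split => // w /h; exact: J1_ball_le.
exists (fun n w => discretize m e1 K (prelimit_levels m N e1 H Y n w) (S n ^~ w)).
exists (fun w => discretize m e1 K (limit_levels H kappa eta U m N e1 w) (B ^~ w)).
exists E, E'; split.
- by move=> n; have [] := hE n.
- by move=> w /hE'; exact: J1_ball_le.
- by split => // n; have [] := hE n.
- split; last by apply: le_trans pE' (le_trans bnd _); lra.
  have /cvgrPdist_le/(_ _ t0) cv := cvg_prelimit_bound (N := N) m0 e10 K0.
  near=> n.
  have mn : (m <= n)%N by near: n; exact: nbhs_infty_ge.
  have [_ /(_ mn) h _] := hE n; apply: le_trans h _.
  have : `|mean P' (fun w => modulus_excess K (B ^~ w)) / e1 +
    tail H kappa e1 ^+ 2 / m%:R + tail H kappa e1 / m%:R + tail H kappa (e1 * N.+1%:R) -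
    prelimit_bound P H X Y m N e1 K n| <= e / 8 by near: n.
  by rewrite ler_norml; move: bnd; lra.
move=> F L M FL FM; have cF := J1_lipschitz_continuous FL.
have mC n j k : measurable [set w | (prelimit_levels m N e1 H Y n w j <= k)%N].
  exact: measurable_prelimit_levels.
have mC' j k : measurable [set w | (limit_levels H kappa eta U m N e1 w j <= k)%N].
  by apply: (measurable_limit_levels hkappa hPPP).
have CN n w j : (prelimit_levels m N e1 H Y n w j <= N)%N by exact: prelimit_levels_le.
have CN' w j : (limit_levels H kappa eta U m N e1 w j <= N)%N by exact: limit_levels_le.
have Cc k : prob P (orthant m (prelimit_levels m N e1 H Y n) k) @[n --> \oo] -->
    prob P' (orthant m (limit_levels H kappa eta U m N e1) k).
  by rewrite (prob_limit_orthant hH0 hkappa hPPP)//; exact: cvg_prelimit_orthant.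
have mFS n c : measurable_fun setT (fun w => F (discretize m e1 K c (S n ^~ w))).
  exact: measurable_discretize_walk.
have mFB c : measurable_fun setT (fun w => F (discretize m e1 K c (B ^~ w))).
  exact: measurable_discretize_continuous.
have iS n c k : mean P (fun w => F (discretize m e1 K c (S n ^~ w)) *
      \1_(cell m (prelimit_levels m N e1 H Y n) k) w) =
    mean P (fun w => F (discretize m e1 K c (S n ^~ w))) *
    prob P (cell m (prelimit_levels m N e1 H Y n) k).
  apply: (mean_independent hXY (mFS n c) (M := M)) => //.
  - move=> a b; rewrite -[X in sigma_family _ _ X]setTI.
    (* On [T] with the sigma-algebra generated by [X], measurability is the required membership of
       the preimages. *)
    apply: (@measurable_discretize_walk _ _ (g_sigma_algebraType
      (\bigcup_(i in [set: nat]) preimage_set_system setT (X i) (@measurable _ R)))) => //.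
    + by move=> i; exact: measurable_sigma_family.
  - apply: (@measurable_cell _ (g_sigma_algebraType
      (\bigcup_(i in [set: nat]) preimage_set_system setT (Y i) (@measurable _ R)))) => j l.
    by apply: measurable_prelimit_levels => // i; exact: measurable_sigma_family.
  - exact: measurable_cell.
have iB c k : mean P' (fun w => F (discretize m e1 K c (B ^~ w)) *
      \1_(cell m (limit_levels H kappa eta U m N e1) k) w) =
    mean P' (fun w => F (discretize m e1 K c (B ^~ w))) *
    prob P' (cell m (limit_levels H kappa eta U m N e1) k).
  apply: (mean_independent hBPPP (mFB c) (M := M)) => //.
  - move=> a b; rewrite -[X in sigma_family _ _ X]setTI.
    apply: (@measurable_discretize_continuous _ _ (g_sigma_algebraType
      (\bigcup_(i in `[0, +oo[) preimage_set_system setT (B i) (@measurable _ R)))) => //.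
    + move=> t; rewrite in_itv /= => /andP[t0' _]; apply: measurable_sigma_family.
      by rewrite /= in_itv /= t0'.
  - exact: points_sigma_cell.
  - exact: measurable_cell.
split.
- by move=> n; have [] := mean_discretize (mC n) (CN n) cF FM (mFS n) (iS n).
- by have [] := mean_discretize mC' CN' cF FM mFB iB.
- exact: (cvg_mean_discretize mC mC' CN CN' Cc K0 hS cadS cadB FL FM mFS mFB iS iB).
Unshelve. all: by end_near. Qed.

Lemma invariance_principle : cvg_in_distr_D01 P P'
    (rescaled H (perturbed_max X Y)) (Z_process H kappa B eta U).
Proof.
have [mEU S0 _ _ _] := hPPP.
have cW n w : cadlag01 (rescaled H (perturbed_max X Y) n ^~ w) by exact: cadlag_rescaled.
split.
- move=> n; split; first by move=> t _; exact: measurable_rescaled_perturbed_max.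
  exact: aeW.
- split; last exact: (ae_cadlag_limit perturbed_max_approximable).
  move=> t t01; apply: measurable_limit_path => //.
  + exact: powR_gt0.
  + by move=> i; have [] := mEU i.
  + by move=> i; have [] := mEU i.
  + by move=> i w; have [+ _] := S0 i w; rewrite /= in_itv /= andbT.
  + by move=> i w; have [_] := S0 i w; rewrite /= in_itv /= andbT.
- move=> F cF bF; exact: (cvg_expectation_approximable cW perturbed_max_approximable).
Qed.

End invariance_principle.

Theorem theorem1 (R : realType) (H kappa : R) (hH0 : 0 < H) (hH1 : H < 1)
    (hkappa : 0 < kappa)
    (d : measure_display) (T : measurableType d) (P : probability T R)
    (X Y : nat -> {RV P >-> R})
    (hXY : independent_sigma P (sigma_family setT (fun n => X n : T -> R))
                               (sigma_family setT (fun n => Y n : T -> R)))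
    (d' : measure_display) (T' : measurableType d') (P' : probability T' R)
    (B : R -> T' -> R) (eta U : nat -> T' -> R)
    (hB : fractional_brownian_motion P' H B)
    (hPPP : poisson_point_process P' point_space (jump_intensity H) eta U)
    (hBPPP : independent_sigma P' (sigma_family `[0, +oo[ B)
                                  (points_sigma point_space eta U))
    (hS : cvg_in_distr_D01 P P' (rescaled H (walk (fun n => X n : T -> R))) B)
    (hYindep : mutually_independent P (fun n => Y n : T -> R))
    (hYid : identically_distributed P (fun n => Y n : T -> R))
    (hYtail : fine (P [set w | x < Y 0%N w]) / (kappa * x `^ (- H^-1))
                @[x --> +oo] --> (1 : R)) :
  cvg_in_distr_D01 P P'
    (rescaled H (perturbed_max (fun n => X n : T -> R) (fun n => Y n : T -> R)))
    (Z_process H kappa B eta U).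
Proof.
have [_ _ _ cB] := hB.
have mX i : measurable_fun setT (X i) by exact: measurable_funPT.
have mY i : measurable_fun setT (Y i) by exact: measurable_funPT.
exact: (invariance_principle hH0 hkappa mX mY hXY cB hPPP hBPPP hS hYindep hYid hYtail).
Qed.
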